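(* Let $I$ be an interval and let $(\Omega_\varepsilon)_{\varepsilon\in I}$ be an analytic family of strictly convex analytic planar domains. Then, given a pair $(m,n)\in\mathbb{Z}\times\mathbb{N}^{*}$ of coprime integers such that $m/n\in(0,1)$, the set of $\varepsilon\in I$ such that the symplectic billiard map associated to $\Omega_\varepsilon$ has an $(m,n)$-periodic invariant curve is either finite or consists of the whole $I$.
   Context: Analytic family: the domains are bounded with analytic boundary, and there is an analytic map $(\varepsilon,t)\in I\times\mathbb{R}\mapsto\gamma_\varepsilon(t)\in\mathbb{R}^2$, $1$-periodic in $t$, such that each $\gamma_\varepsilon$ is a regular (counterclockwise) parametrization of $\partial\Omega_\varepsilon$. Symplectic billiard: let $\Omega$ be strictly convex, bounded, with smooth boundary parametrized by a $1$-periodic $\gamma:\mathbb{R}\to\mathbb{R}^2$, and let $\omega=dx\wedge dy$ be the canonical symplectic form on $\mathbb{R}^2$. For $t\in\mathbb{R}$ let $t^*\in(t,t+1)$ be the unique parameter such that the tangent lines to $\partial\Omega$ at $\gamma(t)$ and $\gamma(t^* )$ are parallel. Let $\mathcal{P}=\{(t_1,t_2)\in\mathbb{R}^2: t_1<t_2<t_1^*\}$. The symplectic billiard map is $F:\mathcal{P}\to\mathcal{P}$, $F(t_1,t_2)=(t_2,t_3)$, where $t_2<t_3<t_2^*$ and $\gamma(t_3)$ is the point such that the line through $\gamma(t_1)$ and $\gamma(t_3)$ is parallel to the tangent line to $\partial\Omega$ at $\gamma(t_2)$. In the coordinates $(t,s)$, $t=t_1$, $s=\omega(\gamma'(t_1),\gamma(t_2))$,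 it becomes a map, still denoted $F$, of $\mathbb{A}_{s^\pm}=\{(t,s): s^-(t)<s<s^+(t)\}$ to itself, where $s^-(t)=\omega(\gamma'(t),\gamma(t))$ and $s^+(t)=\omega(\gamma'(t),\gamma(t^* ))$. $(m,n)$-periodic invariant curve: the graph $\Gamma=\{(t,\eta(t)): t\in\mathbb{R}\}\subset\mathbb{A}_{s^\pm}$ of a $1$-periodic Lipschitz continuous function $\eta:\mathbb{R}\to\mathbb{R}$ with $F(\Gamma)\subseteq\Gamma$ and $F^n(t,\eta(t))=(t+m,\eta(t))$ for all $t\in\mathbb{R}$.
   Formalization: ''Finite or the whole I'' is proved for compact intervals I; for a general interval, where it can fail (e.g. r < 1 + d sin(ε)cos(3θ) on I = R), the set is either all of I or meets every compact subset of I in a finite set. *)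

(* Defs.v *)
(* The plane is R * R, with the product topology, for an arbitrary
   R : realType. *)
From HB Require Import structures.
From mathcomp Require Export all_boot all_order all_algebra.
From mathcomp Require Export all_classical all_reals all_analysis.

Set Implicit Arguments.
Unset Strict Implicit.
Unset Printing Implicit Defensive.

Export Order.TTheory GRing.Theory Num.Theory.
Export numFieldNormedType.Exports.

Local Open Scope classical_set_scope.
Local Open Scope ring_scope.

Section plane.
Variable R : realType.
Implicit Types (D O : set (R * R)) (c : R -> R * R).

(* omega = dx /\ dy *)
Definition omega (u v : R * R) : R := u.1 * v.2 - u.2 * v.1.

Definition frontier D : set (R * R) := closure D `\` D°.

(* [D] need not be open: at a point of [D] that is not interior, [f] has to
   agree with the sum of a convergent power series at the nearby points of [D].
   The double series is summed by total degree; absolute convergence makes the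
   order of summation irrelevant. *)
Definition analytic_on D (f : R * R -> R) : Prop :=
  forall p, D p -> exists a : nat -> nat -> R, exists2 r : R, 0 < r &
    forall q, ball p r q ->
      let term i j := a i j * (q.1 - p.1) ^+ i * (q.2 - p.2) ^+ j in
      cvgn (series (fun d => \sum_(i < d.+1) `|term i (d - i)%N|)) /\
      (D q -> series (fun d => \sum_(i < d.+1) term i (d - i)%N) @ \oo --> f q).

(* For an open [O]: no segment joining two points of the closure lies in the
   boundary.  The curvature of the boundary may vanish at some points. *)
Definition strictly_convex_domain O : Prop :=
  [/\ open O, O !=set0 &
      forall x y, closure O x -> closure O y -> x != y ->
        forall l : R, 0 < l < 1 -> O (l *: x + (1 - l) *: y)].

(* The last clause is the counterclockwise orientation: the left normal
   (- c'_2, c'_1) points into the domain. *)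
Definition ccw_parametrization O c : Prop :=
  [/\ periodic c 1,
      forall t, derivable c t 1 /\ derive1 c t != 0,
      forall t u, c t = c u -> exists k : int, u = t + k%:~R,
      range c = frontier O &
      forall t, \forall h \near 0^'+,
        O (c t + h *: (- (derive1 c t).2, (derive1 c t).1))].

Definition analytic_family (I : set R) (Omega : R -> set (R * R))
    (gamma : R -> R -> R * R) : Prop :=
  [/\ forall e, I e -> bounded_set (Omega e),
      analytic_on (I `*` setT) (fun p => (gamma p.1 p.2).1),
      analytic_on (I `*` setT) (fun p => (gamma p.1 p.2).2) &
      forall e, I e -> ccw_parametrization (Omega e) (gamma e)].

Section symplectic_billiard.
Variable c : R -> R * R.

(* In this section [get] selects an element that is unique when [c]
   parametrizes the boundary of a bounded strictly convex domain. *)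

(* The parameter t* of the point with parallel tangent. *)
Definition opposite (t : R) : R :=
  get [set u | t < u < t + 1 /\ omega (derive1 c t) (derive1 c u) = 0].

Definition phase_space : set (R * R) :=
  [set p | p.1 < p.2 < opposite p.1].

Definition billiard (p : R * R) : R * R :=
  (p.2, get [set u | p.2 < u < opposite p.2 /\
                     omega (derive1 c p.2) (c u - c p.1) = 0]).

Definition to_ts (p : R * R) : R * R := (p.1, omega (derive1 c p.1) (c p.2)).

Definition of_ts (q : R * R) : R * R :=
  get [set p | phase_space p /\ to_ts p = q].

Definition billiard_ts (q : R * R) : R * R := to_ts (billiard (of_ts q)).

Definition annulus : set (R * R) :=
  [set q | omega (derive1 c q.1) (c q.1) < q.2 <
           omega (derive1 c q.1) (c (opposite q.1))].

Definition graph_of (eta : R -> R) : set (R * R) :=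
  range (fun t => (t, eta t)).

Definition periodic_invariant_curve (m : int) (n : nat) (eta : R -> R) : Prop :=
  [/\ periodic eta 1,
      lipschitz eta,
      graph_of eta `<=` annulus,
      billiard_ts @` graph_of eta `<=` graph_of eta &
      forall t, iter n billiard_ts (t, eta t) = (t + m%:~R, eta t)].

End symplectic_billiard.

Definition parameters_with_curve (I : set R) (gamma : R -> R -> R * R)
    (m : int) (n : nat) : set R :=
  [set e | I e /\ exists eta, periodic_invariant_curve (gamma e) m n eta].

End plane.

(* Main.v *)
From HB Require Import structures.
Require Import Defs.
From mathcomp Require Import ring lra zify.

(** Let [S] be the set of parameters with an [(m, n)]-periodic invariant curve.  Its
    limit points in [I] form a closed subset of [I], and also an open one, because
    all parameters of [I] near such a limit point belong to [S].  As [I] is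
    connected, either [S] has no limit point in [I], and then it meets each compact
    part of [I] in a finite set, or every point of [I] is a limit point, and then
    [S = I].  The heart of the matter is what happens near a limit point
    (curves_near_limit_point).

    An invariant curve is the same thing as an increasing circle map [g] whose
    orbits are billiard orbits and whose [n]-th iterate is the translation by [m]
    (Lemmas circle_map_of_curve, curve_of_circle_map).  The successive points
    [x, y, z] of an orbit satisfy [omega (c' y) (c z - c x) = 0], and strict convexity
    makes the left-hand side strictly monotone in [x] and in [z] on the phase space:
    the twist property (twist_unique).

    Let [e0] be a limit point of [S].  Along an ultrafilter of parameters of [S] that
    converges to [e0], all points of all orbits converge, and by the twist property
    the limits are again the orbits of one circle map [g0] for the parameter [e0]
    (ultralimit_circle_map).  The strict inequalities of the phase space survive in
    the limit because [m] is positive and smaller than [n / 2].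

    The orbits of [g0] continue to all nearby parameters, with the starting point
    kept fixed (local_continuation).  All billiard equations but the one at the
    starting point can be solved by the implicit function theorem: the linearized
    equations form a cyclic Jacobi system with positive off-diagonal coefficients,
    the orbits of [g0] provide a positive solution of it, and comparison with that
    solution excludes a nonzero solution that vanishes at the starting point
    (jacobi_trivial).  The remaining equation then says that an analytic function of
    the parameter vanishes, which it does at the infinitely many parameters of [S]
    near [e0], hence identically (poly_norm_identity).  By compactness of the circle
    the construction is uniform in the starting point; by uniqueness the new orbits
    are the orbits of one circle map, and by Lipschitz dependence on the starting
    point its curve is Lipschitz (curve_near).

    Analyticity enters through first order expansions with remainder, stated once
    for every norm on an algebra of functions that is closed under pointwise limits
    (function_norm, analytic_at_jet).  Three such norms are used: the supremum norm
    for continuity, the norm of absolutely convergent power series in the parameter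
    for analytic dependence, and the Lipschitz norm on two points for uniqueness and
    contraction.  One computation (newton_ball) shows that a simplified Newton step
    maps a ball into a smaller one for all of them. *)

Set Implicit Arguments.
Unset Strict Implicit.
Unset Printing Implicit Defensive.

Local Open Scope classical_set_scope.
Local Open Scope ring_scope.

(** * Normed algebras of functions *)

Section function_norm.
Variable R : realType.

(** [N f M] reads: the norm of [f] is at most [M].  Only the values on [D]
    matter.  Closure under pointwise limits is what makes analyticity of a limit
    of iterates automatic, without any completeness argument. *)
Record function_norm (T : Type) (D : set T) (N : (T -> R) -> R -> Prop) : Prop :=
  FunctionNorm {
    norm_cst : forall a : R, N (fun=> a) `|a|;
    norm_add : forall f g A B, N f A -> N g B -> N (fun x => f x + g x) (A + B);
    norm_mul : forall f g A B, N f A -> N g B -> N (fun x => f x * g x) (A * B);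
    norm_lim : forall (f : nat -> T -> R) g M, (forall k, N (f k) M) ->
      (forall x, D x -> f ^~ x @ \oo --> g x) -> N g M;
    norm_le : forall f A B, A <= B -> N f A -> N f B;
    norm_bound : forall f M x, N f M -> D x -> `|f x| <= M }.

Section theory.
Variables (T : Type) (D : set T) (N : (T -> R) -> R -> Prop).
Hypothesis NN : function_norm D N.

Lemma norm_ext f g M : (forall x, D x -> f x = g x) -> N f M -> N g M.
Proof.
move=> fg Nf; apply: (norm_lim NN (f := fun=> f)) => // x Dx.
by rewrite -fg//; exact: cvg_cst.
Qed.

Lemma norm_cstM a f M : N f M -> N (fun x => a * f x) (`|a| * M).
Proof. by move=> Nf; apply: (norm_mul NN) => //; exact: (norm_cst NN). Qed.

Lemma norm_opp f M : N f M -> N (fun x => - f x) M.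
Proof.
move=> /(norm_cstM (-1)); rewrite normrN1 mul1r.
by apply: norm_ext => x _; rewrite mulN1r.
Qed.

Lemma norm_sub f g A B : N f A -> N g B -> N (fun x => f x - g x) (A + B).
Proof. by move=> Nf /norm_opp Ng; exact: (norm_add NN). Qed.

Lemma norm_exp f M k : N f M -> N (fun x => f x ^+ k) (M ^+ k).
Proof.
move=> Nf; elim: k => [|k IHk].
  apply: (norm_le NN (A := `|1|)); first by rewrite normr1 expr0.
  by apply: norm_ext (norm_cst NN 1) => x _; rewrite expr0.
rewrite exprS; apply: norm_ext (norm_mul NN Nf IHk) => x _.
by rewrite exprS.
Qed.

Lemma norm_sum (J : Type) (s : seq J) (f : J -> T -> R) (M : J -> R) :
  (forall j, N (f j) (M j)) ->
  N (fun x => \sum_(j <- s) f j x) (\sum_(j <- s) M j).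
Proof.
move=> Nf; elim: s => [|j s IHs].
  rewrite big_nil; apply: (norm_le NN (A := `|0|)); first by rewrite normr0.
  by apply: norm_ext (norm_cst NN 0) => x _; rewrite big_nil.
rewrite big_cons; apply: norm_ext (norm_add NN (Nf j) IHs) => x _.
by rewrite big_cons.
Qed.

End theory.
End function_norm.

(** * Double power series summed by total degree *)

Section double_series.
Variable R : realType.
Implicit Types (a F G : nat -> nat -> R) (rho M s y : R).

Definition psum n F : R := \sum_(d < n) \sum_(i < d.+1) F i (d - i)%N.

Lemma eq_psum n F G : (forall i j, F i j = G i j) -> psum n F = psum n G.
Proof.
by move=> FG; apply: eq_bigr => d _; apply: eq_bigr => i _; rewrite FG.
Qed.

Lemma psumD n F G : psum n (fun i j => F i j + G i j) = psum n F + psum n G.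
Proof.
rewrite /psum -big_split/=; apply: eq_bigr => d _.
by rewrite -big_split.
Qed.

Lemma psumZ n b F : psum n (fun i j => b * F i j) = b * psum n F.
Proof.
rewrite /psum big_distrr/=; apply: eq_bigr => d _.
by rewrite big_distrr.
Qed.

Lemma psumB n F G : psum n (fun i j => F i j - G i j) = psum n F - psum n G.
Proof.
rewrite -[- psum n G]mulN1r -psumZ -psumD; apply: eq_psum => i j.
by rewrite mulN1r.
Qed.

Lemma ler_psum n F G : (forall i j, F i j <= G i j) -> psum n F <= psum n G.
Proof.
by move=> FG; apply: ler_sum => d _; apply: ler_sum => i _; exact: FG.
Qed.

Lemma ler_norm_psum n F : `|psum n F| <= psum n (fun i j => `|F i j|).
Proof.
apply: le_trans (ler_norm_sum _ _ _) _; apply: ler_sum => d _.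
exact: ler_norm_sum.
Qed.

(** The degree drops by one when a factor [y] is taken out, which shifts the
    partial sums. *)
Lemma psum_shift n F : (forall i, F i 0%N = 0) ->
  psum n.+1 F = psum n (fun i j => F i j.+1).
Proof.
move=> F0; rewrite /psum big_ord_recl big_ord1 subn0 F0 add0r.
apply: eq_bigr => d _; rewrite big_ord_recr/= subnn F0 addr0.
by apply: eq_bigr => i _; rewrite subSn// -ltnS.
Qed.

Lemma psum_jet n F : (forall i j, (0 < i)%N || (1 < j)%N -> F i j = 0) ->
  psum n.+2 F = F 0%N 0%N + F 0%N 1%N.
Proof.
move=> F0; elim: n => [|n IHn].
  by rewrite /psum !big_ord_recr !big_ord0/= !add0r (F0 1%N)// addr0.
rewrite /psum big_ord_recr/=; rewrite /psum in IHn; rewrite IHn.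
rewrite [X in _ + X]big1 ?addr0// => i _; apply: F0.
by case: i => [[|i] ?].
Qed.

Definition summable2 a rho M :=
  forall n, psum n (fun i j => `|a i j| * rho ^+ (i + j)) <= M.

Definition psval a (s y : R) : R :=
  lim (psum n (fun i j => a i j * s ^+ i * y ^+ j) @[n --> \oo]).

Lemma summable2_le a rho rho' M : 0 <= rho' <= rho ->
  summable2 a rho M -> summable2 a rho' M.
Proof.
move=> /andP[r0 rr] aM n; apply: le_trans (aM n); apply: ler_psum => i j.
by apply: ler_wpM2l => //; rewrite lerXn2r ?nnegrE// (le_trans r0).
Qed.

Lemma psval_cvg a rho M s y : summable2 a rho M -> `|s| <= rho ->
  `|y| <= rho ->
  psum n (fun i j => a i j * s ^+ i * y ^+ j) @[n --> \oo] --> psval a s y.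
Proof.
move=> aM sr yr.
pose u d := \sum_(i < d.+1) (a i (d - i)%N * s ^+ i * y ^+ (d - i)).
have -> : (fun n => psum n (fun i j => a i j * s ^+ i * y ^+ j)) = series u.
  by apply/funext => n; rewrite /series/= big_mkord.
suff : cvgn (series u).
  move=> cu; rewrite /psval.
  have -> : (fun n => psum n (fun i j => a i j * s ^+ i * y ^+ j)) = series u.
    by apply/funext => n; rewrite /series/= big_mkord.
  exact: cu.
apply: normed_cvg; apply: nondecreasing_is_cvgn.
  apply/nondecreasing_seqP => n.
  by rewrite [leRHS]seriesSr lerDl normr_ge0.
exists M => _ [n _ <-]; apply: le_trans (aM n).
rewrite (_ : [normed series u] n = \sum_(d < n) `|u d|); last first.
  by rewrite -[LHS]/(series (fun d => `|u d|) n) seriesEord.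
apply: ler_sum => d _.
apply: le_trans (ler_norm_sum _ _ _) _; apply: ler_sum => i _.
rewrite !normrM !normrX -mulrA exprD; apply: ler_wpM2l => //.
have r0 : 0 <= rho by exact: le_trans sr.
by apply: ler_pM; rewrite ?exprn_ge0// lerXn2r ?nnegrE.
Qed.

Lemma psval0 a : psval a 0 0 = a 0%N 0%N.
Proof.
apply/cvg_lim => //; rewrite -(cvg_shiftn 2).
apply: cvg_near_cst; apply: nearW => n /=.
rewrite addn2 psum_jet/= => [|[|i] [|j]]; rewrite ?expr0 ?mulr1 ?expr1 ?mulr0 ?addr0//.
  by rewrite expr0n/= mulr0.
  by rewrite exprS mul0r mulr0.
by rewrite exprS mul0r mulr0 mul0r.
Qed.

Section norm.
Variables (T : Type) (D : set T) (N : (T -> R) -> R -> Prop).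
Hypothesis NN : function_norm D N.
Variables (s y : T -> R) (sigma r : R).
Hypotheses (Ns : N s sigma) (Ny : N y r).

Lemma norm_psum a n :
  N (fun x => psum n (fun i j => a i j * s x ^+ i * y x ^+ j))
    (psum n (fun i j => `|a i j| * sigma ^+ i * r ^+ j)).
Proof.
apply: (norm_sum NN) => d; apply: (norm_sum NN) => i.
by apply: (norm_mul NN); [apply: (norm_cstM NN)|]; exact: (norm_exp NN).
Qed.

Variables (a : nat -> nat -> R) (rho M : R).
Hypotheses (rho_gt0 : 0 < rho) (aM : summable2 a rho M).
Hypotheses (sigma_ge0 : 0 <= sigma) (r_ge0 : 0 <= r).
Hypotheses (sigma_rho : sigma <= rho) (r_rho : r <= rho).

(** Every monomial of the remainder contains either a factor [s] or two
    factors [y], hence is smaller than its bound at radius [rho] by a factor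
    [sigma / rho] or [(r / rho) ^+ 2]. *)
Lemma norm_psval_jet :
  N (fun x => psval a (s x) (y x) - a 0%N 0%N - a 0%N 1%N * y x)
    ((sigma / rho + (r / rho) ^+ 2) * M).
Proof.
pose b i j := if (0 < i)%N || (1 < j)%N then a i j else 0.
pose c i j := if (0 < i)%N || (1 < j)%N then 0 else a i j.
apply: (norm_lim NN
  (f := fun n x => psum n.+2 (fun i j => b i j * s x ^+ i * y x ^+ j))).
  move=> n; apply: (norm_le NN) (norm_psum b n.+2).
  have k0 : 0 <= sigma / rho + (r / rho) ^+ 2.
    by rewrite addr_ge0 ?sqr_ge0// divr_ge0// ltW.
  apply: le_trans (ler_wpM2l k0 (aM n.+2)); rewrite -psumZ.
  apply: ler_psum => i j; rewrite /b; case: ifP => ij; last first.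
    by rewrite normr0 !mul0r mulr_ge0// mulr_ge0// exprn_ge0// ltW.
  rewrite mulrCA -mulrA; apply: ler_wpM2l => //.
  have -> : sigma ^+ i * r ^+ j =
      ((sigma / rho) ^+ i * (r / rho) ^+ j) * rho ^+ (i + j).
    by rewrite exprD mulrACA -!exprMn !mulfVK// gt_eqF.
  apply: ler_wpM2r; first by rewrite exprn_ge0// ltW.
  have u0 : 0 <= sigma / rho by rewrite divr_ge0// ltW.
  have u1 : sigma / rho <= 1 by rewrite ler_pdivrMr// mul1r.
  have v0 : 0 <= r / rho by rewrite divr_ge0// ltW.
  have v1 : r / rho <= 1 by rewrite ler_pdivrMr// mul1r.
  case: i ij => [|i] ij.
    rewrite expr0 mul1r; apply: (@le_trans _ _ ((r / rho) ^+ 2)).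
      by case: j ij => [|[|j]]//= _; rewrite -(addn2 j) exprD ler_piMl ?sqr_ge0 ?exprn_ile1.
    by rewrite lerDr.
  apply: (@le_trans _ _ (sigma / rho)); last by rewrite lerDl sqr_ge0.
  rewrite exprS -mulrA ler_piMr// mulr_ile1 ?exprn_ge0 ?exprn_ile1//.
move=> x Dx.
have -> : (fun n => psum n.+2 (fun i j => b i j * s x ^+ i * y x ^+ j)) =
    (fun n => psum n.+2 (fun i j => a i j * s x ^+ i * y x ^+ j)
       - (a 0%N 0%N + a 0%N 1%N * y x)).
  apply/funext => n.
  have -> : a 0%N 0%N + a 0%N 1%N * y x =
      psum n.+2 (fun i j => c i j * s x ^+ i * y x ^+ j).
    rewrite psum_jet /c/= ?expr0 ?expr1 ?mulr1// => i j -> /=.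
    by rewrite !mul0r.
  rewrite -psumB; apply: eq_psum => i j; rewrite /b /c.
  by case: ifP => _; rewrite !mul0r ?subr0 ?subrr.
rewrite -addrA -opprD; apply: cvgB; last exact: cvg_cst.
have := @psval_cvg a rho M (s x) (y x) aM.
rewrite -(cvg_shiftn 2) => /(_ _ _).
under eq_fun do rewrite addn2.
apply.
  by apply: le_trans sigma_rho; exact: (norm_bound NN Ns).
by apply: le_trans r_rho; exact: (norm_bound NN Ny).
Qed.

End norm.

Section termwise_derivative.
Variables (a : nat -> nat -> R) (rho M : R).
Hypotheses (rho_gt0 : 0 < rho) (aM : summable2 a rho M).

Definition dcoef i j : R := j.+1%:R * a i j.+1.

(** Halving the radius pays for the factors [j + 1 <= 2 ^ j]. *)
Lemma summable2_dcoef : summable2 dcoef (rho / 2) (rho^-1 * M).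
Proof.
move=> n.
pose F i j := (0 < j)%N%:R * (`|a i j| * rho ^+ (i + j)).
apply: (@le_trans _ _ (rho^-1 * psum n (fun i j => `|a i j.+1| * rho ^+ (i + j.+1)))).
  rewrite -psumZ; apply: ler_psum => i j; rewrite /dcoef normrM normr_nat.
  rewrite addnS exprS mulrCA (mulrA rho^-1) mulVf ?gt_eqF// mul1r.
  rewrite [_ * `|_|]mulrC -mulrA; apply: ler_wpM2l => //.
  rewrite exprMn mulrCA -[leRHS]mulr1; apply: ler_wpM2l.
    by rewrite exprn_ge0// ltW.
  rewrite exprVn ler_pdivrMr ?exprn_gt0// mul1r -natrX ler_nat.
  by apply: leq_trans (_ : 2 ^ j <= _)%N; [exact: ltn_expl|rewrite leq_exp2l ?leq_addl].
apply: ler_wpM2l; first by rewrite invr_ge0 ltW.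
apply: le_trans (aM n.+1).
rewrite (@eq_psum n _ (fun i j => F i j.+1)) => [|i j]; last first.
  by rewrite /F mul1r.
rewrite -psum_shift => [|i]; last by rewrite /F mul0r.
apply: ler_psum => i [|j]; rewrite /F ?mul0r ?mul1r//.
by rewrite mulr_ge0// exprn_ge0// ltW.
Qed.

(** The factor [q ^+ 2] on the left stands for the exponent [j - 2] on the right,
    which would need a case distinction. *)
Lemma expr_taylor1 (q y w : R) j : `|y| <= q -> `|y + w| <= q ->
  q ^+ 2 * `|(y + w) ^+ j - y ^+ j - j%:R * y ^+ j.-1 * w|
    <= (j ^ 2)%:R * q ^+ j * w ^+ 2.
Proof.
move=> yq wq; have q0 : 0 <= q by exact: le_trans yq.
elim: j => [|j IHj]; first by rewrite !expr0 subrr !mul0r subr0 normr0 mulr0.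
have -> : (y + w) ^+ j.+1 - y ^+ j.+1 - j.+1%:R * y ^+ j.+1.-1 * w =
    (y + w) * ((y + w) ^+ j - y ^+ j - j%:R * y ^+ j.-1 * w)
    + j%:R * y ^+ j.-1 * w ^+ 2.
  case: j {IHj} => [|j]; first by rewrite /= !expr0 !expr1; ring.
  by rewrite /= !exprS -natr1; ring.
apply: le_trans (ler_wpM2l (sqr_ge0 q) (ler_normD _ _)) _.
rewrite mulrDr.
have A : q ^+ 2 * `|(y + w) * ((y + w) ^+ j - y ^+ j - j%:R * y ^+ j.-1 * w)|
    <= (j ^ 2)%:R * q ^+ j * w ^+ 2 * q.
  rewrite normrM [X in q ^+ 2 * X]mulrC mulrA.
  by apply: ler_pM => //; rewrite mulr_ge0 ?sqr_ge0.
have B : q ^+ 2 * `|j%:R * y ^+ j.-1 * w ^+ 2| <= j%:R * q ^+ j.+1 * w ^+ 2.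
  rewrite [`|_ * w ^+ 2|]normrM (ger0_norm (sqr_ge0 w)) mulrA.
  rewrite ler_wpM2r ?sqr_ge0// normrM normr_nat mulrCA.
  case: j {IHj A} => [|j]; first by rewrite !mul0r.
  apply: ler_wpM2l => //=; rewrite normrX.
  have -> : q ^+ j.+2 = q ^+ 2 * q ^+ j by rewrite -exprD.
  by apply: ler_wpM2l; rewrite ?sqr_ge0// lerXn2r ?nnegrE.
apply: le_trans (lerD A B) _.
have -> : (j ^ 2)%:R * q ^+ j * w ^+ 2 * q + j%:R * q ^+ j.+1 * w ^+ 2
    = (j ^ 2 + j)%:R * q ^+ j.+1 * w ^+ 2 by rewrite natrD !exprS; move: (j ^ 2)%N => J; ring.
rewrite ler_wpM2r ?sqr_ge0// ler_wpM2r ?exprn_ge0// ler_nat.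
by rewrite -!mulnn mulSn mulnS addnC addnA leq_add// addnC leq_addr.
Qed.

(** The second order errors of the monomials add up, because a quarter of the
    radius absorbs the factors [j ^ 2 <= 4 ^ j]. *)
Lemma psval_taylor1 (s y w : R) :
  `|s| <= rho / 4 -> `|y| <= rho / 4 -> `|y + w| <= rho / 4 ->
  `|psval a s (y + w) - psval a s y - psval dcoef s y * w|
    <= 16 / rho ^+ 2 * M * w ^+ 2.
Proof.
move=> sr yr wr.
have r4 : rho / 4 <= rho by move: rho_gt0 => ?; lra.
have r42 : rho / 4 <= rho / 2 by move: rho_gt0 => ?; lra.
have c1 := psval_cvg aM (le_trans sr r4) (le_trans wr r4).
have c2 := psval_cvg aM (le_trans sr r4) (le_trans yr r4).
have c3 := psval_cvg summable2_dcoef (le_trans sr r42) (le_trans yr r42).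
move: c1 c2; rewrite -cvg_shiftS => c1; rewrite -cvg_shiftS => c2.
pose u z n := psum n (fun i j => a i j * s ^+ i * z ^+ j).
pose v n := psum n (fun i j => dcoef i j * s ^+ i * y ^+ j).
have c : `|u (y + w) n.+1 - u y n.+1 - v n * w| @[n --> \oo] -->
    `|psval a s (y + w) - psval a s y - psval dcoef s y * w|.
  apply: cvg_norm; apply: cvgB; first by apply: cvgB; [exact: c1|exact: c2].
  by apply: cvgMr_tmp; exact: c3.
apply: (cvgr_to_le c); apply: nearW => n /=; rewrite /u /v.
have -> : psum n (fun i j => dcoef i j * s ^+ i * y ^+ j) * w =
    psum n.+1 (fun i j => j%:R * a i j * s ^+ i * y ^+ j.-1 * w).
  rewrite psum_shift => [|i]; last by rewrite !mul0r.
  by rewrite mulrC -psumZ; apply: eq_psum => i j; rewrite mulrC.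
rewrite -!psumB; apply: le_trans (ler_norm_psum _ _) _.
rewrite -mulrA [M * _]mulrC mulrA; apply: le_trans (_ : 16 / rho ^+ 2 * w ^+ 2 *
  psum n.+1 (fun i j => `|a i j| * rho ^+ (i + j)) <= _); last first.
  by apply: ler_wpM2l => //; rewrite mulr_ge0 ?sqr_ge0// divr_ge0// sqr_ge0.
rewrite -psumZ; apply: ler_psum => i j.
have -> : a i j * s ^+ i * (y + w) ^+ j - a i j * s ^+ i * y ^+ j
    - j%:R * a i j * s ^+ i * y ^+ j.-1 * w = a i j * (s ^+ i *
    ((y + w) ^+ j - y ^+ j - j%:R * y ^+ j.-1 * w)) by ring.
rewrite normrM mulrCA; apply: ler_wpM2l => //.
rewrite exprD mulrCA normrM normrX; apply: ler_pM; rewrite ?exprn_ge0//.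
  by rewrite lerXn2r ?nnegrE ?(ltW rho_gt0)// (le_trans sr).
have := expr_taylor1 j yr wr.
have -> : (rho / 4) ^+ 2 = (16 / rho ^+ 2)^-1 by rewrite invf_div exprMn exprVn; lra.
rewrite mulrC ler_pdivrMr ?divr_gt0 ?exprn_gt0// => /le_trans; apply.
rewrite [leRHS]mulrC [leRHS]mulrA [leRHS]mulrAC; apply: ler_wpM2r.
  by rewrite divr_ge0// sqr_ge0.
apply: ler_wpM2r; first exact: sqr_ge0.
rewrite exprMn mulrCA -[leRHS]mulr1; apply: ler_wpM2l.
  by rewrite exprn_ge0// ltW.
rewrite exprVn ler_pdivrMr ?exprn_gt0// mul1r -natrX ler_nat.
rewrite -[4%N]/(2 ^ 2)%N -expnM mulnC expnM leq_exp2r//.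
exact/ltnW/ltn_expl.
Qed.

End termwise_derivative.
End double_series.

(** * Analytic functions of a parameter and a real variable *)

Section analytic_at.
Variable R : realType.
Variable I : set R.
Implicit Types (f : R -> R -> R) (e x rho del : R).

(** The expansion is only required at parameters in [I], so that [e0] may be an
    end point of [I]. *)
Definition analytic_at f e0 x0 := exists a rho M,
  [/\ 0 < rho, summable2 a rho M & forall e y, I e -> `|e - e0| <= rho ->
      `|y| <= rho -> f e (x0 + y) = psval a (e - e0) y].

Lemma analytic_onP f : analytic_on (I `*` setT) (fun p => f p.1 p.2) ->
  forall e0 x0, I e0 -> analytic_at f e0 x0.
Proof.
move=> fI e0 x0 Ie0; have [a [r r0 ar]] := fI (e0, x0) (conj Ie0 Logic.I).
have r2 : 0 < r / 2 by rewrite divr_gt0.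
have inball e y : `|e - e0| <= r / 2 -> `|y| <= r / 2 ->
    ball (e0, x0) r (e, x0 + y).
  move=> er yr; split; rewrite /ball/=.
    by rewrite distrC (le_lt_trans er)//; lra.
  by rewrite opprD addrA subrr sub0r normrN (le_lt_trans yr)//; lra.
have nr2 : `|r / 2| <= r / 2 by rewrite ger0_norm// ltW.
(* The absolute convergence at this corner of the square bounds the coefficients
   at radius [r / 2]. *)
pose q := (e0 + r / 2, x0 + r / 2).
have qe : q.1 - e0 = r / 2 by rewrite /q/=; ring.
have qx : q.2 - x0 = r / 2 by rewrite /q/=; ring.
have qr : ball (e0, x0) r q by apply: inball; rewrite ?qe.
have [cq _] := ar _ qr.
pose v d := \sum_(i < d.+1) `|a i (d - i)%N * (r / 2) ^+ i * (r / 2) ^+ (d - i)|.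
have {}cq : cvgn (series v).
  move: cq; rewrite (_ : (fun d => _) = v)//; apply/funext => d.
  by rewrite /v /= -[e0 + _ - e0]/(q.1 - e0) -[x0 + _ - x0]/(q.2 - x0) qe qx.
exists a, (r / 2), (limn (series v)); split=> //.
  move=> n; apply: le_trans (nondecreasing_cvgn_le _ cq n).
    rewrite seriesEord/=; apply: ler_sum => d _; apply: ler_sum => i _.
    rewrite exprD mulrA [leRHS]normrM [`|a _ _ * _|]normrM.
    by rewrite !normrX (ger0_norm (ltW r2)).
  apply/nondecreasing_seqP => n'; rewrite seriesSr lerDl.
  by apply: sumr_ge0.
move=> e y Ie er yr.
have [_ /(_ (conj Ie Logic.I))/=] := ar _ (inball _ _ er yr).
have -> : x0 + y - x0 = y by ring.
move=> /cvg_lim <-//; rewrite /psval.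
by congr (lim (_ @ \oo)); apply/funext => n; rewrite seriesEord.
Qed.

Lemma near_dnbhs0 del (P : R -> Prop) : 0 < del ->
  (forall h, h != 0 -> `|h| <= del -> P h) -> \forall h \near 0^', P h.
Proof.
move=> del0 hP; exists del => //= h /=; rewrite sub0r normrN => hd h0.
by apply: hP => //; exact: ltW.
Qed.

(** A quadratic error bound identifies the derivative of a sum of power series
    without exchanging limits. *)
Lemma quadratic_is_derive (g : R -> R) x d B del : 0 < del ->
  (forall w, `|w| <= del -> `|g (x + w) - g x - d * w| <= B * w ^+ 2) ->
  is_derive x 1 g d.
Proof.
move=> del0 gB.
suff c : h^-1 *: ((g \o shift x) (h *: 1) - g x) @[h --> 0^'] --> d.
  by apply: DeriveDef; [apply/cvg_ex; exists d|exact/cvg_lim].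
apply/cvgrPdist_le => /= eps eps0.
have B0 : 0 < `|B| + 1 by rewrite ltr_wpDl.
apply: (@near_dnbhs0 (Num.min del (eps / (`|B| + 1)))).
  by rewrite lt_min del0 divr_gt0.
move=> h h0; rewrite le_min => /andP[hd he].
rewrite /shift/= [_ *: 1]mulr1.
have -> : d - h^-1 *: (g (h + x) - g x) =
    - (h^-1 * (g (x + h) - g x - d * h)).
  by rewrite [h + x]addrC -[_ *: _]/(_ * _); field.
rewrite normrN normrM normfV ler_pdivrMl ?normr_gt0//.
apply: le_trans (gB _ hd) _.
rewrite -real_normK ?num_real// expr2 mulrCA; apply: ler_wpM2l => //.
move: he; rewrite ler_pdivlMr// mulrC; apply: le_trans.
by apply: ler_wpM2r => //; rewrite (le_trans (ler_norm _))// lerDl.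
Qed.

(** A power series can be differentiated termwise, hence near its centre the
    derivative in the second variable is again a double power series. *)
Lemma analytic_at_derive f :
    (forall e x, I e -> analytic_at f e x) -> forall e0 x0, I e0 ->
  derivable (f e0) x0 1 /\ analytic_at (fun e => derive1 (f e)) e0 x0.
Proof.
move=> fI e0 x0 Ie0; have [a [rho [M [rho0 aM fa]]]] := fI e0 x0 Ie0.
have r8 : 0 < rho / 8 by rewrite divr_gt0.
have D e y : I e -> `|e - e0| <= rho / 8 -> `|y| <= rho / 8 ->
    is_derive (x0 + y) 1 (f e) (psval (dcoef a) (e - e0) y).
  move=> Ie er yr; apply: (@quadratic_is_derive _ _ _ (16 / rho ^+ 2 * M) (rho / 8)) => //.
  move=> w wr.
  have ywr : `|y + w| <= rho / 4 by rewrite (le_trans (ler_normD _ _))//; lra.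
  rewrite -[x0 + y + w]addrA !fa//; try lra.
  by apply: psval_taylor1 => //; lra.
split.
  have := @D e0 0 Ie0; rewrite subrr normr0 addr0 => /(_ (ltW r8) (ltW r8)) df.
  exact: ex_derive.
exists (dcoef a), (rho / 8), (rho^-1 * M); split=> //.
  by apply: summable2_le (summable2_dcoef rho0 aM); rewrite ltW//=; lra.
move=> e y Ie er yr; rewrite derive1E; have Df := D _ _ Ie er yr.
exact: derive_val.
Qed.

(** The first order Taylor expansion of an analytic function, in every algebra
    of functions at once: the error is linear in the size of the parameter and
    quadratic in the size of the variable. *)
Lemma analytic_at_jet f e0 x0 : I e0 -> analytic_at f e0 x0 ->
  exists C rho : R, [/\ 0 < C, 0 < rho &
    forall (T : Type) (D : set T) (N : (T -> R) -> R -> Prop),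
    function_norm D N -> forall (e y : T -> R) (sigma r : R),
    (forall z, D z -> I (e z)) -> N (fun z => e z - e0) sigma -> N y r ->
    0 <= sigma <= rho -> 0 <= r <= rho ->
    N (fun z => f (e z) (x0 + y z) - f e0 x0 - derive1 (f e0) x0 * y z)
      (C * (sigma + r ^+ 2))].
Proof.
move=> Ie0 [a [rho [M [rho0 aM fa]]]].
have rho4 : 0 < rho / 4 by rewrite divr_gt0.
have f0 : f e0 x0 = a 0%N 0%N.
  by have := fa e0 0 Ie0; rewrite subrr normr0 addr0 psval0 => ->//; exact: ltW.
have f1 : derive1 (f e0) x0 = a 0%N 1%N.
  suff df : is_derive x0 1 (f e0) (a 0%N 1%N) by rewrite derive1E derive_val.
  apply: (@quadratic_is_derive _ _ _ (16 / rho ^+ 2 * M) (rho / 4)) => // w wr.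
  have wr1 : `|w| <= rho by lra.
  rewrite fa// ?subrr ?normr0 ?(ltW rho0)// f0 -(psval0 a).
  have -> : a 0%N 1%N = psval (dcoef a) 0 0 by rewrite psval0 /dcoef mul1r.
  have := @psval_taylor1 _ a rho M rho0 aM 0 0 w.
  by rewrite normr0 add0r; apply => //; exact: ltW.
have M0 : 0 <= M by apply: le_trans (aM 0%N); rewrite /psum big_ord0.
have C0 : 0 < rho^-1 + rho^-2 by rewrite addr_gt0 ?invr_gt0 ?exprn_gt0.
exists ((rho^-1 + rho^-2) * (M + 1)), rho; split=> //.
  by rewrite mulr_gt0// ltr_wpDl.
move=> T D N NN e y sigma r eI Ns Ny /andP[s0 srho] /andP[r0 rrho].
have jet := norm_psval_jet NN Ns Ny rho0 aM s0 r0 srho rrho.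
apply: (norm_le NN); last first.
  apply: (norm_ext NN) jet => x Dx /=; rewrite fa//.
  - by rewrite f0 f1.
  - exact: eI.
  - exact: le_trans (norm_bound NN Ns Dx) _.
  - exact: le_trans (norm_bound NN Ny Dx) _.
rewrite mulrAC; apply: ler_pM => //; last by rewrite lerDl.
- by rewrite addr_ge0 ?sqr_ge0// divr_ge0// ltW.
have -> : (rho^-1 + rho^-2) * (sigma + r ^+ 2) =
    sigma / rho + (r / rho) ^+ 2 + (rho^-1 * r ^+ 2 + rho^-2 * sigma).
  by rewrite exprMn -exprVn; ring.
by rewrite lerDl addr_ge0// mulr_ge0 ?invr_ge0 ?sqr_ge0// ltW.
Qed.

End analytic_at.

(** * Strictly convex curves *)

Section plane.
Variable R : realType.
Implicit Types (a b p q : R * R) (c : R -> R * R) (t u v w : R).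

Lemma omegaC a b : omega a b = - omega b a.
Proof. by rewrite /omega; ring. Qed.

Lemma omegaB a p q : omega a (p - q) = omega a p - omega a q.
Proof. by rewrite /omega /=; ring. Qed.

Lemma omegaZ (l : R) a b : omega a (l *: b) = l * omega a b.
Proof.
have sE (x y : R) : x *: y = x * y by [].
by rewrite /omega /= !sE; ring.
Qed.

Lemma is_derive_approx (f : R -> R) t (d kappa : R) : is_derive t 1 f d ->
  0 < kappa -> exists2 del : R, 0 < del &
    forall w, `|w| <= del -> `|f (t + w) - f t - d * w| <= kappa * `|w|.
Proof.
move=> df kappa0.
have dF : derivable f t 1 by exact: ex_derive.
have cl : h^-1 *: ((f \o shift t) (h *: 1) - f t) @[h --> 0^'] --> d.
  by rewrite -(@derive_val _ _ _ _ _ _ _ df); exact: dF.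
move/cvgrPdist_le : cl => /(_ _ kappa0) [del /= del0 fd].
exists (del / 2); first by rewrite divr_gt0.
move=> w wd; have [->|w0] := eqVneq w 0.
  by rewrite addr0 subrr mulr0 subrr normr0 mulr0.
have := fd w; rewrite /ball_/= sub0r normrN [_ *: 1]mulr1 => /(_ _ w0).
have wdel : `|w| < del by lra.
move=> /(_ wdel); rewrite -[_ *: _]/(_ * _) => fw.
have -> : f (t + w) - f t - d * w = - (d - w^-1 * (f (w + t) - f t)) * w.
  by rewrite [w + t]addrC; field.
by rewrite normrM normrN ler_wpM2r.
Qed.

Lemma derive1_coord c t : derivable c t 1 ->
  is_derive t 1 (fun x => (c x).1) (derive1 c t).1 /\
  is_derive t 1 (fun x => (c x).2) (derive1 c t).2.
Proof.
move=> dc; rewrite derive1E.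
have {}dc : (fun h => h^-1 *: (c (h *: 1 + t) - c t)) @ 0^' --> 'D_1 c t by exact: dc.
have c1 : (fun h => h^-1 *: ((c (h *: 1 + t)).1 - (c t).1)) @ 0^' --> ('D_1 c t).1.
  exact: (cvg_comp _ _ dc cvg_fst).
have c2 : (fun h => h^-1 *: ((c (h *: 1 + t)).2 - (c t).2)) @ 0^' --> ('D_1 c t).2.
  exact: (cvg_comp _ _ dc cvg_snd).
split; apply: DeriveDef; try by exact/cvg_lim.
  by apply/cvg_ex; exists ('D_1 c t).1.
by apply/cvg_ex; exists ('D_1 c t).2.
Qed.

Lemma conv_open (O : set (R * R)) p q l : strictly_convex_domain O ->
  O p -> O q -> 0 < l < 1 -> O (l *: p + (1 - l) *: q).
Proof.
case=> _ _ cO Op Oq l01; have [->|pq] := eqVneq p q.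
  by rewrite -scalerDl addrC subrK scale1r.
by apply: cO => //; exact: subset_closure.
Qed.

Lemma open_box (O : set (R * R)) p : open O -> O p ->
  exists2 r : R, 0 < r & forall w : R * R, `|w.1| < r -> `|w.2| < r -> O (p + w).
Proof.
move=> oO Op; have : nbhs p O by exact: open_nbhs_nbhs.
move=> /nbhs_ballP[r /= r0 rO]; exists r => // w w1 w2; apply: rO.
by split; rewrite /ball/= opprD addrA subrr sub0r normrN.
Qed.

(** A point [z] of the domain below the tangent line at [c t] would, together
    with a point [c t + h *: n] above it ([n] the inner normal), put in the domain
    a whole box around [c t + tau *: c' t], of size proportional to [tau]; for
    small [tau] that box contains the boundary point [c (t + tau)]. *)
Lemma support_line (O : set (R * R)) c t q : strictly_convex_domain O ->
  ccw_parametrization O c -> closure O q -> q != c t ->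
  0 < omega (derive1 c t) (q - c t).
Proof.
move=> sO [_ dc _ rc ic] Oq qc; have [oO _ cO] := sO.
rewrite ltNge; apply/negP => qle.
have [cp Onp] : closure O (c t) /\ ~ O (c t).
  have : frontier O (c t) by rewrite -rc; exists t.
  by rewrite /frontier (interior_id O).1// => -[].
have NO w : ~ O (c w).
  have : frontier O (c w) by rewrite -rc; exists w.
  by rewrite /frontier (interior_id O).1// => -[].
have [dct] := dc t; have [d1 d2] := derive1_coord dct.
have := ic t; case: (derive1 c t) d1 d2 qle => a1 a2 /= d1 d2 qle nO a0.
have N0 : 0 < a1 ^+ 2 + a2 ^+ 2.
  rewrite lt_neqAle addr_ge0 ?sqr_ge0// andbT eq_sym paddr_eq0 ?sqr_ge0//.
  by rewrite !sqrf_eq0; apply: contra a0 => /andP[/eqP-> /eqP->].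
set p := c t in cp qc qle nO Onp *.
(* The tangential component of [z - p] has to be nonzero too: it becomes the
   increment of the parameter. *)
have [z Oz [zlt zneq]] : exists2 z, O z &
    omega (a1, a2) (z - p) < 0 /\ a1 * (z - p).1 + a2 * (z - p).2 != 0.
  pose z0 := (2^-1 : R) *: q + (1 - 2^-1) *: p.
  have Oz0 : O z0 by apply: cO => //; lra.
  have z0le : omega (a1, a2) (z0 - p) <= 0.
    have -> : omega (a1, a2) (z0 - p) = 2^-1 * omega (a1, a2) (q - p).
      by rewrite /omega /z0 /= -![_ *: _]/(_ * _); field.
    by rewrite pmulr_rle0.
  have [r r0 rO] := open_box oO Oz0.
  pose eta := r / (2 * (`|a1| + `|a2| + 1)).
  have D0 : 0 < 2 * (`|a1| + `|a2| + 1).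
    by rewrite mulr_gt0// ltr_wpDl// addr_ge0.
  have eta0 : 0 < eta by rewrite divr_gt0.
  have etar : eta * (`|a1| + `|a2|) < r.
    by rewrite /eta mulrAC ltr_pdivrMr//; nra.
  have [e0|e0] := eqVneq (a1 * (z0 - p).1 + a2 * (z0 - p).2) 0.
    exists (z0 + (eta * (a1 + a2), eta * (a2 - a1))).
      apply: rO => /=; rewrite normrM (gtr0_norm eta0);
        apply: le_lt_trans etar; apply: ler_wpM2l; rewrite ?(ltW eta0)//.
        exact: ler_normD.
      by rewrite [leRHS]addrC; exact: ler_normB.
    move: z0le e0; rewrite /omega /=; set x := z0.1 - p.1; set y := z0.2 - p.2.
    rewrite -![_ + _ - _]addrA [_ + - p.1]addrC [_ + - p.2]addrC !addrA.
    rewrite -/x -/y => z0le e0.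
    have {}eta0 : 0 < eta * (a1 ^+ 2 + a2 ^+ 2) by rewrite mulr_gt0.
    by split; [nra|rewrite gt_eqF//; nra].
  exists (z0 + (eta * a2, - (eta * a1))).
    apply: rO => /=; rewrite ?normrN normrM (gtr0_norm eta0);
      apply: le_lt_trans etar; apply: ler_wpM2l; rewrite ?(ltW eta0)//.
      by rewrite lerDr.
    by rewrite lerDl.
  move: z0le e0; rewrite /omega /=; set x := z0.1 - p.1; set y := z0.2 - p.2.
  rewrite -![_ + _ - _]addrA [_ + - p.1]addrC [_ + - p.2]addrC !addrA.
  rewrite -/x -/y => z0le e0.
  have {}eta0 : 0 < eta * (a1 ^+ 2 + a2 ^+ 2) by rewrite mulr_gt0.
  split; first nra.
  by apply: contra e0 => /eqP e0; apply/eqP; rewrite -e0; ring.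
pose al := (a1 * (z - p).1 + a2 * (z - p).2) / (a1 ^+ 2 + a2 ^+ 2).
pose be := - omega (a1, a2) (z - p) / (a1 ^+ 2 + a2 ^+ 2).
have al0 : al != 0 by rewrite mulf_neq0// invr_eq0 gt_eqF.
have be0 : 0 < be by rewrite divr_gt0// oppr_gt0.
have z1 : z.1 = p.1 + al * a1 + be * a2.
  by rewrite /al /be /omega/=; field; rewrite gt_eqF.
have z2 : z.2 = p.2 + al * a2 - be * a1.
  by rewrite /al /be /omega/=; field; rewrite gt_eqF.
have [r r0 rO] := open_box oO Oz.
have nal : 0 < `|al| by rewrite normr_gt0.
have kap0 : 0 < r / 2 / `|al| by rewrite !divr_gt0.
have [del1 del10 c1] := is_derive_approx d1 kap0.
have [del2 del20 c2] := is_derive_approx d2 kap0.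
have [h0 /= h00 hO] := nO.
pose lam := Num.min 2^-1 (Num.min (del1 / `|al|) (Num.min (del2 / `|al|) (h0 / (4 * be)))).
have lam0 : 0 < lam by rewrite /lam !lt_min invr_gt0 ltr0n !divr_gt0// mulr_gt0.
have [l2 l_1 l_2 l_h] : [/\ lam <= 2^-1, lam <= del1 / `|al|,
    lam <= del2 / `|al| & lam <= h0 / (4 * be)].
  by split; rewrite /lam !ge_min lexx ?orbT.
clearbody lam al be.
have tau1 : `|lam * al| <= del1 by rewrite normrM (gtr0_norm lam0) -ler_pdivlMr.
have tau2 : `|lam * al| <= del2 by rewrite normrM (gtr0_norm lam0) -ler_pdivlMr.
(* With this [h], the convex combination of [z] and [p + h *: n] with weight
   [lam] is the point [p + (lam * al) *: c' t] of the tangent line. *)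
pose h : R := lam * be / (1 - lam).
have l1 : 0 < 1 - lam by rewrite subr_gt0 (le_lt_trans l2)// invf_lt1// ltr1n.
have h_gt0 : 0 < h by apply: divr_gt0 => //; apply: mulr_gt0.
have h_lt : h < h0.
  rewrite ltr_pdivrMr//.
  have l4 : lam * (4 * be) <= h0 by rewrite -ler_pdivlMr// mulr_gt0.
  have : h0 * lam <= h0 * 2^-1 by rewrite ler_wpM2l// ltW.
  have : 0 < lam * be by rewrite mulr_gt0.
  by nra.
have Oh : O (p + h *: (- a2, a1)).
  apply: hO => //=; rewrite sub0r normrN gtr0_norm//.
pose w := (((c (t + lam * al)).1 - p.1 - a1 * (lam * al)) / lam,
           ((c (t + lam * al)).2 - p.2 - a2 * (lam * al)) / lam).
have wr (x : R) : `|x| <= r / 2 / `|al| * `|lam * al| -> `|x / lam| < r.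
  move=> xr; rewrite normrM normfV (gtr0_norm lam0) ltr_pdivrMr//.
  apply: le_lt_trans xr _; rewrite normrM (gtr0_norm lam0).
  have -> : r / 2 / `|al| * (lam * `|al|) = r / 2 * lam by field; rewrite gt_eqF.
  by nra.
have Ow : O (z + w) by apply: rO; apply: wr; [exact: c1|exact: c2].
apply: (NO (t + lam * al)).
have -> : c (t + lam * al) = lam *: (z + w) + (1 - lam) *: (p + h *: (- a2, a1)).
  have sE (x y : R) : x *: y = x * y by [].
  apply: injective_projections; rewrite /= ?z1 ?z2 !sE /h; field.
    by rewrite gt_eqF//= gt_eqF.
  by rewrite gt_eqF//= gt_eqF.
by apply: conv_open => //; lra.
Qed.

End plane.

(** * The phase space and the twist property *)

(** Up to normalization and an additive constant, [height c t u] is the distance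
    of [c u] to the tangent line at [c t], and [tangents c t u] is its derivative
    in [u].  Locked because unfolded instances are expensive to compare. *)
HB.lock Definition tangents (R : realType) (c : R -> R * R) (t u : R) : R :=
  omega (derive1 c t) (derive1 c u).

HB.lock Definition height (R : realType) (c : R -> R * R) (t u : R) : R :=
  omega (derive1 c t) (c u).

HB.lock Definition antipode (R : realType) (c : R -> R * R) (t : R) : R :=
  opposite c t.

Section oval.
Variable R : realType.

(** What the dynamics uses of a parametrized strictly convex curve. *)
Record oval (c : R -> R * R) : Prop := Oval {
  oval_per : forall t, c (t + 1) = c t;
  oval_inj : forall t u, c t = c u -> exists k : int, u = t + k%:~R;
  oval_der1 : forall t : R, is_derive t 1 (fun x : R => (c x).1) (derive1 c t).1;
  oval_der2 : forall t : R, is_derive t 1 (fun x : R => (c x).2) (derive1 c t).2;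
  oval_cont1 : continuous (fun t : R => (derive1 c t).1);
  oval_cont2 : continuous (fun t : R => (derive1 c t).2);
  oval_support : forall t u, c u != c t -> 0 < omega (derive1 c t) (c u - c t) }.

Variable c : R -> R * R.
Hypothesis Oc : oval c.
Implicit Types (t u v w : R) (a : R * R) (k : int).

Local Notation tangents := (tangents c).
Local Notation height := (height c).
Local Notation antipode := (antipode c).

Lemma tangentsC t u : tangents t u = - tangents u t.
Proof. by rewrite tangents.unlock; exact: omegaC. Qed.

Lemma oval_perz t k : c (t + k%:~R) = c t.
Proof.
have pn x (j : nat) : c (x + j%:R) = c x.
  by elim: j => [|j IHj]; rewrite ?addr0// -natr1 addrA oval_per.
by case: k => j; [exact: pn|rewrite NegzE mulrNz -[LHS](pn _ j.+1) subrK].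
Qed.

Lemma derive1_per t k : derive1 c (t + k%:~R) = derive1 c t.
Proof.
rewrite /derive1 (_ : (fun h => _) = fun h => h^-1 *: (c (h + t) - c t))//.
by apply/funext => h; rewrite addrA !oval_perz.
Qed.

Lemma heightDz t u k : height t (u + k%:~R) = height t u.
Proof. by rewrite height.unlock oval_perz. Qed.

Lemma heightzD t u k : height (t + k%:~R) u = height t u.
Proof. by rewrite height.unlock derive1_per. Qed.

Lemma tangentsDz t u k : tangents t (u + k%:~R) = tangents t u.
Proof. by rewrite tangents.unlock derive1_per. Qed.

Lemma tangentszD t u k : tangents (t + k%:~R) u = tangents t u.
Proof. by rewrite tangents.unlock derive1_per. Qed.

Lemma height_is_derive t u : is_derive u 1 (height t) (tangents t u).
Proof.
have d1 := oval_der1 Oc u; have d2 := oval_der2 Oc u.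
rewrite height.unlock tangents.unlock /omega.
exact: is_derive_eq.
Qed.

Lemma height_continuous t : continuous (height t).
Proof.
by move=> u; have := height_is_derive t u => D; apply/differentiable_continuous/derivable1_diffP/ex_derive.
Qed.

Lemma tangents_continuous t : continuous (tangents t).
Proof.
move=> u; rewrite tangents.unlock; apply: cvgB.
  by apply: cvgMl_tmp; exact: (oval_cont2 Oc).
by apply: cvgMl_tmp; exact: (oval_cont1 Oc).
Qed.

Lemma height_continuousl u : continuous (height^~ u).
Proof.
move=> t; rewrite height.unlock; apply: cvgB.
  by apply: cvgMr_tmp; exact: (oval_cont1 Oc).
by apply: cvgMr_tmp; exact: (oval_cont2 Oc).
Qed.

Lemma tangents_continuousl u : continuous (tangents^~ u).
Proof.
move=> t; rewrite tangents.unlock; apply: cvgB.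
  by apply: cvgMr_tmp; exact: (oval_cont1 Oc).
by apply: cvgMr_tmp; exact: (oval_cont2 Oc).
Qed.

Lemma height_mvt t u v : u < v ->
  exists2 x, u < x < v & height t v - height t u = tangents t x * (v - u).
Proof.
move=> uv; have [x xuv e] := MVT uv (fun x _ => height_is_derive t x)
   (continuous_subspaceT (@height_continuous t)).
by exists x => //; move: xuv; rewrite in_itv.
Qed.

Lemma distinct t u : t < u < t + 1 -> c u != c t.
Proof.
move=> /andP[tu ut]; apply/eqP => /esym /(oval_inj Oc)[k uk].
move: tu ut; rewrite uk ltrDl ltrD2l -[1]/(1%:~R) ltr0z ltr_int.
by case: k {uk} => [[|k]|k].
Qed.

Lemma height_gt t u : c u != c t -> height t t < height t u.
Proof. by move=> /(oval_support Oc); rewrite height.unlock omegaB subr_gt0. Qed.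

Lemma height_gtE t u : t < u < t + 1 -> height t t < height t u.
Proof. by move=> /distinct; exact: height_gt. Qed.

Lemma derive1_neq0 t : derive1 c t != 0.
Proof.
apply/eqP => c0; have : t < t + 2^-1 < t + 1 by lra.
by move=> /height_gtE; rewrite height.unlock c0 /omega !mul0r ltxx.
Qed.

(** Where the tangents are parallel, they point in opposite directions: the
    curve lies to the left of both tangent lines. *)
Lemma parallel_opposite t u : tangents t u = 0 -> c u != c t ->
  exists2 l : R, l < 0 & derive1 c u = l *: derive1 c t.
Proof.
move=> w0 cut.
have := oval_support Oc cut; rewrite eq_sym in cut.
have := oval_support Oc cut; have := derive1_neq0 t.
move: w0; rewrite tangents.unlock.
case: (derive1 c t) => a1 a2; case: (derive1 c u) => b1 b2.
rewrite /omega/= => w0 a0 supu supt.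
have N0 : 0 < a1 ^+ 2 + a2 ^+ 2.
  rewrite lt_neqAle addr_ge0 ?sqr_ge0// andbT eq_sym paddr_eq0 ?sqr_ge0//.
  by rewrite !sqrf_eq0; apply: contra a0 => /andP[/eqP-> /eqP->].
pose l := (a1 * b1 + a2 * b2) / (a1 ^+ 2 + a2 ^+ 2).
have e1 : b1 = l * a1.
  apply: (mulfI (lt0r_neq0 N0)); rewrite /l mulrA mulrCA divff ?gt_eqF// mulr1.
  by rewrite -[LHS]addr0 -[X in _ + X](mulr0 a2) -w0; ring.
have e2 : b2 = l * a2.
  apply: (mulfI (lt0r_neq0 N0)); rewrite /l mulrA mulrCA divff ?gt_eqF// mulr1.
  by rewrite -[LHS]subr0 -[X in _ - X](mulr0 a1) -w0; ring.
exists l; last by rewrite e1 e2.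
rewrite ltNge; apply/negP => l0; move: supu; rewrite e1 e2.
apply/negP; rewrite -leNgt.
have := mulr_ge0 l0 (ltW supt); lra.
Qed.

(** At the point with parallel tangent the height is strictly maximal, because
    the whole curve also lies on the inner side of the tangent there. *)
Lemma height_max t u v : tangents t u = 0 -> c u != c t -> c v != c u ->
  height t v < height t u.
Proof.
move=> w0 ut /height_gt; have [l l0] := parallel_opposite w0 ut.
rewrite height.unlock => ->; rewrite /omega/=.
have sE (x y : R) : x *: y = x * y by [].
by rewrite !sE -subr_gt0 => h; nra.
Qed.

(** Two points with tangents parallel to that at [t] would each be strictly
    higher than the other. *)
Lemma tangents_neq0 t u v : tangents t u = 0 -> t < u < t + 1 ->
  t < v < t + 1 -> v != u -> tangents t v != 0.
Proof.
move=> tu ut vt vu; apply/eqP => tv.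
have cvu : c v != c u.
  apply/eqP => /esym /(oval_inj Oc)[k vk].
  have kuv : (k%:~R : R) = v - u by rewrite vk; ring.
  have : -1 < k < 1 by rewrite -2!(ltr_int R) intrN kuv; lra.
  case: k vk {kuv} => [[|k]|[|k]]//.
  by rewrite addr0 => vk; rewrite vk eqxx in vu.
have := height_max tu (distinct ut) cvu.
by rewrite eq_sym in cvu; have := height_max tv (distinct vt) cvu; lra.
Qed.

(** By Rolle's theorem the height over the tangent line at [t] has a critical
    point within one turn.  Strict convexity makes it unique, so that the
    derivative keeps a sign on either side. *)
Lemma opposite_exists t : exists s, [/\ t < s < t + 1, tangents t s = 0,
  forall u, t < u < s -> 0 < tangents t u &
  forall u, s < u < t + 1 -> tangents t u < 0].
Proof.
have t1 : t < t + 1 by rewrite ltrDl.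
have [s] := @Rolle _ (height t) _ _ t1
  (fun x _ => @ex_derive _ _ _ _ _ _ _ (height_is_derive t x))
  (continuous_subspaceT (@height_continuous t)) (esym (heightDz t t 1)).
rewrite in_itv/= => ts ds.
have ts0 : tangents t s = 0.
  rewrite -(@derive_val _ _ _ _ _ _ _ (height_is_derive t s)).
  exact: derive_val.
(* A sign change of the derivative locates the only critical point [s]. *)
have zero x y : t < x -> x <= y -> y < t + 1 ->
    Num.min (tangents t x) (tangents t y) <= 0 <= Num.max (tangents t x) (tangents t y) ->
    x <= s <= y.
  move=> tx xy yt /(IVT xy (continuous_subspaceT (@tangents_continuous t)))[z].
  rewrite in_itv/= => /andP[xz zy] tz0; have [<-|/eqP zs] := pselect (z = s).
    by rewrite xz.
  have zt : t < z < t + 1 by lra.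
  by have := tangents_neq0 ts0 ts zt zs; rewrite tz0 eqxx.
exists s; split=> // u /andP[].
  move=> tu us; rewrite ltNge; apply/negP => tu0.
  have [x /andP[tx xu] hx] := height_mvt t tu.
  have : t < u < t + 1 by lra.
  move=> /height_gtE hu.
  have x0 : 0 < tangents t x.
    by rewrite -(pmulr_lgt0 (x := u - t)) -?hx; lra.
  have : x <= s <= u; last by lra.
  apply: zero => //; [lra|lra|].
  by rewrite ge_min tu0 orbT le_max ltW.
move=> su ut; rewrite ltNge; apply/negP => tu0.
have [x /andP[ux xt] hx] := height_mvt t ut.
have : t < u < t + 1 by lra.
move=> /height_gtE hu.
have x0 : tangents t x < 0.
  rewrite -(pmulr_llt0 (x := t + 1 - u)) -?hx; last by lra.
  by rewrite (heightDz t t 1); lra.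
have : u <= s <= x; last by lra.
apply: zero => //; [lra|lra|].
by rewrite ge_min (ltW x0) orbT le_max tu0.
Qed.

Lemma oppositeP t : let s := antipode t in
  [/\ t < s < t + 1, tangents t s = 0,
  forall u, t < u < s -> 0 < tangents t u &
  forall u, s < u < t + 1 -> tangents t u < 0].
Proof.
have [s [ts ts0 tp tn]] := opposite_exists t.
suff -> : antipode t = s by [].
have oE : antipode t = get [set u | t < u < t + 1 /\ tangents t u = 0].
  by rewrite antipode.unlock tangents.unlock.
rewrite oE; apply: get_unique => [//|u [ut tu0]].
have [//|/eqP us] := pselect (u = s).
by have := tangents_neq0 ts0 ts ut us; rewrite tu0 eqxx.
Qed.

(** The phase space, described without the opposite point: the conditions are
    open in the curve and in both points. *)
Definition phase t u := t < u < t + 1 /\ 0 < tangents t u.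

Lemma phaseP t u : phase t u <-> t < u < antipode t.
Proof.
have [ts ts0 tp tn] := oppositeP t; split=> [[tu p]|tu]; last first.
  by split; [lra|exact: tp].
case/andP: tu => -> ut /=; rewrite ltNge le_eqVlt; apply/negP => /orP[/eqP e|su].
  by rewrite -e ts0 ltxx in p.
by have := tn u; rewrite su ut => /(_ isT); lra.
Qed.

Lemma phaseDz k t u : phase t u <-> phase (t + k%:~R) (u + k%:~R).
Proof.
by rewrite /phase tangentsDz tangentszD addrAC !ltrD2r.
Qed.

(** The opposite point moves forward with [t]: if it moved back, the tangent at
    [antipode v], which is reversed from that at [v], would have the wrong
    direction with respect to the tangent at [t]. *)
Lemma phase_subl t u v : phase t u -> t <= v < u -> phase v u.
Proof.
move=> tu /andP[]; rewrite le_eqVlt => /predU1P[<-//|tv] vu.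
have {}tu := (phaseP t u).1 tu; apply/phaseP; rewrite vu/=.
have [ts ts0 tp tn] := oppositeP t; have [vs vs0 vp vn] := oppositeP v.
apply: (@lt_trans _ _ (antipode t)); first by lra.
rewrite ltNge; apply/negP => le.
have cv : c (antipode v) != c v by exact: distinct.
have [l l0 e] := parallel_opposite vs0 cv.
have : 0 < tangents t v by apply: tp; lra.
have : 0 <= tangents t (antipode v).
  move: le; rewrite le_eqVlt => /predU1P[->|ss]; first by rewrite ts0.
  by apply/ltW/tp; lra.
have -> : tangents t (antipode v) = l * tangents t v.
  by rewrite tangents.unlock e omegaZ.
by rewrite nmulr_rge0// leNgt => /negbTE->.
Qed.

Lemma phase_subr t u v : phase t u -> t < v <= u -> phase t v.
Proof. by move=> /phaseP tu tv; apply/phaseP; lra. Qed.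

Lemma height_incr t u v : phase t u -> t <= v < u -> height t v < height t u.
Proof.
move=> /phaseP tu /andP[tv vu]; have [ts ts0 tp tn] := oppositeP t.
have [x /andP[vx xu] e] := height_mvt t vu.
by rewrite -subr_gt0 e mulr_gt0// ?subr_gt0//; apply: tp; lra.
Qed.

Lemma height_decr t u v : phase t u -> t < v <= u -> height u v < height u t.
Proof.
move=> tu /andP[tv vu].
have [x /andP[tx xv] e] := height_mvt u tv.
have xu : phase x u by apply: phase_subl tu _; lra.
rewrite -subr_lt0 e pmulr_llt0 ?subr_gt0// tangentsC oppr_lt0.
by case: xu.
Qed.

Lemma height_inj t u v : phase t u -> phase t v -> height t u = height t v -> u = v.
Proof.
move=> tu tv e; case: (ltgtP u v) => [uv|vu|//].
  have tuv : t <= u < v by rewrite uv andbT; case: tu => /andP[/ltW].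
  by have := height_incr tv tuv; rewrite e ltxx.
have tvu : t <= v < u by rewrite vu andbT; case: tv => /andP[/ltW].
by have := height_incr tu tvu; rewrite e ltxx.
Qed.

(** The twist property: the billiard equation is strictly monotone in both
    neighbours of a point. *)
Lemma twist_unique b x x' y y' : phase b y -> phase b y' -> phase x b ->
  phase x' b -> height b y = height b x -> height b y' = height b x' ->
  x <= x' -> y <= y' -> y = y'.
Proof.
move=> py py' px px' hy hy' xx; rewrite le_eqVlt => /predU1P[//|yy].
have byy : b <= y < y' by rewrite yy andbT; case: py => /andP[/ltW].
have := height_incr py' byy; rewrite hy hy'.
move: xx; rewrite le_eqVlt => /predU1P[->|xx]; first by rewrite ltxx.
have xxb : x < x' <= b by rewrite xx; case: px' => /andP[/ltW].
by move=> /lt_trans /(_ (height_decr px xxb)); rewrite ltxx.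
Qed.

Lemma phase_height t h : height t t < h < height t (antipode t) ->
  exists2 w, phase t w & height t w = h.
Proof.
move=> /andP[th hs]; have [ts ts0 tp tn] := oppositeP t.
have ts' : t <= antipode t by lra.
have := IVT (v := h) ts' (continuous_subspaceT (@height_continuous t)).
rewrite ge_min le_max (ltW th) (ltW hs) orbT => /(_ isT)[w].
rewrite in_itv/= => /andP[tw ws] e; exists w => //; apply/phaseP.
rewrite !lt_neqAle tw ws !andbT; apply/andP; split; apply/eqP => E.
  by move: th; rewrite -e -E ltxx.
by move: hs; rewrite -e E ltxx.
Qed.

(** The next bounce exists because the height of [t] over the tangent line at
    [u] lies strictly between the minimum and the maximum of the height. *)
Lemma billiard_exists t u : phase t u ->
  exists2 w, phase u w & height u w = height u t.
Proof.
move=> tu; apply: phase_height.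
have [us us0 up un] := oppositeP u.
have ut : u < t + 1 < u + 1 by case: tu; lra.
have <- : height u (t + 1) = height u t by exact: (heightDz u t 1).
rewrite height_gtE//=; apply: height_max => //; first exact: distinct.
have tn0 : tangents u (t + 1) != 0.
  rewrite (tangentsDz u t 1) tangentsC oppr_eq0 gt_eqF//.
  by case: tu.
apply/eqP => /esym /(oval_inj Oc)[k e].
by move: tn0; rewrite e tangentsDz us0 eqxx.
Qed.

End oval.

(** * Invariant curves as circle maps *)

Section aux.
Variable R : realType.

Lemma lipschitzP (f : R -> R) :
  lipschitz f <-> exists L, forall x y, `|f x - f y| <= L * `|x - y|.
Proof.
split=> [[L [_ fL]]|[L fL]].
  exists (L + 1) => x y.
  have LL : L < L + 1 by rewrite ltrDl.
  exact: (fL _ LL (x, y)).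
exists L; split; first exact: num_real.
move=> M LM [x y] _ /=; apply: le_trans (fL x y) _.
by apply: ler_wpM2r => //; exact: ltW.
Qed.

Lemma lipschitz_continuous (f : R -> R) L :
  (forall x y, `|f x - f y| <= L * `|x - y|) -> continuous f.
Proof.
move=> fL x; apply/cvgrPdist_le => /= eps eps0.
have L0 : 0 < `|L| + 1 by rewrite ltr_wpDl.
apply/nbhs_ballP; exists (eps / (`|L| + 1)); first by rewrite /= divr_gt0.
move=> y /= /ltW; rewrite ler_pdivlMr// mulrC => xy.
apply: le_trans (fL x y) (le_trans _ xy); apply: ler_wpM2r => //.
by rewrite (le_trans (ler_norm _))// lerDl.
Qed.

Lemma cvg_near_lt (T : Type) (F : set_system T) (FF : Filter F) (f g : T -> R)
    (a b : R) : f x @[x --> F] --> a -> g x @[x --> F] --> b -> a < b ->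
  \forall x \near F, f x < g x.
Proof.
move=> fa gb ab; have ab0 : 0 < b - a by rewrite subr_gt0.
apply: filterS (cvgr_gt _ (cvgB gb fa) _ ab0) => x /=.
by rewrite subr_gt0.
Qed.

End aux.

Section circle_map.
Variable R : realType.

(** The dynamics induced on the first coordinate by a periodic invariant
    curve. *)
Record periodic_circle_map (c : R -> R * R) (m : int) (n : nat) (g : R -> R)
    : Prop := PeriodicCircleMap {
  circle_phase : forall t, phase c t (g t);
  circle_billiard : forall t, height c (g t) (g (g t)) = height c (g t) t;
  circle_degree : forall t, g (t + 1) = g t + 1;
  circle_iter : forall t, iter n g t = t + m%:~R }.

Variable c : R -> R * R.
Hypothesis Oc : oval c.
Implicit Types (t u v w : R).

Lemma phase_spaceE t u : phase_space c (t, u) <-> phase c t u.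
Proof.
have [ph hp] := phaseP Oc t u; rewrite antipode.unlock in ph hp.
by split; [exact: hp|exact: ph].
Qed.

Lemma billiard_phase t u w : phase c t u -> phase c u w ->
  height c u w = height c u t -> billiard c (t, u) = (u, w).
Proof.
move=> tu uw e; rewrite /billiard/=; congr pair.
have bE x : phase c u x /\ height c u x = height c u t <->
   u < x < opposite c u /\ omega (derive1 c u) (c x - c t) = 0.
  have := phase_spaceE u x; rewrite /phase_space/= => -[px xp].
  rewrite omegaB height.unlock; split=> -[px' e']; split.
  - exact: xp.
  - by rewrite e' subrr.
  - exact: px.
  - exact/subr0_eq.
apply: get_unique; first exact/bE.
move=> x /bE[ux ex]; apply: (height_inj Oc ux uw); by rewrite ex.
Qed.

Lemma to_tsE t u : to_ts c (t, u) = (t, height c t u).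
Proof. by rewrite height.unlock. Qed.

Lemma of_ts_phase t u : phase c t u -> of_ts c (t, height c t u) = (t, u).
Proof.
move=> tu; apply: get_unique; first by split; [exact/phase_spaceE|exact: to_tsE].
move=> [t' u'] [/phase_spaceE tu']; rewrite to_tsE => -[tt].
by rewrite tt in tu' * => e; rewrite (height_inj Oc tu' tu e).
Qed.

Lemma annulusP t s : annulus c (t, s) <-> exists2 u, phase c t u & height c t u = s.
Proof.
have -> : annulus c (t, s) <-> height c t t < s < height c t (antipode c t).
  by rewrite height.unlock antipode.unlock.
split; first exact: phase_height.
move=> [u tu <-]; have [ts ts0 _ _] := oppositeP Oc t.
have /andP[tu' us] := (phaseP Oc t u).1 tu.
rewrite (height_gtE Oc) ?tu' ?(lt_trans us)//; last by case/andP: ts.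
apply: (height_max Oc ts0); first exact: distinct.
by rewrite eq_sym; apply: distinct => //; rewrite us/=; lra.
Qed.

Section of_curve.
Variables (m : int) (n : nat) (eta : R -> R).
Hypothesis curve : periodic_invariant_curve c m n eta.

Let g t := (of_ts c (t, eta t)).2.

Let annulus_eta t : annulus c (t, eta t).
Proof. by case: curve => _ _ sub _ _; apply: sub; exists t. Qed.

Let g_phase t : phase c t (g t) /\ height c t (g t) = eta t.
Proof.
have [u tu hu] := (annulusP _ _).1 (annulus_eta t).
by rewrite /g -hu of_ts_phase.
Qed.

Let of_ts_g t : of_ts c (t, eta t) = (t, g t).
Proof. by have [tg <-] := g_phase t; exact: of_ts_phase. Qed.

Let step t : height c (g t) (g (g t)) = height c (g t) t /\
  billiard_ts c (t, eta t) = (g t, eta (g t)).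
Proof.
have [tg _] := g_phase t; have [w gw hw] := billiard_exists Oc tg.
have e : billiard_ts c (t, eta t) = (g t, height c (g t) w).
  by rewrite /billiard_ts of_ts_g (billiard_phase tg gw hw) to_tsE.
have : graph_of eta (billiard_ts c (t, eta t)).
  by case: curve => _ _ _ sub _; apply: sub; exists (t, eta t) => //; exists t.
rewrite e => -[x _ [-> ew]].
have [gg hg] := g_phase (g t).
have wg : w = g (g t) by apply: (height_inj Oc gw gg); rewrite hg ew.
by split; [rewrite -[in LHS]wg|rewrite ew].
Qed.

Let g_degree t : g (t + 1) = g t + 1.
Proof.
have [tg hg] := g_phase t; have [tg1 hg1] := g_phase (t + 1).
have tgt : phase c (t + 1) (g t + 1) by exact: (phaseDz Oc 1 t (g t)).1 tg.
apply: (height_inj Oc tg1 tgt).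
have -> : height c (t + 1) (g t + 1) = height c t (g t).
  by rewrite (heightzD Oc t _ 1) (heightDz Oc _ _ 1).
by rewrite hg1 hg; case: curve.
Qed.

Lemma circle_map_of_curve : periodic_circle_map c m n g.
Proof.
split=> [t|t||t]; [by case: (g_phase t)|by case: (step t)|exact: g_degree|].
have it k : iter k (billiard_ts c) (t, eta t) = (iter k g t, eta (iter k g t)).
  by elim: k => //= k ->; have [_ ->] := step (iter k g t).
by case: curve => _ _ _ _ /(_ t); rewrite it => -[].
Qed.

(** [g t] solves [height c t (g t) = eta t], and the height is strictly increasing
    in its second argument: points on either side of [g t] stay on their side
    for nearby parameters. *)
Lemma circle_map_of_curve_continuous : continuous g.
Proof.
have eta_cont : continuous eta.
  by case: curve => _ /lipschitzP[L /lipschitz_continuous].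
move=> t; apply/cvgrPdist_lt => /= eps eps0.
have [tg hg] := g_phase t; have /andP[tgt gt] := (phaseP Oc t _).1 tg.
have [ts _ _ _] := oppositeP Oc t.
pose u := g t - Num.min eps (g t - t) / 2.
pose v := g t + Num.min eps (antipode c t - g t) / 2.
have m0 : 0 < Num.min eps (g t - t) by rewrite lt_min eps0 subr_gt0.
have m1 : 0 < Num.min eps (antipode c t - g t) by rewrite lt_min eps0 subr_gt0.
have me0 : Num.min eps (g t - t) <= eps by rewrite ge_min lexx.
have mg0 : Num.min eps (g t - t) <= g t - t by rewrite ge_min lexx orbT.
have me1 : Num.min eps (antipode c t - g t) <= eps by rewrite ge_min lexx.
have mg1 : Num.min eps (antipode c t - g t) <= antipode c t - g t.
  by rewrite ge_min lexx orbT.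
have tu : t < u < g t by rewrite /u; lra.
have gv : g t < v < antipode c t by rewrite /v; lra.
have tv : phase c t v by apply/(phaseP Oc); lra.
have hu : height c t u < eta t by rewrite -hg; apply: height_incr => //; lra.
have hv : eta t < height c t v.
  by rewrite -hg; apply: (height_incr Oc tv); lra.
have tu' : phase c t u by apply: (phase_subr Oc tg); lra.
have hcont w : height c x w @[x --> t] --> height c t w by exact: height_continuousl.
have wcont w : tangents c x w @[x --> t] --> tangents c t w by exact: tangents_continuousl.
have n1 : \forall x \near t, height c x u < eta x.
  exact: cvg_near_lt (hcont u) (eta_cont t) hu.
have n2 : \forall x \near t, eta x < height c x v.
  exact: cvg_near_lt (eta_cont t) (hcont v) hv.
have n3 : \forall x \near t, 0 < tangents c x u.
  by apply: cvgr_gt (wcont u) _ _; case: tu'.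
have n4 : \forall x \near t, 0 < tangents c x v.
  by apply: cvgr_gt (wcont v) _ _; case: tv.
have n5 : \forall x \near t, x < u by apply: lt_nbhsl; lra.
have n6 : \forall x \near t, v - 1 < x by apply: lt_nbhsr; lra.
near=> x.
have [xg hx] := g_phase x.
have xu : phase c x u.
  have : x < u by near: x.
  have : v - 1 < x by near: x.
  by split; [lra|near: x].
have xv : phase c x v.
  have : x < u by near: x.
  have : v - 1 < x by near: x.
  by split; [lra|near: x].
have gu : u < g x.
  rewrite ltNge; apply/negP => gu.
  have : height c x (g x) <= height c x u.
    move: gu; rewrite le_eqVlt => /predU1P[->//|gu].
    by apply/ltW/(height_incr Oc xu); case: xg; lra.
  by rewrite hx leNgt; apply/negP; rewrite negbK; near: x.
have gv' : g x < v.
  rewrite ltNge; apply/negP => vg.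
  have : height c x v <= height c x (g x).
    move: vg; rewrite le_eqVlt => /predU1P[->//|vg].
    by apply/ltW/(height_incr Oc xg); case: xv; lra.
  by rewrite hx leNgt; apply/negP; rewrite negbK; near: x.
by rewrite ltr_norml; rewrite /u in gu; rewrite /v in gv'; lra.
Unshelve. all: by end_near. Qed.

End of_curve.

Section theory.
Variables (m : int) (n : nat) (g : R -> R).
Hypotheses (n0 : (0 < n)%N) (gc : periodic_circle_map c m n g).

Lemma circle_degreez t (k : int) : g (t + k%:~R) = g t + k%:~R.
Proof.
have pn x (j : nat) : g (x + j%:R) = g x + j%:R.
  by elim: j => [|j IHj]; rewrite ?addr0// -natr1 !addrA (circle_degree gc) IHj.
case: k => j; first exact: pn.
by rewrite NegzE mulrNz; apply: (addIr j.+1%:R); rewrite -pn !subrK.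
Qed.

Lemma circle_inj : injective g.
Proof.
move=> x y gxy; have := circle_iter gc x; have := circle_iter gc y.
case: n n0 => // k _; rewrite !iterSr gxy => -> /addIr //.
Qed.

(** The circle map is injective because its [n]-th iterate is, and a continuous
    injection of the line of degree one is increasing. *)
Lemma circle_increasing : continuous g -> {mono g : x y / x <= y}.
Proof.
move=> cg x y; apply: (@itv_continuous_inj_le R g `]-oo, +oo[) => //.
- exists 0, 1; split=> //; rewrite -[1]add0r (circle_degree gc).
  by rewrite lerDl.
- exact: continuous_subspaceT.
- by move=> ? ? _ _; exact: circle_inj.
Qed.

(** Two bounces make less than one turn: otherwise the pair [(g t, t + 1)], whose
    tangents are oriented the wrong way, would be in the phase space. *)
Lemma circle_rotation_lt : m%:~R * 2 < n%:R :> R.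
Proof.
have two t : g (g t) < t + 1.
  rewrite ltNge; apply/negP => tg.
  have [/andP[_ gt] pt] := circle_phase gc t.
  have : phase c (g t) (t + 1).
    by apply: (phase_subr Oc (circle_phase gc (g t))); rewrite gt.
  by case=> _; rewrite (tangentsDz Oc _ _ 1) tangentsC oppr_gt0; lra.
have itlt j : iter j.+1.*2 g 0 < j.+1%:R.
  elim: j => [|j IHj]; first by have := two 0; rewrite add0r.
  rewrite doubleS !iterS; apply: lt_trans (two _) _.
  by rewrite -[j.+2%:R]natr1 ltrD2r.
have := itlt n.-1; rewrite prednK// -addnn iterD !(circle_iter gc).
by rewrite add0r; lra.
Qed.

End theory.

(** Everything but Lipschitz continuity is automatic: in the coordinates [(t, s)]
    the curve is the graph of [height c t (g t)]. *)
Lemma curve_of_circle_map m n g : periodic_circle_map c m n g ->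
  lipschitz (fun t => height c t (g t)) ->
  periodic_invariant_curve c m n (fun t => height c t (g t)).
Proof.
move=> gc lip.
have step t : billiard_ts c (t, height c t (g t)) = (g t, height c (g t) (g (g t))).
  have gt := circle_phase gc t.
  rewrite /billiard_ts (of_ts_phase gt).
  by rewrite (billiard_phase gt (circle_phase gc _) (circle_billiard gc t)) to_tsE.
split=> //.
- move=> t; rewrite (circle_degree gc) (heightzD Oc t _ 1).
  exact: (heightDz Oc _ _ 1).
- move=> _ [t _ <-]; apply/annulusP; exists (g t) => //; exact: (circle_phase gc).
- by move=> _ [_ [t _ <-] <-]; rewrite step; exists (g t).
- move=> t; have it k : iter k (billiard_ts c) (t, height c t (g t)) =
      (iter k g t, height c (iter k g t) (g (iter k g t))).
    by elim: k => //= k ->; rewrite step.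
  rewrite it (circle_iter gc) (circle_degreez gc).
  by rewrite (heightzD Oc) (heightDz Oc).
Qed.

End circle_map.

(** * Limits of invariant curves along an ultrafilter *)

Section analytic_ovals.
Variables (R : realType) (I : set R) (gamma : R -> R -> R * R).

Record analytic_ovals : Prop := AnalyticOvals {
  family_oval : forall e, I e -> oval (gamma e);
  family_an1 : forall e x, I e -> analytic_at I (fun e t => (gamma e t).1) e x;
  family_an2 : forall e x, I e -> analytic_at I (fun e t => (gamma e t).2) e x;
  family_dan1 : forall e x, I e ->
    analytic_at I (fun e t => (derive1 (gamma e) t).1) e x;
  family_dan2 : forall e x, I e ->
    analytic_at I (fun e t => (derive1 (gamma e) t).2) e x }.

Lemma analytic_at_eq (f h : R -> R -> R) e0 x0 :
  (forall e x, I e -> f e x = h e x) -> analytic_at I f e0 x0 ->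
  analytic_at I h e0 x0.
Proof.
move=> fh [a [rho [M [rho0 aM fa]]]]; exists a, rho, M; split=> // e y Ie er yr.
by rewrite -fh// fa.
Qed.

Lemma derivable_continuous1 (f : R -> R) x : derivable f x 1 -> {for x, continuous f}.
Proof. by move=> /derivable1_diffP/differentiable_continuous. Qed.

Lemma analytic_ovalsP Omega : (forall e, I e -> strictly_convex_domain (Omega e)) ->
  analytic_family I Omega gamma -> analytic_ovals.
Proof.
move=> convex [_ an1 an2 ccw].
have a1 := @analytic_onP _ I (fun e t => (gamma e t).1) an1.
have a2 := @analytic_onP _ I (fun e t => (gamma e t).2) an2.
have d1 e t : I e -> derive1 (fun t => (gamma e t).1) t = (derive1 (gamma e) t).1.
  move=> /ccw[_ /(_ t)[/derive1_coord[D _] _] _ _ _].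
  by rewrite derive1E derive_val.
have d2 e t : I e -> derive1 (fun t => (gamma e t).2) t = (derive1 (gamma e) t).2.
  move=> /ccw[_ /(_ t)[/derive1_coord[_ D] _] _ _ _].
  by rewrite derive1E derive_val.
have da1 e x : I e -> analytic_at I (fun e t => (derive1 (gamma e) t).1) e x.
  move=> Ie; have [_] := analytic_at_derive a1 x Ie.
  by apply: analytic_at_eq => e' x'; exact: d1.
have da2 e x : I e -> analytic_at I (fun e t => (derive1 (gamma e) t).2) e x.
  move=> Ie; have [_] := analytic_at_derive a2 x Ie.
  by apply: analytic_at_eq => e' x'; exact: d2.
split=> // e Ie; have [per der inj ran inn] := ccw e Ie.
split=> //.
- by move=> t; have [/derive1_coord[]] := der t.
- by move=> t; have [/derive1_coord[]] := der t.
- by move=> t; apply: derivable_continuous1; have [] := analytic_at_derive da1 t Ie.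
- by move=> t; apply: derivable_continuous1; have [] := analytic_at_derive da2 t Ie.
move=> t u; apply: (support_line (convex e Ie) (ccw e Ie)).
have : frontier (Omega e) (gamma e u) by rewrite -ran; exists u.
by case.
Qed.

Hypothesis A : analytic_ovals.

(** [0 <= M] is stated apart because [D] may be empty. *)
Lemma sup_norm (T : Type) (D : set T) :
  function_norm D (fun (f : T -> R) M => 0 <= M /\ forall x, D x -> `|f x| <= M).
Proof.
split.
- by move=> a; split.
- move=> f g a b [a0 fa] [b0 gb]; split=> [|x Dx]; first exact: addr_ge0.
  by rewrite (le_trans (ler_normD _ _))// lerD ?fa ?gb.
- move=> f g a b [a0 fa] [b0 gb]; split=> [|x Dx]; first exact: mulr_ge0.
  by rewrite normrM ler_pM ?fa ?gb.
- move=> f g M fM fg; split=> [|x Dx]; first by case: (fM 0%N).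
  apply: (cvgr_to_le (cvg_norm (fg x Dx))); apply: nearW => k.
  by case: (fM k) => _; apply.
- by move=> f a b ab [a0 fa]; split=> [|x Dx]; rewrite (le_trans _ ab)// fa.
- by move=> f M x [_]; apply.
Qed.

(** The first order expansion, in the algebra of functions on one point. *)
Lemma analytic_at_cvg (f : R -> R -> R) e0 x0 (T : Type) (F : set_system T)
    (FF : Filter F) (e x : T -> R) : I e0 -> analytic_at I f e0 x0 ->
  (\forall z \near F, I (e z)) -> e z @[z --> F] --> e0 ->
  x z @[z --> F] --> x0 -> f (e z) (x z) @[z --> F] --> f e0 x0.
Proof.
move=> Ie0 fa eI ee xx.
have [C [rho [C0 rho0 jet]]] := analytic_at_jet Ie0 fa.
set d := derive1 (f e0) x0 in jet.
apply/cvgrPdist_le => /= eps eps0.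
have B0 : 0 < C * 2 + `|d| + 1 by rewrite ltr_wpDl// addr_ge0// ?mulr_ge0// ltW.
pose del := Num.min 1 (Num.min rho (eps / (C * 2 + `|d| + 1))).
have del0 : 0 < del by rewrite /del !lt_min ltr01 rho0 divr_gt0.
have [del1 delr dele] : [/\ del <= 1, del <= rho & del * (C * 2 + `|d| + 1) <= eps].
  by rewrite -ler_pdivlMr// /del !ge_min !lexx !orbT.
have n1 := cvgr_dist_le _ _ ee _ del0.
have n2 := cvgr_dist_le _ _ xx _ del0.
apply: filterS3 eI (n1 FF) (n2 FF) => z Iez ez xz.
have := jet unit setT _ (sup_norm _) (fun=> e z) (fun=> x z - x0) del del.
case=> //.
- by split=> [|_ _]; [exact: ltW|rewrite distrC].
- by split=> [|_ _]; [exact: ltW|rewrite distrC].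
- by rewrite (ltW del0).
- by rewrite (ltW del0).
move=> _ /(_ tt Logic.I); rewrite subrKC => h.
have del2 : del ^+ 2 <= del by rewrite expr2 ler_piMr// ltW.
have h1 : C * (del + del ^+ 2) <= C * 2 * del.
  by rewrite -mulrA ler_wpM2l ?(ltW C0)//; lra.
have h2 : `|d * (x z - x0)| <= `|d| * del.
  by rewrite normrM ler_wpM2l// distrC.
rewrite distrC.
have -> : f (e z) (x z) - f e0 x0 =
  (f (e z) (x z) - f e0 x0 - d * (x z - x0)) + d * (x z - x0) by ring.
apply: le_trans (ler_normD _ _) _; apply: le_trans (lerD h h2) _.
by apply: le_trans dele; lra.
Qed.

Section cvg.
Variables (e0 t0 u0 : R) (T : Type) (F : set_system T) (e t u : T -> R).
Context {FF : Filter F}.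
Hypotheses (Ie0 : I e0) (eI : \forall z \near F, I (e z)).
Hypotheses (ee : e z @[z --> F] --> e0) (tt : t z @[z --> F] --> t0).
Hypotheses (uu : u z @[z --> F] --> u0).

Lemma height_cvg : height (gamma (e z)) (t z) (u z) @[z --> F]
  --> height (gamma e0) t0 u0.
Proof.
rewrite height.unlock; apply: cvgB; apply: cvgM.
- exact: analytic_at_cvg (family_dan1 A t0 Ie0) _ _ _.
- exact: analytic_at_cvg (family_an2 A u0 Ie0) _ _ _.
- exact: analytic_at_cvg (family_dan2 A t0 Ie0) _ _ _.
- exact: analytic_at_cvg (family_an1 A u0 Ie0) _ _ _.
Qed.

Lemma tangents_cvg : tangents (gamma (e z)) (t z) (u z) @[z --> F]
  --> tangents (gamma e0) t0 u0.
Proof.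
rewrite tangents.unlock; apply: cvgB; apply: cvgM.
- exact: analytic_at_cvg (family_dan1 A t0 Ie0) _ _ _.
- exact: analytic_at_cvg (family_dan2 A u0 Ie0) _ _ _.
- exact: analytic_at_cvg (family_dan2 A t0 Ie0) _ _ _.
- exact: analytic_at_cvg (family_dan1 A u0 Ie0) _ _ _.
Qed.

End cvg.

Lemma real_cvg_unique (T : Type) (F : set_system T) (FF : ProperFilter F)
    (f g : T -> R) (a b : R) : f x @[x --> F] --> a -> g x @[x --> F] --> b ->
  (\forall x \near F, f x = g x) -> a = b.
Proof.
move=> fa gb fg; apply/le_anti/andP; split.
  rewrite -subr_le0; apply: (cvgr_to_le (cvgB fa gb)).
  by apply: filterS fg => x fgx; rewrite -[leLHS]/(f x - g x) fgx subrr.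
rewrite -subr_ge0; apply: (cvgr_to_ge (cvgB fa gb)).
by apply: filterS fg => x fgx; rewrite -[leRHS]/(f x - g x) fgx subrr.
Qed.

(** Limits of bounded functions along an ultrafilter exist without passing to
    subsequences, hence simultaneously at all points of the circle. *)
Lemma ultra_cvg (T : Type) (U : set_system T) (f : T -> R) a b :
  UltraFilter U -> (\forall z \near U, a <= f z <= b) ->
  exists l : R, f z @[z --> U] --> l.
Proof.
move=> UU fab.
have [l [_ cl]] := @segment_compact R a b _ (fmap_proper_filter f _) fab.
exists l => B Bl.
have [//|UB] := in_ultra_setVsetC (f @^-1` B) UU.
by have [x [/= nB]] := cl (~` B) B UB Bl.
Qed.

Section ultralimit.
Variables (U : set_system R) (e0 : R) (m : int) (n : nat) (g : R -> R -> R).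
Context {UU : UltraFilter U}.
Hypotheses (Ie0 : I e0) (Ue0 : U --> e0) (m_gt0 : 0 < m) (n_gt0 : (0 < n)%N).
Hypothesis gU : \forall e \near U, [/\ I e,
  periodic_circle_map (gamma e) m n (g e) & {mono g e : x y / x <= y}].

Let IU : \forall e \near U, I e.
Proof. by apply: filterS gU => e []. Qed.

Let orbit k t e := iter k (g e) t.

Let orbit_cvg k t : exists l : R, orbit k t e @[e --> U] --> l.
Proof.
apply: (@ultra_cvg _ _ _ t (t + k%:R)); apply: filterS gU => e [Ie ge _].
rewrite /orbit; elim: k => [|k IHk]; first by rewrite addr0 /= lexx.
rewrite iterS; have [/andP[]] := circle_phase ge (iter k (g e) t).
by rewrite -natr1; lra.
Qed.

Let X k t : R := xget 0 [set l : R | orbit k t e @[e --> U] --> l].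

Let X_cvg k t : orbit k t e @[e --> U] --> X k t.
Proof. by have := xgetPex 0 (orbit_cvg k t). Qed.

Let X_unique k t (f : R -> R) (l : R) : f e @[e --> U] --> l ->
  (\forall e \near U, orbit k t e = f e) -> X k t = l.
Proof.
by move=> fl; exact: (real_cvg_unique _ (@X_cvg k t) fl).
Qed.

Let X0 t : X 0 t = t.
Proof. by apply: (X_unique (f := fun=> t)); [exact: cvg_cst|exact: nearW]. Qed.

Let XDn k t : X (k + n) t = X k t + m%:~R.
Proof.
apply: (X_unique (f := fun e => orbit k t e + m%:~R)).
  by apply: cvgD; [exact: X_cvg|exact: cvg_cst].
apply: filterS gU => e [Ie ge _].
by rewrite /orbit addnC iterD (circle_iter ge).
Qed.

Let X_le k t : X k t <= X k.+1 t.
Proof.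
apply: (ler_cvg_to (@X_cvg k t) (@X_cvg k.+1 t)); apply: filterS gU => e [Ie ge _].
by rewrite /orbit iterS; have [/andP[/ltW]] := circle_phase ge (iter k (g e) t).
Qed.

Let X_le1 k t : X k.+1 t <= X k t + 1.
Proof.
have l1 : orbit k t e + 1 @[e --> U] --> X k t + 1.
  by apply: cvgD; [exact: X_cvg|exact: cvg_cst].
apply: (ler_cvg_to (@X_cvg k.+1 t) l1); apply: filterS gU => e [Ie ge _].
by rewrite /orbit iterS; have [/andP[_ /ltW]] := circle_phase ge (iter k (g e) t).
Qed.

Let X_billiard k t : height (gamma e0) (X k.+1 t) (X k.+2 t) =
  height (gamma e0) (X k.+1 t) (X k t).
Proof.
have l1 := height_cvg Ie0 IU Ue0 (@X_cvg k.+1 t) (@X_cvg k.+2 t).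
have l2 := height_cvg Ie0 IU Ue0 (@X_cvg k.+1 t) (@X_cvg k t).
apply: (real_cvg_unique _ (l1 _) (l2 _)); apply: filterS gU => e [Ie ge _].
by rewrite /orbit !iterS (circle_billiard ge).
Qed.

Let X_tangents k t : 0 <= tangents (gamma e0) (X k t) (X k.+1 t).
Proof.
have l1 := tangents_cvg Ie0 IU Ue0 (@X_cvg k t) (@X_cvg k.+1 t).
apply: (cvgr_to_ge (l1 _)); apply: filterS gU => e [Ie ge _].
by rewrite /orbit iterS ltW//; case: (circle_phase ge (iter k (g e) t)).
Qed.

(* The height increases along the phase space, hence weakly in the limit; this
   rules out that the limit orbit jumps by a full turn. *)
Let X_height k t v : X k t < v < X k.+1 t ->
  height (gamma e0) (X k t) v <= height (gamma e0) (X k t) (X k.+1 t).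
Proof.
move=> /andP[kv vk].
have l1 : height (gamma e) (orbit k t e) v @[e --> U] -->
    height (gamma e0) (X k t) v.
  by apply: height_cvg => //; exact: cvg_cst.
have l2 := height_cvg Ie0 IU Ue0 (@X_cvg k t) (@X_cvg k.+1 t).
apply: (ler_cvg_to l1 (l2 _)); near=> e.
have [Ie ge _] : [/\ I e, periodic_circle_map (gamma e) m n (g e) &
  {mono g e : x y / x <= y}] by near: e.
apply/ltW/(height_incr (family_oval A Ie)).
  by rewrite /orbit iterS; exact: (circle_phase ge).
apply/andP; split; last by near: e; exact: cvgr_gt (@X_cvg k.+1 t) _ vk.
by apply/ltW; near: e; exact: cvgr_lt (@X_cvg k t) _ kv.
Unshelve. all: by end_near. Qed.

Let O0 : oval (gamma e0) := family_oval A Ie0.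

Let X_lt1 k t : X k.+1 t < X k t + 1.
Proof.
rewrite lt_neqAle X_le1 andbT; apply/eqP => e.
have v1 : X k t < X k t + 2^-1 < X k t + 1 by lra.
have := @X_height k t (X k t + 2^-1); rewrite e (heightDz O0 _ _ 1) => /(_ v1).
by rewrite leNgt (height_gtE O0 v1).
Qed.

(* If the limit orbit stops once, the tangent line at the next point keeps it
   there for ever. *)
Let X_lt k t : X k t < X k.+1 t.
Proof.
rewrite lt_neqAle X_le andbT; apply/eqP => e.
have st j : X (k + j) t = X k t /\ X (k + j).+1 t = X k t.
  elim: j => [|j [e1 e2]]; first by rewrite addn0.
  rewrite addnS e2; split=> //; apply/eqP; rewrite eq_sym -[_ == _]negbK.
  apply/negP => ne; have := X_billiard (k + j) t; rewrite e1 e2 => hE.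
  have : X k t < X (k + j).+2 t < X k t + 1.
    by rewrite -e2 X_lt1 andbT lt_neqAle X_le andbT e2.
  by move=> /(height_gtE O0); rewrite hE ltxx.
have [+ _] := st n; rewrite XDn => /eqP; rewrite -subr_eq0 addrC addKr intr_eq0.
by rewrite gt_eqF.
Qed.

(* At the other end of the phase space, every second point of the limit orbit
   would advance by one full turn. *)
Let X_phase k t : phase (gamma e0) (X k t) (X k.+1 t).
Proof.
split; first by rewrite X_lt X_lt1.
rewrite lt_neqAle X_tangents andbT; apply/eqP => /esym par.
have st i : tangents (gamma e0) (X i t) (X i.+1 t) = 0 ->
    X i.+2 t = X i t + 1 /\ tangents (gamma e0) (X i.+1 t) (X i.+2 t) = 0.
  move=> e.
  have lt01 : X i t < X i.+1 t < X i t + 1 by rewrite X_lt X_lt1.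
  have ne := distinct O0 lt01; rewrite eq_sym in ne.
  have e' : tangents (gamma e0) (X i.+1 t) (X i t) = 0 by rewrite tangentsC e oppr0.
  have [eq|ne2] := eqVneq (gamma e0 (X i.+2 t)) (gamma e0 (X i t)); last first.
    by have := height_max O0 e' ne ne2; rewrite X_billiard ltxx.
  have [j ij] := oval_inj O0 (esym eq).
  have j0 : (0 : R) < j%:~R.
    by have := X_lt i t; have := X_lt i.+1 t; rewrite ij; lra.
  have j2 : (j%:~R : R) < 2%:~R.
    by have := X_lt1 i t; have := X_lt1 i.+1 t; rewrite ij; lra.
  have j1 : j = 1.
    by move: j0 j2; rewrite ltr0z ltr_int; case: (j) => [[|[|]]|].
  by rewrite ij j1 (tangentsDz O0 _ _ 1).
have st2 j : X (k + j.*2) t = X k t + j%:R /\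
    tangents (gamma e0) (X (k + j.*2) t) (X (k + j.*2).+1 t) = 0.
  elim: j => [|j [ej tj]]; first by rewrite addn0 addr0.
  have [e1 t1] := st _ tj; have [e2 t2] := st _ t1.
  by rewrite doubleS !addnS; split=> //; rewrite e1 ej -natr1 addrA.
have [] := st2 n; rewrite -addnn addnA !XDn => e _.
have [e1 [Ie1 ge _]] := filter_ex gU.
by have := circle_rotation_lt (family_oval A Ie1) n_gt0 ge; lra.
Qed.

(* The orbits of [t] and of its limit [X k t] are ordered along the
   ultrafilter; since they pass through the same point, the twist forces them
   to coincide. *)
Let X_comp k t : X k.+1 t = X 1 (X k t).
Proof.
set a := X k t.
have le_ge : (forall i, X (k + i) t <= X i a) \/ (forall i, X i a <= X (k + i) t).
  have [UA|UA] := in_ultra_setVsetC [set e | orbit k t e <= a] UU; [left|right].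
    move=> i; apply: (ler_cvg_to (@X_cvg (k + i) t) (@X_cvg i a)).
    apply: filterS2 UA gU => e /= ea [_ _ mono].
    by rewrite /orbit addnC iterD; elim: i => //= i; rewrite mono.
  move=> i; apply: (ler_cvg_to (@X_cvg i a) (@X_cvg (k + i) t)).
  apply: filterS2 UA gU => e /= ea [_ _ mono].
  rewrite /orbit addnC iterD; elim: i => [|i] /=; last by rewrite mono.
  by rewrite ltW// ltNge; apply/negP.
case: (n) n_gt0 XDn => // n' _ XD.
have b1 : X (k + n').+1 t = a + m%:~R by rewrite -addnS XD.
have b2 : X n'.+1 a = a + m%:~R by rewrite -[n'.+1]add0n XD X0.
have := X_billiard (k + n') t; have := X_billiard n' a.
have := X_phase (k + n') t; have := X_phase n' a.
have := X_phase (k + n').+1 t; have := X_phase n'.+1 a.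
rewrite b1 b2 => p1 p2 p3 p4 h1 h2.
suff : X (k + n').+2 t = X n'.+2 a.
  by rewrite -!addnS -addSnnS -[n'.+2]add1n !XD => /addIr.
case: le_ge => le.
  apply: (twist_unique O0 p2 p1 p4 p3 h2 h1); first exact: le.
  by have := le n'.+2; rewrite !addnS.
apply/esym/(twist_unique O0 p1 p2 p3 p4 h1 h2); first exact: le.
by have := le n'.+2; rewrite !addnS.
Qed.

(** Each point of each orbit converges on its own along the ultrafilter.  The
    limits stay strictly inside the phase space because the rotation number
    [m / n] is neither [0] nor as large as [1 / 2], and they are iterates of one
    map because of the twist. *)
Lemma ultralimit_circle_map : exists g0, [/\
  periodic_circle_map (gamma e0) m n g0, {mono g0 : x y / x <= y} &
  forall k t, iter k (g e) t @[e --> U] --> iter k g0 t].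
Proof.
have itX k t : iter k (X 1) t = X k t.
  by elim: k => [|k IHk]; [rewrite X0|rewrite iterS IHk -X_comp].
have c0 : periodic_circle_map (gamma e0) m n (X 1).
  split=> t.
  - by have := X_phase 0 t; rewrite X0.
  - by have := X_billiard 0 t; rewrite (X_comp 1) X0.
  - apply: (X_unique (f := fun e => orbit 1 t e + 1)).
      by apply: cvgD; [exact: X_cvg|exact: cvg_cst].
    by apply: filterS gU => e [_ ge _]; rewrite /orbit /= (circle_degree ge).
  - by rewrite itX -[n]add0n XDn X0.
exists (X 1); split=> //; last by move=> k t; rewrite itX; exact: X_cvg.
have homo x y : x <= y -> X 1 x <= X 1 y.
  move=> xy; apply: (ler_cvg_to (@X_cvg 1 x) (@X_cvg 1 y)).
  by apply: filterS gU => e [_ _ mono]; rewrite /orbit /= mono.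
apply: le_mono => x y xy; rewrite lt_neqAle homo ?ltW// andbT.
by apply: contraTneq xy => /(circle_inj n_gt0 c0)->; rewrite ltxx.
Qed.

End ultralimit.
End analytic_ovals.

(** * Two normed algebras of functions *)

Section l1_norm.
Variable R : realType.
Implicit Types (p q : {poly R}) (z x : R).

Definition l1 p : R := \sum_(i < size p) `|p`_i|.

Lemma l1_widen n p : (size p <= n)%N -> l1 p = \sum_(i < n) `|p`_i|.
Proof.
move=> pn; rewrite /l1 (big_ord_widen n (fun i => `|p`_i|))// big_mkcond/=.
apply: eq_bigr => i _; case: ltnP => // pi.
by rewrite nth_default// normr0.
Qed.

Lemma l1_ge0 p : 0 <= l1 p. Proof. exact: sumr_ge0. Qed.

Lemma l1_polyC (a : R) : l1 a%:P = `|a|.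
Proof. by rewrite (@l1_widen 1) ?size_polyC_leq1// big_ord1 coefC. Qed.

Lemma l1D p q : l1 (p + q) <= l1 p + l1 q.
Proof.
pose n := maxn (size p) (size q).
rewrite (@l1_widen n (p + q)) ?size_polyD// (@l1_widen n p) ?leq_maxl//.
rewrite (@l1_widen n q) ?leq_maxr// -big_split/=; apply: ler_sum => i _.
by rewrite coefD ler_normD.
Qed.

Lemma l1Z (a : R) p : l1 (a *: p) = `|a| * l1 p.
Proof.
rewrite (@l1_widen (size p)) ?size_scale_leq// /l1 big_distrr/=.
by apply: eq_bigr => i _; rewrite coefZ normrM.
Qed.

Lemma l1N p : l1 (- p) = l1 p.
Proof. by rewrite -scaleN1r l1Z normrN1 mul1r. Qed.

Lemma l1_cons p (a : R) : l1 (p * 'X + a%:P) = l1 p + `|a|.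
Proof.
rewrite (@l1_widen (size p).+1); last by rewrite size_MXaddC; case: ifP.
rewrite big_ord_recl coefD coefMX coefC/= add0r addrC; congr (_ + _).
by apply: eq_bigr => i _; rewrite coefD coefMX coefC/= addr0.
Qed.

Lemma l1MX p : l1 (p * 'X) = l1 p.
Proof. by have := l1_cons p 0; rewrite normr0 !addr0. Qed.

Lemma l1M p q : l1 (p * q) <= l1 p * l1 q.
Proof.
elim/poly_ind: p => [|p a IHp].
  by rewrite mul0r /l1 size_poly0 !big_ord0 mul0r.
rewrite l1_cons mulrDl mulrDl; apply: le_trans (l1D _ _) _.
by rewrite mulrAC l1MX mul_polyC l1Z lerD2r.
Qed.

Lemma horner_l1 p x : `|x| <= 1 -> `|p.[x]| <= l1 p.
Proof.
move=> x1; elim/poly_ind: p => [|p a IHp].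
  by rewrite horner0 normr0 l1_ge0.
rewrite l1_cons !hornerE; apply: le_trans (ler_normD _ _) _.
by rewrite lerD2r normrM (le_trans _ IHp)// ler_piMr.
Qed.

(** From [q * 'X = (p - p.[z]) + z *: q] and the isometry [q |-> q * 'X]. *)
Lemma l1_factor p z : `|z| < 1 -> exists q,
  (1 - `|z|) * l1 q <= 2 * l1 p /\ forall x, p.[x] - p.[z] = (x - z) * q.[x].
Proof.
move=> z1; have : root (p - p.[z]%:P) z by rewrite rootE !hornerE subrr.
move=> /factor_theorem[q pq]; exists q; split; last first.
  move=> x; have := congr1 (horner^~ x) pq; rewrite /= !hornerE => ->.
  by rewrite mulrC.
have e : q * 'X = (p - p.[z]%:P) + z *: q.
  by rewrite pq mulrBr -mul_polyC [z%:P * q]mulrC subrK.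
have : l1 q <= 2 * l1 p + `|z| * l1 q.
  rewrite -{1}l1MX e; apply: le_trans (l1D _ _) _; rewrite l1Z lerD2r.
  apply: le_trans (l1D _ _) _; rewrite l1N l1_polyC mulr_natl mulr2n lerD2l.
  by apply: horner_l1; exact: ltW.
by lra.
Qed.

End l1_norm.

Lemma near_seq (J : eqType) (T : Type) (F : set_system T) (FF : Filter F)
    (s : seq J) (P : J -> T -> Prop) :
  (forall j, j \in s -> \forall x \near F, P j x) ->
  \forall x \near F, forall j, j \in s -> P j x.
Proof.
elim: s => [_|i s IHs sP]; first by apply: filterE.
have Pi : \forall x \near F, P i x by apply: sP; rewrite inE eqxx.
have Ps : \forall x \near F, forall j, j \in s -> P j x.
  by apply: IHs => j js; apply: sP; rewrite inE js orbT.
by apply: filterS2 Pi Ps => x Pix Psx j; rewrite inE => /predU1P[->|/Psx].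
Qed.

Section poly_norm.
Variable R : realType.
Implicit Types (D : set R) (f g : R -> R) (s : seq R).

(** Pointwise limits of polynomials whose coefficients have a bounded sum of
    absolute values: inside the interval from -1 to 1 these are the sums of power
    series with the same bound, but no coefficients need to be produced. *)
Definition poly_norm D f (M : R) := forall s, (forall x, x \in s -> D x) ->
  forall del : R, 0 < del -> exists2 p : {poly R}, l1 p <= M &
    forall x, x \in s -> `|p.[x] - f x| <= del.

Lemma poly_normP D : D `<=` [set x | `|x| <= 1] -> function_norm D (poly_norm D).
Proof.
move=> D1.
have bound f M x : poly_norm D f M -> D x -> `|f x| <= M.
  move=> fM Dx; apply/ler_addgt0Pr => del del0.
  have [|p pM pf] := fM [:: x] _ del del0.
    by move=> y; rewrite inE => /eqP->.
  have := pf x; rewrite inE eqxx => /(_ isT) px.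
  have := horner_l1 p (D1 _ Dx); rewrite distrC in px.
  have -> : f x = (f x - p.[x]) + p.[x] by ring.
  by move=> hp; apply: le_trans (ler_normD _ _) _; lra.
split=> //.
- move=> a s sD del del0; exists a%:P; first by rewrite l1_polyC.
  by move=> x _; rewrite hornerC subrr normr0 ltW.
- move=> f g A B fA gB s sD del del0.
  have del2 : 0 < del / 2 by rewrite divr_gt0.
  have [p pA pf] := fA s sD _ del2; have [q qB qg] := gB s sD _ del2.
  exists (p + q); first by rewrite (le_trans (l1D _ _))// lerD.
  move=> x xs; rewrite hornerD.
  have -> : p.[x] + q.[x] - (f x + g x) = (p.[x] - f x) + (q.[x] - g x) by ring.
  apply: le_trans (ler_normD _ _) _.
  by have := pf x xs; have := qg x xs; lra.
- move=> f g A B fA gB s sD del del0.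
  have [p0 p0A _] := fA s sD _ del0; have [q0 q0B _] := gB s sD _ del0.
  have A0 : 0 <= A by exact: le_trans (l1_ge0 p0) p0A.
  have B0 : 0 <= B by exact: le_trans (l1_ge0 q0) q0B.
  have AB0 : 0 < A + B + 1 by rewrite ltr_wpDl// addr_ge0.
  have del1 : 0 < del / (A + B + 1) by rewrite divr_gt0.
  have [p pA pf] := fA s sD _ del1; have [q qB qg] := gB s sD _ del1.
  exists (p * q).
    by rewrite (le_trans (l1M _ _))// ler_pM ?l1_ge0.
  move=> x xs; rewrite hornerM.
  have -> : p.[x] * q.[x] - f x * g x =
    p.[x] * (q.[x] - g x) + (p.[x] - f x) * g x by ring.
  apply: le_trans (ler_normD _ _) _; rewrite !normrM.
  apply: le_trans (_ : A * (del / (A + B + 1)) + (del / (A + B + 1)) * B <= _).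
    apply: lerD; apply: ler_pM => //; last 2 first.
    + exact: pf.
    + exact: bound (sD _ xs).
    + exact: le_trans (horner_l1 _ (D1 _ (sD _ xs))) pA.
    + exact: qg.
  have -> : A * (del / (A + B + 1)) + del / (A + B + 1) * B =
    del / (A + B + 1) * (A + B) by ring.
  by rewrite mulrAC ler_pdivrMr// ler_wpM2l ?(ltW del0)// lerDl.
- move=> f g M fM fg s sD del del0.
  have del2 : 0 < del / 2 by rewrite divr_gt0.
  have : \forall k \near \oo, forall x, x \in s -> `|f k x - g x| <= del / 2.
    apply: near_seq => x xs; have := cvgr_dist_le _ _ (fg x (sD x xs)) _ del2.
    by move=> /(_ _); apply: filterS => k; rewrite distrC.
  move=> [k _ /(_ k (leqnn k)) kfg].
  have [p pM pf] := fM k s sD _ del2; exists p => // x xs.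
  have -> : p.[x] - g x = (p.[x] - f k x) + (f k x - g x) by ring.
  apply: le_trans (ler_normD _ _) _.
  by have := pf x xs; have := kfg x xs; lra.
move=> f A B AB fA s sD del del0; have [p pA pf] := fA s sD _ del0.
by exists p => //; exact: le_trans AB.
Qed.

Lemma poly_norm_id D : poly_norm D id 1.
Proof.
move=> s sD del del0; exists 'X; last first.
  by move=> x _; rewrite hornerX subrr normr0 ltW.
by rewrite -['X]mul1r l1MX -[1%R]/(1%:P) l1_polyC normr1.
Qed.

(** Dividing by [x - z] at a zero [z] multiplies the bound by a constant, while
    [x - z] itself is small for small [x] and [z]. *)
Lemma poly_norm_div D f M z : poly_norm D f M -> D z -> `|z| <= 8^-1 ->
  f z = 0 -> poly_norm (D `\ z) (fun x => f x / (x - z)) (16 / 7 * M).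
Proof.
move=> fM Dz z8 fz s sD del del0.
have [mu mu0 smu] : exists2 mu : R, 0 < mu & forall x, x \in s -> mu <= `|x - z|.
  elim: s sD => [_|y s IHs sD]; first by exists 1.
  have [|mu mu0 smu] := IHs; first by move=> x xs; apply: sD; rewrite inE xs orbT.
  have [_ /= yz] : (D `\ z) y by apply: sD; rewrite inE eqxx.
  exists (Num.min mu `|y - z|).
    by rewrite lt_min mu0 normr_gt0 subr_eq0; apply/eqP.
  by move=> x; rewrite inE => /predU1P[->|/smu mux]; rewrite ge_min ?lexx ?mux ?orbT.
have dmu0 : 0 < del * mu / 2 by rewrite divr_gt0// mulr_gt0.
have [|p pM pf] := fM (z :: s) _ _ dmu0.
  by move=> x; rewrite inE => /predU1P[->//|/sD[]].
have [|q [ql qE]] := @l1_factor _ p z; first by lra.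
exists q.
  by have := l1_ge0 q; nra.
move=> x xs; have xz0 : 0 < `|x - z| by exact: lt_le_trans mu0 (smu x xs).
have xz : x - z != 0 by rewrite -normr_gt0.
have pz : `|p.[z]| <= del * mu / 2.
  by have := pf z; rewrite inE eqxx fz subr0; apply.
have px : `|p.[x] - f x| <= del * mu / 2 by apply: pf; rewrite inE xs orbT.
have -> : q.[x] - f x / (x - z) = ((p.[x] - f x) - p.[z]) / (x - z).
  by apply: (mulIf xz); rewrite mulfVK// mulrBl mulfVK// mulrC -qE; ring.
rewrite normrM normfV ler_pdivrMr//; apply: le_trans (ler_normB _ _) _.
apply: (@le_trans _ _ (del * mu)); first by lra.
by apply: ler_wpM2l; [exact: ltW|exact: smu].
Qed.

(** Dividing out a zero [z] costs a factor [16 / 7], and [x - z] is at most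
    [1 / 4 + 1 / 8 = 3 / 8].  As [16 / 7 * (3 / 8) < 1], the value at [x] is
    arbitrarily small when there are arbitrarily many zeros. *)
Lemma poly_norm_identity D f M : D `<=` [set x | `|x| <= 1] ->
  poly_norm D f M ->
  (forall s, exists z, [/\ D z, z \notin s, `|z| <= 8^-1 & f z = 0]) ->
  forall x, D x -> `|x| <= 4^-1 -> f x = 0.
Proof.
move=> D1 fM fz x Dx x4; apply/eqP; rewrite -normr_le0.
have bound k : `|f x| <= (6 / 7) ^+ k * M.
  elim: k D f M D1 fM fz Dx => [|k IHk] D f M D1 fM fz Dx.
    by rewrite expr0 mul1r; exact: (norm_bound (poly_normP D1) fM Dx).
  have [z [Dz]] := fz [:: x]; rewrite inE => zx z8 fz0.
  have Dx' : (D `\ z) x by split=> //=; apply/eqP; rewrite eq_sym.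
  have := IHk _ _ _ _ (poly_norm_div fM Dz z8 fz0) _ Dx'.
  have D1' : D `\ z `<=` [set x | `|x| <= 1] by move=> y [/D1].
  move=> /(_ D1') IH.
  have {}IH : `|f x / (x - z)| <= (6 / 7) ^+ k * (16 / 7 * M).
    apply: IH => s; have [y [Dy ys y8 fy]] := fz (z :: s).
    move: ys; rewrite inE negb_or => /andP[yz ys].
    by exists y; split=> //; [split=> //=; exact/eqP|rewrite fy mul0r].
  have xz : x - z != 0 by rewrite subr_eq0 eq_sym.
  have -> : f x = f x / (x - z) * (x - z) by rewrite mulfVK.
  rewrite normrM exprS; have : `|x - z| <= 3 / 8.
    by apply: le_trans (ler_normB _ _) _; lra.
  move=> xz8; have : 0 <= (6 / 7) ^+ k * (16 / 7 * M) by exact: le_trans IH.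
  have := ler_pM (normr_ge0 _) (normr_ge0 _) IH xz8.
  by move=> le _; apply: le_trans le _; rewrite le_eqVlt; apply/orP; left; apply/eqP; field.
have c : (6 / 7) ^+ k * M @[k --> \oo] --> 0 * M.
  by apply: cvgMr_tmp; apply: cvg_expr; rewrite ger0_norm; lra.
rewrite mul0r in c; apply: (cvgr_to_ge c); exact: nearW.
Qed.

End poly_norm.

Section lipschitz_norm.
Variables (R : realType) (K : R).
Hypothesis K_ge0 : 0 <= K.

(** Functions on two points, with a weight [K] on their difference: a bound in
    this algebra is a Lipschitz estimate. *)
Definition lipschitz_norm (f : bool -> R) (M : R) :=
  forall b, `|f b| + K * `|f true - f false| <= M.

Lemma lipschitz_normP : function_norm setT lipschitz_norm.
Proof.
split=> //.
- by move=> a b; rewrite subrr normr0 mulr0 addr0.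
- move=> f g A B fA gB b.
  have -> : f true + g true - (f false + g false) =
    (f true - f false) + (g true - g false) by ring.
  have := fA b; have := gB b; have := ler_normD (f b) (g b).
  have := ler_wpM2l K_ge0 (ler_normD (f true - f false) (g true - g false)).
  by lra.
- move=> f g A B fA gB b.
  have -> : f true * g true - f false * g false =
    f true * (g true - g false) + (f true - f false) * g false by ring.
  set df := f true - f false in fA *; set dg := g true - g false in gB *.
  have d0 : 0 <= K * `|df| by rewrite mulr_ge0.
  have e0 : 0 <= K * `|dg| by rewrite mulr_ge0.
  have h1 : `|f b| * `|g b| <= (A - K * `|df|) * (B - K * `|dg|).
    by apply: ler_pM => //; [have := fA b|have := gB b]; lra.
  have h2 : `|f true| * (K * `|dg|) <= (A - K * `|df|) * (K * `|dg|).
    by apply: ler_wpM2r => //; have := fA true; lra.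
  have h3 : K * `|df| * `|g false| <= K * `|df| * (B - K * `|dg|).
    by apply: ler_wpM2l => //; have := gB false; lra.
  have := ler_wpM2l K_ge0 (ler_normD (f true * dg) (df * g false)).
  have := mulr_ge0 d0 e0; rewrite !normrM.
  by nra.
- move=> f g M fM fg b.
  have c : `|f k b| + K * `|f k true - f k false| @[k --> \oo] -->
      `|g b| + K * `|g true - g false|.
    apply: cvgD; first by apply: cvg_norm; exact: fg.
    by apply: cvgMl_tmp; apply: cvg_norm; apply: cvgB; exact: fg.
  by apply: (cvgr_to_le c); apply: nearW => k; exact: fM.
- by move=> f A B AB fA b; exact: le_trans AB.
- move=> f M b fM _; have := fM b; have := mulr_ge0 K_ge0 (normr_ge0 (f true - f false)).
  by lra.
Qed.

End lipschitz_norm.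

(** * An inverse function theorem with analytic parameter *)

Section expansion.
Variables (R : realType) (I : set R) (e0 : R) (n : nat) (x : 'I_n -> R).
Implicit Types (E F : R -> ('I_n -> R) -> R) (a b : 'I_n -> R).

(** First order expansion at [(e0, x)] with linear part [a], uniformly over all
    normed algebras of functions. *)
Definition expansion E (E0 : R) a := exists C rho : R, [/\ 0 < C, 0 < rho &
  forall (T : Type) (D : set T) (N : (T -> R) -> R -> Prop), function_norm D N ->
  forall (e : T -> R) (y : 'I_n -> T -> R) (sigma r : R),
    (forall z, D z -> I (e z)) -> N (fun z => e z - e0) sigma ->
    (forall k, N (y k) r) -> 0 <= sigma <= r -> r <= rho ->
    N (fun z => E (e z) (fun k => x k + y k z) - E0 - \sum_k a k * y k z)
      (C * (sigma + r ^+ 2))].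

Lemma norm_linear T (D : set T) N (NN : function_norm D N) a
    (y : 'I_n -> T -> R) r : (forall k, N (y k) r) ->
  N (fun z => \sum_k a k * y k z) ((\sum_k `|a k|) * r).
Proof.
move=> Ny; rewrite mulr_suml; apply: (norm_sum NN) => k.
exact: (norm_cstM NN).
Qed.

Lemma expansion_coord (f : R -> R -> R) k : I e0 -> analytic_at I f e0 (x k) ->
  expansion (fun e z => f e (z k)) (f e0 (x k))
    (fun l => if l == k then derive1 (f e0) (x k) else 0).
Proof.
move=> Ie0 fa; have [C [rho [C0 rho0 jet]]] := analytic_at_jet Ie0 fa.
exists C, rho; split=> // T D N NN e y sigma r eI Ne Ny /andP[s0 sr] rrho.
apply: (norm_ext NN) (jet T D N NN e (y k) sigma r eI Ne (Ny k) _ _).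
- move=> z Dz; rewrite (bigD1 k)//= eqxx big1 ?addr0// => l /negbTE->.
  by rewrite mul0r.
- by rewrite s0 (le_trans sr).
- by rewrite (le_trans s0).
Qed.

Lemma expansion_var k :
  expansion (fun e z => z k - x k) 0 (fun l => if l == k then 1 else 0).
Proof.
exists 1, 1; split=> // T D N NN e y sigma r eI Ne Ny /andP[s0 sr] _.
apply: (norm_le NN (A := `|0|)).
  by rewrite normr0 mul1r addr_ge0// sqr_ge0.
apply: (norm_ext NN) (norm_cst NN 0) => z _.
rewrite (bigD1 k)//= eqxx big1 => [|l /negbTE->]; last by rewrite mul0r.
by ring.
Qed.

Lemma expansionB E F (E0 F0 : R) a b : expansion E E0 a -> expansion F F0 b ->
  expansion (fun e z => E e z - F e z) (E0 - F0) (fun k => a k - b k).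
Proof.
move=> [C [rho [C0 rho0 jE]]] [C' [rho' [C'0 rho'0 jF]]].
exists (C + C'), (Num.min rho rho'); split; [exact: addr_gt0|by rewrite lt_min rho0|].
move=> T D N NN e y sigma r eI Ne Ny sr; rewrite le_min => /andP[rr rr'].
have NE := jE T D N NN e y sigma r eI Ne Ny sr rr.
have NF := jF T D N NN e y sigma r eI Ne Ny sr rr'.
rewrite mulrDl; apply: (norm_ext NN) (norm_sub NN NE NF) => z _.
under [in RHS]eq_bigr do rewrite mulrBl.
by rewrite sumrB; ring.
Qed.

Lemma expansionM E F (E0 F0 : R) a b : expansion E E0 a -> expansion F F0 b ->
  expansion (fun e z => E e z * F e z) (E0 * F0) (fun k => E0 * b k + F0 * a k).
Proof.
move=> [C [rho [C0 rho0 jE]]] [C' [rho' [C'0 rho'0 jF]]].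
pose A : R := \sum_k `|a k|; pose B : R := \sum_k `|b k|.
have A0 : 0 <= A by exact: sumr_ge0.
have B0 : 0 <= B by exact: sumr_ge0.
exists (`|E0| * C' + `|F0| * C + (A + 2 * C) * (B + 2 * C')).
exists (Num.min 1 (Num.min rho rho')); split; last 1 first.
- move=> T D N NN e y sigma r eI Ne Ny sr.
  rewrite !le_min => /andP[r1 /andP[rr rr']].
  have NE := jE T D N NN e y sigma r eI Ne Ny sr rr.
  have NF := jF T D N NN e y sigma r eI Ne Ny sr rr'.
  have Na := norm_linear NN a Ny; have Nb := norm_linear NN b Ny.
  rewrite -/A in Na; rewrite -/B in Nb.
  have N1 := norm_add NN (norm_cstM NN E0 NF) (norm_cstM NN F0 NE).
  have N2 := norm_mul NN (norm_add NN Na NE) (norm_add NN Nb NF).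
  apply: (norm_le NN); last first.
    apply: (norm_ext NN) (norm_add NN N1 N2) => z _ /=.
    have -> : \sum_k (E0 * b k + F0 * a k) * y k z =
        E0 * (\sum_k b k * y k z) + F0 * (\sum_k a k * y k z).
      rewrite !big_distrr -big_split/=; apply: eq_bigr => k _.
      by rewrite mulrDl !mulrA.
    by ring.
  case/andP: sr => s0 sr.
  have r0 : 0 <= r by exact: le_trans sr.
  have k0 : 0 <= sigma + r ^+ 2 by rewrite addr_ge0// sqr_ge0.
  have k2 : sigma + r ^+ 2 <= 2 * r by nra.
  rewrite [leRHS]mulrDl; apply: lerD.
    by rewrite le_eqVlt; apply/orP; left; apply/eqP; ring.
  have h1 : A * r + C * (sigma + r ^+ 2) <= (A + 2 * C) * r.
    by rewrite mulrDl lerD2l -mulrA mulrCA ler_wpM2l// ltW.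
  have h2 : B * r + C' * (sigma + r ^+ 2) <= (B + 2 * C') * r.
    by rewrite mulrDl lerD2l -mulrA mulrCA ler_wpM2l// ltW.
  have := ler_pM _ _ h1 h2; rewrite !addr_ge0 ?mulr_ge0 ?(ltW C0) ?(ltW C'0)//.
  move=> /(_ isT isT) h3; apply: le_trans h3 _.
  rewrite mulrACA; apply: ler_wpM2l.
    by rewrite mulr_ge0// addr_ge0// mulr_ge0// ltW.
  by rewrite expr2 lerDr.
- rewrite ltr_wpDl ?mulr_gt0 ?addr_ge0 ?mulr_ge0 ?(ltW C0) ?(ltW C'0)//.
  + by rewrite ltr_wpDl// mulr_gt0.
  + by rewrite ltr_wpDl// mulr_gt0.
- by rewrite !lt_min ltr01 rho0.
Qed.

(** Only boundedness in the algebra is retained: it is what the identity theorem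
    asks for. *)
Lemma expansion_bound E (E0 : R) a : expansion E E0 a -> exists2 rho : R, 0 < rho &
  forall (T : Type) (D : set T) (N : (T -> R) -> R -> Prop), function_norm D N ->
  forall (e : T -> R) (y : 'I_n -> T -> R) (sigma r : R),
    (forall z, D z -> I (e z)) -> N (fun z => e z - e0) sigma ->
    (forall k, N (y k) r) -> 0 <= sigma <= r -> r <= rho ->
    exists M, N (fun z => E (e z) (fun k => x k + y k z)) M.
Proof.
move=> [C [rho [C0 rho0 jE]]]; exists rho => // T D N NN e y sigma r eI Ne Ny sr rr.
have NE := jE T D N NN e y sigma r eI Ne Ny sr rr.
have := norm_add NN (norm_add NN NE (norm_linear NN a Ny)) (norm_cst NN E0).
move=> H; eexists; apply: (norm_ext NN) H => z _ /=; ring.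
Qed.

End expansion.

Section inverse_function.
Variables (R : realType) (I : set R) (e0 : R) (n : nat) (x : 'I_n -> R).
Variables (F : 'I_n -> R -> ('I_n -> R) -> R) (A : 'M[R]_n).
Hypothesis FA : forall k, expansion I e0 x (F k) 0 (A k).
Hypothesis A_unit : A \in unitmx.
Implicit Types (tau y : 'I_n -> R) (e r d : R).

(** One step of the simplified Newton method for [F e (x + y) = tau]. *)
Definition newton e tau y k : R :=
  y k - \sum_l invmx A k l * (F l e (fun j => x j + y j) - tau l).

Lemma newton_fixed e tau y : (forall k, newton e tau y k = y k) <->
  (forall k, F k e (fun j => x j + y j) = tau k).
Proof.
split=> H k; last by rewrite /newton big1 ?subr0// => l _; rewrite H subrr mulr0.
pose v := \col_l (F l e (fun j => x j + y j) - tau l).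
have v0 : invmx A *m v = 0.
  apply/matrixP => i j; rewrite !mxE; have := H i; rewrite /newton.
  rewrite -[RHS]subr0 => /addrI/oppr_inj e0'.
  by rewrite -[RHS]e0'; apply: eq_bigr => l _; rewrite mxE.
have : A *m (invmx A *m v) = 0 by rewrite v0 mulmx0.
rewrite mulmxA mulmxV// mul1mx => /matrixP /(_ k 0).
by rewrite !mxE => /subr0_eq.
Qed.

Lemma uniform_expansion : exists C rho : R, [/\ 0 < C, 0 < rho &
  forall l (T : Type) (D : set T) (N : (T -> R) -> R -> Prop), function_norm D N ->
  forall (e : T -> R) (y : 'I_n -> T -> R) (sigma r : R),
    (forall z, D z -> I (e z)) -> N (fun z => e z - e0) sigma ->
    (forall k, N (y k) r) -> 0 <= sigma <= r -> r <= rho ->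
    N (fun z => F l (e z) (fun k => x k + y k z) - \sum_k A l k * y k z)
      (C * (sigma + r ^+ 2))].
Proof.
have [C HC] := choice FA; have [rho Hrho] := choice HC.
have C0 k : 0 < C k by have [] := Hrho k.
exists (1 + \sum_k C k), (\big[Num.min/1]_k rho k); split.
- by rewrite ltr_pwDl// sumr_ge0// => k _; exact: ltW.
- by apply: lt_bigmin => // k _; have [] := Hrho k.
move=> l T D N NN e y sigma r eI Ne Ny sr rr.
have [_ _ H] := Hrho l.
have rl : r <= rho l by apply: le_trans rr (bigmin_le _ _ _).
have NF := H T D N NN e y sigma r eI Ne Ny sr rl.
apply: (norm_le NN); last by apply: (norm_ext NN) NF => z _; rewrite subr0.
apply: ler_wpM2r; first by case/andP: sr => s0 _; rewrite addr_ge0// sqr_ge0.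
rewrite (bigD1 l)//= addrCA lerDl addr_ge0// sumr_ge0// => k _; exact: ltW.
Qed.

(** In the difference [y - A^-1 (F e (x + y) - tau)] the linear terms in [y]
    cancel, so that a Newton step maps small balls into much smaller ones, in
    every normed algebra of functions. *)
Definition newton_shrinks (r kappa : R) :=
  forall (T : Type) (D : set T) (N : (T -> R) -> R -> Prop), function_norm D N ->
  forall (e : T -> R) (tau y : 'I_n -> T -> R),
    (forall z, D z -> I (e z)) -> N (fun z => e z - e0) (kappa * r) ->
    (forall k, N (tau k) (kappa * r)) -> (forall k, N (y k) r) ->
    forall k, N (fun z => newton (e z) (tau^~ z) (y^~ z) k) (r / 8).

Lemma newton_ball : exists r0 kappa : R, [/\ 0 < r0, 0 < kappa <= 1 &
  forall r, 0 < r <= r0 -> newton_shrinks r kappa].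
Proof.
have [C [rho [C0 rho0 H]]] := uniform_expansion.
pose L : R := \sum_k \sum_l `|invmx A k l|.
have L0 : 0 <= L by apply: sumr_ge0 => k _; exact: sumr_ge0.
pose K := (L + 1) * (C + 1).
have K1 : 1 <= K by rewrite /K; nra.
have K0 : 0 < 16 * K by lra.
exists (Num.min rho (16 * K)^-1), (16 * K)^-1; split.
- by rewrite lt_min rho0 invr_gt0.
- by rewrite invr_gt0 K0/= invf_le1//; lra.
move=> r /andP[r0]; rewrite le_min => /andP[rrho rK] T D N NN e tau y eI Ne Nt Ny k.
set kappa := (16 * K)^-1 in Ne Nt rK *.
have kap1 : kappa <= 1 by rewrite invf_le1//; lra.
have kap0 : 0 < kappa by rewrite invr_gt0.
have kr : 0 <= kappa * r <= r.
  by rewrite mulr_ge0 ?(ltW kap0) ?(ltW r0)//= ler_piMl// ltW.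
have Nl l := norm_cstM NN (invmx A k l)
  (norm_sub NN (H l T D N NN e y _ _ eI Ne Ny kr rrho) (Nt l)).
apply: (norm_le NN); last first.
  apply: (norm_ext NN) (norm_opp NN (norm_sum NN (index_enum 'I_n) Nl)) => z _ /=.
  have yE : y k z = \sum_l invmx A k l * (\sum_j A l j * y j z).
    have : (invmx A *m A) *m (\col_j y j z) = \col_j y j z.
      by rewrite mulVmx// mul1mx.
    rewrite -mulmxA => /matrixP /(_ k 0); rewrite !mxE => <-.
    apply: eq_bigr => l _; congr (_ * _); rewrite mxE.
    by apply: eq_bigr => j _; rewrite mxE.
  rewrite /newton {1}yE -sumrB -sumrN; apply: eq_bigr => l _.
  by ring.
rewrite -mulr_suml.
have s1 : \sum_l `|invmx A k l| <= L + 1.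
  apply: le_trans (_ : L <= _); last by rewrite lerDl.
  by rewrite /L [leRHS](bigD1 k)//= lerDl sumr_ge0// => l _; exact: sumr_ge0.
have k2 : kappa * r + r ^+ 2 <= r * (kappa * 2).
  by rewrite expr2; have := ler_wpM2l (ltW r0) rK; lra.
have s2 : C * (kappa * r + r ^+ 2) + kappa * r <= (C + 1) * (r * (kappa * 2)).
  rewrite mulrDl mul1r; apply: lerD; first by rewrite ler_wpM2l// ltW.
  by have := mulr_gt0 kap0 r0; lra.
apply: le_trans (ler_pM _ _ s1 s2) _.
- exact: sumr_ge0.
- by case/andP: kr => kr _; rewrite addr_ge0// mulr_ge0 ?(ltW C0)// addr_ge0 ?sqr_ge0.
rewrite le_eqVlt; apply/orP; left; apply/eqP.
have KK : K * kappa = 16^-1 by rewrite /kappa; field; lra.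
have -> : (L + 1) * ((C + 1) * (r * (kappa * 2))) = (K * kappa) * (2 * r).
  by rewrite /K; ring.
by rewrite KK; field.
Qed.

Section solution.
Variables (r kappa : R).
Hypotheses (r_gt0 : 0 < r) (kappa_gt0 : 0 < kappa).
Hypothesis shrinks : newton_shrinks r kappa.

(** Shrinking in the algebra of functions on two points, where the weight is
    chosen to make a distance [d] count as much as the radius. *)
Lemma newton_contracts e tau tau' y y' d : I e -> `|e - e0| <= kappa * r ->
  (forall k, `|tau k| <= kappa * r / 2) -> (forall k, `|tau' k| <= kappa * r / 2) ->
  (forall k, `|y k| <= r / 2) -> (forall k, `|y' k| <= r / 2) -> 0 < d ->
  (forall k, `|y k - y' k| <= d) -> (forall k, `|tau k - tau' k| <= kappa * d) ->
  forall k, `|newton e tau y k - newton e tau' y' k| <= d / 4.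
Proof.
move=> Ie er tr tr' yr yr' d0 yd td k.
pose K := r / (2 * d).
have K0 : 0 < K by rewrite divr_gt0// mulr_gt0.
have KE : K * d = r / 2 by rewrite /K; field; rewrite gt_eqF.
have NN := lipschitz_normP (ltW K0).
have Ne : lipschitz_norm K (fun=> e - e0) (kappa * r).
  by move=> b; rewrite subrr normr0 mulr0 addr0.
have Nt j : lipschitz_norm K (fun b => if b then tau j else tau' j) (kappa * r).
  move=> b; have : K * `|tau j - tau' j| <= kappa * r / 2.
    by have := ler_wpM2l (ltW K0) (td j); rewrite mulrCA KE; lra.
  by case: b => /=; [have := tr j|have := tr' j]; lra.
have Ny j : lipschitz_norm K (fun b => if b then y j else y' j) r.
  move=> b; have : K * `|y j - y' j| <= r / 2.
    by have := ler_wpM2l (ltW K0) (yd j); rewrite KE; lra.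
  by case: b => /=; [have := yr j|have := yr' j]; lra.
have := shrinks NN (fun _ _ => Ie) Ne Nt Ny k => /(_ true) /= h.
rewrite -(ler_pM2l K0); have : K * (d / 4) = r / 8 by rewrite mulrA KE; field.
by move=> ->; apply: le_trans h; rewrite lerDr.
Qed.

Definition solves e tau y := forall k, F k e (fun j => x j + y j) = tau k.

(** Solutions in the ball are Lipschitz functions of the right-hand side, in
    particular they are unique. *)
Lemma solution_lipschitz e tau tau' y y' d : I e -> `|e - e0| <= kappa * r ->
  (forall k, `|tau k| <= kappa * r / 2) -> (forall k, `|tau' k| <= kappa * r / 2) ->
  (forall k, `|y k| <= r / 2) -> (forall k, `|y' k| <= r / 2) ->
  solves e tau y -> solves e tau' y' ->
  (forall k, `|tau k - tau' k| <= d) -> forall k, `|y k - y' k| <= d / kappa.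
Proof.
move=> Ie er tr tr' yr yr' sy sy' td k.
pose D : R := \big[Num.max/0]_j `|y j - y' j|.
have yD j : `|y j - y' j| <= D by exact: le_bigmax.
apply: le_trans (yD k) _; rewrite leNgt; apply/negP => dD.
have d0 : 0 <= d by exact: le_trans (td k).
have D0 : 0 < D by apply: le_lt_trans dD; rewrite divr_ge0// ltW.
have tD j : `|tau j - tau' j| <= kappa * D.
  by apply: le_trans (td j) _; rewrite mulrC -ler_pdivrMr// ltW.
have ny := (newton_fixed e tau y).2 sy; have ny' := (newton_fixed e tau' y').2 sy'.
have : D <= D / 4.
  apply: bigmax_le => [|j _]; first by rewrite divr_ge0// ltW.
  have := newton_contracts Ie er tr tr' yr yr' D0 yD tD j.
  by rewrite ny ny'.
by lra.
Qed.

(** The iterates from 0 converge geometrically and keep their bound in the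
    algebra [poly_norm], which is closed under limits: the solution depends
    analytically on the parameter. *)
Lemma solution_exists tau : (forall k, `|tau k| <= kappa * r / 2) ->
  let D := [set s : R | `|s| <= 1 /\ I (e0 + kappa * r * s)] in
  exists Y : R -> 'I_n -> R,
    [/\ forall s, D s -> solves (e0 + kappa * r * s) tau (Y s),
        forall s k, D s -> `|Y s k| <= r / 8 &
        forall k, poly_norm D (Y^~ k) (r / 8)].
Proof.
move=> tr D.
have kr0 : 0 < kappa * r by exact: mulr_gt0.
have D1 : D `<=` [set s | `|s| <= 1] by move=> s [].
have PN := poly_normP D1.
pose it j s := iter j (newton (e0 + kappa * r * s) tau) (fun=> 0).
have Ne : poly_norm D (fun s => e0 + kappa * r * s - e0) (kappa * r).
  have := norm_cstM PN (kappa * r) (@poly_norm_id R D).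
  rewrite gtr0_norm// mulr1; apply: (norm_ext PN) => s _; ring.
have Nt k : poly_norm D (fun=> tau k) (kappa * r).
  apply: (norm_le PN) (norm_cst PN (tau k)).
  by apply: le_trans (tr k) _; lra.
have itN j k : poly_norm D (fun s => it j s k) (r / 8).
  elim: j k => [|j IHj] k.
    apply: (norm_le PN) (norm_cst PN 0); rewrite normr0 divr_ge0// ltW//.
  have := shrinks PN _ Ne Nt (y := fun k s => it j s k) _ k; apply.
    by move=> s [].
  by move=> l; apply: (norm_le PN) (IHj l); move: r_gt0; lra.
have itr j s k : D s -> `|it j s k| <= r / 8.
  by move=> Ds; exact: (norm_bound PN (itN j k) Ds).
have itr2 j s k : D s -> `|it j s k| <= r / 2.
  by move=> Ds; apply: le_trans (itr j s k Ds) _; move: r_gt0; lra.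
have er s : D s -> `|e0 + kappa * r * s - e0| <= kappa * r.
  by move=> Ds; exact: (norm_bound PN Ne Ds).
have itc j s k : D s -> `|it j.+1 s k - it j s k| <= r / 4 ^+ j.
  move=> Ds; elim: j k => [|j IHj] k.
    by rewrite expr0 divr1 subr0 (le_trans (itr _ _ _ Ds))//; move: r_gt0; lra.
  have d0 : 0 < r / 4 ^+ j by rewrite divr_gt0// exprn_gt0.
  have -> : r / 4 ^+ j.+1 = r / 4 ^+ j / 4 by rewrite exprSr invfM mulrA.
  apply: (newton_contracts (proj2 Ds) (er s Ds) tr tr _ _ d0 IHj) => l.
  - exact: itr2.
  - exact: itr2.
  - by rewrite subrr normr0 mulr_ge0 ?ltW.
have itcvg s k : D s -> cvgn (fun j => it j s k).
  move=> Ds.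
  have -> : (fun j => it j s k) = series (fun j => it j.+1 s k - it j s k).
    by apply/funext => j; rewrite seriesEnat/= telescope_sumr// subr0.
  apply: normed_cvg; apply: (@series_le_cvg _ _ (fun j => r / 4 ^+ j)).
  - by move=> j; exact: normr_ge0.
  - by move=> j; rewrite divr_ge0 ?(ltW r_gt0)// exprn_ge0.
  - by move=> j; exact: itc.
  have -> : (fun j => r / 4 ^+ j) = geometric r 4^-1.
    by apply/funext => j; rewrite /geometric/= exprVn.
  by apply: is_cvg_geometric_series; rewrite ger0_norm//; lra.
pose Y s k := limn (fun j => it j s k).
have YN k : poly_norm D (Y^~ k) (r / 8).
  by apply: (norm_lim PN (f := fun j s => it j s k)) => // s Ds; exact: itcvg.
have Yr s k : D s -> `|Y s k| <= r / 8.
  by move=> Ds; exact: (norm_bound PN (YN k) Ds).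
exists Y; split=> // s Ds; apply/newton_fixed => k.
apply/eqP; rewrite -subr_eq0 -normr_le0; apply/ler_addgt0Pr => d d0; rewrite add0r.
have : \forall j \near \oo, forall l, l \in index_enum 'I_n ->
    `|Y s l - it j s l| <= d / 2.
  apply: near_seq => l _.
  by apply: (cvgr_dist_le _ _ (itcvg s l Ds)); rewrite divr_gt0.
move=> [j0 _ /= H].
have H0 := H _ (leqnn j0); have H1 := H _ (leqnSn j0).
have d2 : 0 < d / 2 by rewrite divr_gt0.
have nc : `|newton (e0 + kappa * r * s) tau (Y s) k - it j0.+1 s k| <= d / 2 / 4.
  apply: (newton_contracts (proj2 Ds) (er s Ds) tr tr _ _ d2) => l.
  - by apply: le_trans (Yr s l Ds) _; move: r_gt0; lra.
  - exact: itr2.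
  - by apply: H0; exact: mem_index_enum.
  - by rewrite subrr normr0 mulr_ge0 ?ltW.
have -> : newton (e0 + kappa * r * s) tau (Y s) k - Y s k =
  (newton (e0 + kappa * r * s) tau (Y s) k - it j0.+1 s k) -
  (Y s k - it j0.+1 s k) by ring.
apply: le_trans (ler_normB _ _) _.
by have := H1 k (mem_index_enum _); lra.
Qed.

End solution.
End inverse_function.

(** * Continuation of periodic orbits *)

Section max_principle.
Variables (R : realType) (n : nat).
Implicit Types (p v : 'I_n.+1 -> R).

Variables (bp bm kap : 'I_n.+1 -> R).
Hypotheses (bp_gt0 : forall k, 0 < bp k) (bm_gt0 : forall k, 0 < bm k).

(** The linearization of the billiard equation along a periodic orbit. *)
Definition jacobi v k :=
  bp k * v (ordS k) + bm k * v (ord_pred k) + kap k * v k = 0.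

(** A zero of a nonnegative solution spreads to the next index, and from there
    around the whole cycle. *)
Lemma jacobi_positive p : (forall k, 0 <= p k) -> \sum_k p k = 1 ->
  (forall k, jacobi p k) -> forall k, 0 < p k.
Proof.
move=> p0 p1 pj k; rewrite lt_neqAle p0 andbT eq_sym; apply/eqP => pk.
have zero i : p (iter i (@ordS n.+1) k) = 0.
  elim: i => //= i; set l := iter _ _ _ => pl.
  have := pj l; rewrite /jacobi pl mulr0 addr0 => e.
  have h1 : 0 <= bp l * p (ordS l) by rewrite mulr_ge0// ltW.
  have h2 : 0 <= bm l * p (ord_pred l) by rewrite mulr_ge0// ltW.
  have /eqP : bp l * p (ordS l) = 0 by lra.
  by rewrite mulf_eq0 gt_eqF//= => /eqP.
have itE i : val (iter i (@ordS n.+1) k) = ((k + i) %% n.+1)%N.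
  elim: i => [|i IHi]; first by rewrite addn0 modn_small.
  by rewrite /= IHi addnS -addn1 modnDml addn1.
have : \sum_j p j = 0.
  apply: big1 => j _; rewrite -(zero (j + n.+1 - k)%N); congr p.
  apply: val_inj; rewrite itE subnKC; first by rewrite modnDr modn_small.
  by rewrite (leq_trans (ltnW (ltn_ord k)))// leq_addl.
by rewrite p1; apply/eqP; rewrite oner_eq0.
Qed.

(** The quotient of a solution by a positive solution has no positive maximum
    away from the index where the solution vanishes. *)
Lemma jacobi_max p v : (forall k, 0 < p k) -> (forall k, jacobi p k) ->
  v ord0 = 0 -> (forall k, k != ord0 -> jacobi v k) -> forall k, v k <= 0.
Proof.
move=> p0 pj v0 vj.
have [k0 k0max] : exists k0, forall j, v j / p j <= v k0 / p k0.
  case: (@Order.TotalTheory.arg_maxP _ _ _ ord0 xpredT (fun j => v j / p j) isT).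
  by move=> k0 _ H; exists k0 => j; exact: H.
set Q := v k0 / p k0 in k0max.
have vQ j : v j <= Q * p j by rewrite -ler_pdivrMr.
suff Q0 : Q <= 0.
  by move=> k; apply: le_trans (vQ k) _; rewrite mulr_le0_ge0// ltW.
rewrite leNgt; apply/negP => Q0.
(* A positive maximum spreads to the previous index, down to index 0. *)
have no i (k : 'I_n.+1) : val k = i -> v k = Q * p k -> False.
  elim: i k => [|i IHi] k ki vk.
    have k00 : k = ord0 by exact: val_inj.
    have := mulr_gt0 Q0 (p0 k); rewrite -vk k00 v0 ltxx//.
  have kn0 : k != ord0 by apply/eqP => k00; rewrite k00 in ki.
  have := vj k kn0; have := pj k; rewrite /jacobi vk => e1 e2.
  apply: (IHi (ord_pred k)).
    rewrite /= ki addSn/= modnDr modn_small//.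
    by have := ltn_ord k; rewrite ki => /ltnW.
  have h1 : 0 <= bp k * (Q * p (ordS k) - v (ordS k)).
    by rewrite mulr_ge0 ?subr_ge0// ltW.
  have h2 : 0 <= bm k * (Q * p (ord_pred k) - v (ord_pred k)).
    by rewrite mulr_ge0 ?subr_ge0// ltW.
  have e3 : Q * (bp k * p (ordS k) + bm k * p (ord_pred k) + kap k * p k) = 0.
    by rewrite e1 mulr0.
  have /eqP : bm k * (Q * p (ord_pred k) - v (ord_pred k)) = 0.
    move: h1 h2 e3 e2; rewrite !mulrDr !mulrN; move: (bp k * v (ordS k)) => X.
    move: (bm k * v (ord_pred k)) => Y.
    rewrite !(mulrCA (bp k) Q) !(mulrCA (bm k) Q) !(mulrCA (kap k) Q).
    by move: (Q * _) (Q * _) (Q * _) => a b d; lra.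
  by rewrite mulf_eq0 gt_eqF//= subr_eq0 => /eqP.
apply: (no _ k0 erefl); rewrite /Q mulfVK// gt_eqF//.
Qed.

Lemma jacobi_trivial p v : (forall k, 0 < p k) -> (forall k, jacobi p k) ->
  v ord0 = 0 -> (forall k, k != ord0 -> jacobi v k) -> forall k, v k = 0.
Proof.
move=> p0 pj v0 vj k; apply/le_anti/andP; split.
  exact: (jacobi_max p0 pj v0 vj).
rewrite -oppr_le0; apply: (@jacobi_max p (fun k => - v k)) => //.
  by rewrite v0 oppr0.
by move=> j /vj; rewrite /jacobi !mulrN -!opprD => ->; rewrite oppr0.
Qed.

End max_principle.

Section periodic_orbit.
Variables (R : realType) (m : int) (N : nat).
Local Notation n := N.+1.

(** A periodic orbit, as the sequence of lifts of its parameters. *)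
Definition periodic_orbit (c : R -> R * R) (Z : nat -> R) :=
  (forall k, Z (k + n)%N = Z k + m%:~R) /\
  forall k, height c (Z k.+1) (Z k.+2) = height c (Z k.+1) (Z k).

(** Heights do not see integer translations, so the billiard equations of a
    periodic orbit are cyclic and do not involve [m]. *)
Definition residual (c : R -> R * R) (z : 'I_n -> R) (k : 'I_n) : R :=
  height c (z k) (z (ordS k)) - height c (z k) (z (ord_pred k)).

Variable c : R -> R * R.
Hypothesis Oc : oval c.

Lemma lift_mod (Z : nat -> R) i : (forall k, Z (k + n)%N = Z k + m%:~R) ->
  Z i = Z (i %% n)%N + ((i %/ n)%:Z * m)%:~R.
Proof.
move=> Zn; rewrite {1}(divn_eq i n) addnC; elim: (i %/ n)%N => [|q IHq].
  by rewrite mul0n addn0 mul0r addr0.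
by rewrite mulSn addnCA addnC Zn IHq -addrA -intrD intS mulrDl mul1r [m + _]addrC.
Qed.

Lemma lift_height (Z : nat -> R) i j : (forall k, Z (k + n)%N = Z k + m%:~R) ->
  height c (Z i) (Z j) = height c (Z (i %% n)%N) (Z (j %% n)%N).
Proof.
move=> Zn; rewrite (lift_mod i Zn) (lift_mod j Zn).
by rewrite (heightzD Oc) (heightDz Oc).
Qed.

Lemma lift_tangents (Z : nat -> R) i j : (forall k, Z (k + n)%N = Z k + m%:~R) ->
  tangents c (Z i) (Z j) = tangents c (Z (i %% n)%N) (Z (j %% n)%N).
Proof.
move=> Zn; rewrite (lift_mod i Zn) (lift_mod j Zn).
by rewrite (tangentszD Oc) (tangentsDz Oc).
Qed.

Lemma orbit_residual Z k : periodic_orbit c Z -> residual c (fun j => Z j) k = 0.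
Proof.
move=> [Zn Zb]; apply/eqP; rewrite subr_eq0; apply/eqP => /=.
have := Zb (k + N)%N; rewrite -addnS.
rewrite (lift_height (k + n) (k + n).+1 Zn) (lift_height (k + n) (k + N) Zn).
by rewrite -addSn !modnDr (modn_small (ltn_ord k)) addnS.
Qed.

(** The orbit is cut at multiples of [n], and [m] turns are added at
    each cut. *)
Definition lift (z : 'I_n -> R) (i : nat) : R :=
  z (inord (i %% n)) + ((i %/ n)%:Z * m)%:~R.

Lemma lift_ord z (k : 'I_n) : lift z k = z k.
Proof.
by rewrite /lift modn_small// divn_small// mul0r addr0 inord_val.
Qed.

Lemma residual_orbit z : (forall k, residual c z k = 0) ->
  periodic_orbit c (lift z).
Proof.
move=> z0; have Zn k : lift z (k + n)%N = lift z k + m%:~R.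
  rewrite /lift modnDr divnDr ?dvdnn// divnn /= -addrA; congr (_ + _).
  by rewrite -intrD addn1 intS mulrDl mul1r [m + _]addrC.
split=> // k; rewrite (lift_height k.+1 k.+2 Zn) (lift_height k.+1 k Zn).
have ltn i : (i %% n < n)%N by rewrite ltn_pmod.
rewrite -[(k.+1 %% n)%N]/(val (Ordinal (ltn k.+1))).
set l := Ordinal (ltn k.+1).
have -> : (k.+2 %% n)%N = val (ordS l) by rewrite /= -[(k.+1 %% n).+1]addn1 modnDml addn1.
have -> : (k %% n)%N = val (ord_pred l).
  by rewrite /= addnS/= modnDml addSnnS modnDr.
by rewrite !lift_ord; apply/eqP; rewrite -subr_eq0; apply/eqP; exact: (z0 l).
Qed.

Lemma circle_orbit g t : periodic_circle_map c m n g ->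
  periodic_orbit c (fun k => iter k g t).
Proof.
move=> gc; split=> k; last exact: (circle_billiard gc).
rewrite iterD (circle_iter gc).
by elim: k => //= k ->; rewrite (circle_degreez gc).
Qed.

End periodic_orbit.

Section continuity.
Variable R : realType.

Lemma mono_surj_continuous (g : R -> R) : {mono g : x y / x <= y} ->
  (forall y, exists x, g x = y) -> continuous g.
Proof.
move=> mono surj t; apply/cvgrPdist_lt => /= eps eps0.
have [a ga] := surj (g t - eps); have [b gb] := surj (g t + eps).
have ltm := leW_mono mono.
have ta : a < t by rewrite -ltm ga; lra.
have tb : t < b by rewrite -ltm gb; lra.
have na : \forall x \near t, a < x by exact: lt_nbhsr.
have nb : \forall x \near t, x < b by exact: lt_nbhsl.
apply: filterS2 na nb => x; rewrite -(ltm a) -(ltm x) ga gb => h1 h2.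
by rewrite ltr_norml; lra.
Qed.

Lemma cvg_sumr (T : Type) (F : set_system T) (FF : Filter F) (J : Type)
    (s : seq J) (f : J -> T -> R) (l : J -> R) :
  (forall j, f j z @[z --> F] --> l j) ->
  \sum_(j <- s) f j z @[z --> F] --> \sum_(j <- s) l j.
Proof.
move=> fl; elim: s => [|j s IHs].
  by under eq_fun do rewrite big_nil; rewrite big_nil; exact: cvg_cst.
under eq_fun do rewrite big_cons; rewrite big_cons.
by apply: cvgD; [exact: fl|exact: IHs].
Qed.

Lemma iter_continuous (g : R -> R) k : continuous g -> continuous (iter k g).
Proof.
move=> cg; elim: k => [|k IHk] x; first exact: cvg_id.
by apply: (@continuous_comp _ _ _ (iter k g) g); [exact: IHk|exact: cg].
Qed.

End continuity.

Section local.
Variables (R : realType) (I : set R) (gamma : R -> R -> R * R).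
Hypothesis A : analytic_ovals I gamma.
Variables (e0 : R) (m : int) (N : nat) (g0 : R -> R).
Local Notation n := N.+1.
Hypotheses (Ie0 : I e0) (gc : periodic_circle_map (gamma e0) m n g0).
Hypothesis mono : {mono g0 : x y / x <= y}.

Let O0 : oval (gamma e0) := family_oval A Ie0.

Lemma base_continuous : continuous g0.
Proof.
apply: mono_surj_continuous => // y; exists (iter N g0 (y - m%:~R)).
by rewrite -iterS (circle_iter gc) subrK.
Qed.

Variable t0 : R.
Let x (k : 'I_n) : R := iter k g0 t0.

Let bp k := tangents (gamma e0) (x k) (x (ordS k)).
Let bm k := tangents (gamma e0) (x (ord_pred k)) (x k).

Let orb0 t : periodic_orbit m N (gamma e0) (fun k => iter k g0 t).
Proof. exact: circle_orbit. Qed.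

Let bp_gt0 k : 0 < bp k.
Proof.
rewrite /bp /x /=; have [Zn _] := orb0 t0.
have := lift_tangents O0 k k.+1 Zn; rewrite modn_small// => <-.
by rewrite iterS; case: (circle_phase gc (iter k g0 t0)).
Qed.

Let bm_gt0 k : 0 < bm k.
Proof.
rewrite /bm /x /=; have [Zn _] := orb0 t0.
have := lift_tangents O0 (k + N) (k + n) Zn.
rewrite modnDr (modn_small (ltn_ord k)) addnS/= => <-.
by case: (circle_phase gc (iter (k + N) g0 t0)).
Qed.

(* [kap] carries the acceleration of the curve at [x k]. *)
Let height_expansion k l : exists kap : R,
  expansion I e0 x (fun e z => height (gamma e) (z k) (z l))
    (height (gamma e0) (x k) (x l))
    (fun j => (if j == l then tangents (gamma e0) (x k) (x l) else 0) +
              (if j == k then kap else 0)).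
Proof.
have E1 := expansion_coord (x := x) (k := k) Ie0 (family_dan1 A (x k) Ie0).
have E2 := expansion_coord (x := x) (k := l) Ie0 (family_an2 A (x l) Ie0).
have E3 := expansion_coord (x := x) (k := k) Ie0 (family_dan2 A (x k) Ie0).
have E4 := expansion_coord (x := x) (k := l) Ie0 (family_an1 A (x l) Ie0).
have := expansionB (expansionM E1 E2) (expansionM E3 E4).
have D1 : derive1 (fun t => (gamma e0 t).1) (x l) = (derive1 (gamma e0) (x l)).1.
  by have D := oval_der1 O0 (x l); rewrite derive1E derive_val.
have D2 : derive1 (fun t => (gamma e0 t).2) (x l) = (derive1 (gamma e0) (x l)).2.
  by have D := oval_der2 O0 (x l); rewrite derive1E derive_val.
rewrite D1 D2.
set k1 := derive1 (fun t => (derive1 (gamma e0) t).1) (x k).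
set k2 := derive1 (fun t => (derive1 (gamma e0) t).2) (x k).
move=> E; exists ((gamma e0 (x l)).2 * k1 - (gamma e0 (x l)).1 * k2).
rewrite height.unlock tangents.unlock /omega; move: E; congr expansion.
apply/funext => j; case: ifP => _; case: ifP => _; rewrite ?mulr0 ?addr0 ?add0r ?subr0 ?oppr0//.
by rewrite opprD addrACA.
Qed.

Let residual_expansion k : exists kap : R,
  expansion I e0 x (fun e z => residual (gamma e) z k) 0
    (fun j => (if j == ordS k then bp k else 0) +
      (if j == ord_pred k then bm k else 0) + (if j == k then kap else 0)).
Proof.
have [k1 E1] := height_expansion k (ordS k).
have [k2 E2] := height_expansion k (ord_pred k).
exists (k1 - k2); have := expansionB E1 E2.
have -> : height (gamma e0) (x k) (x (ordS k)) -
    height (gamma e0) (x k) (x (ord_pred k)) = 0 by exact: (orbit_residual O0 k (orb0 t0)).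
congr expansion; apply/funext => j; rewrite /bm [in RHS]tangentsC /bp.
by case: ifP => _; case: ifP => _; case: ifP => _; ring.
Qed.

Let kap := projT1 (choice residual_expansion).

Let coef k j := (if j == ordS k then bp k else 0) +
  (if j == ord_pred k then bm k else 0) + (if j == k then kap k else 0).

Let coef_expansion k :
  expansion I e0 x (fun e z => residual (gamma e) z k) 0 (coef k).
Proof. exact: (projT2 (choice residual_expansion)). Qed.

Let sum_coef k w : \sum_j coef k j * w j =
  bp k * w (ordS k) + bm k * w (ord_pred k) + kap k * w k.
Proof.
have pick l (a : R) : \sum_j (if j == l then a else 0) * w j = a * w l.
  rewrite (bigD1 l)//= eqxx big1 ?addr0// => j /negbTE->.
  by rewrite mul0r.
under eq_bigr do rewrite !mulrDl.
by rewrite !big_split/= !pick.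
Qed.

(* The derivative of the family of orbits with respect to the starting point,
   or rather a limit of normalized difference quotients. *)
Let positive_field : exists p : 'I_n -> R,
  (forall k, 0 < p k) /\ (forall k, jacobi bp bm kap p k).
Proof.
pose d (k : 'I_n) h : R := iter k g0 (t0 + h) - iter k g0 t0.
have d0 k h : 0 < h -> 0 < d k h.
  move=> h0; rewrite /d subr_gt0.
  have -> : (iter k g0 t0 < iter k g0 (t0 + h)) = (t0 < t0 + h).
    by elim: (val k) => //= i IHi; rewrite (leW_mono mono).
  by rewrite ltrDl.
pose S h : R := \sum_k d k h.
have dS k h : 0 < h -> d k h <= S h.
  by move=> h0; rewrite /S (bigD1 k)//= lerDl sumr_ge0// => j _; exact/ltW/d0.
have S0 h : 0 < h -> 0 < S h by move=> h0; exact: lt_le_trans (d0 ord0 h h0) (dS _ _ h0).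
have [V [VU V0]] := ultraFilterLemma (at_right_proper_filter (0 : R)).
have Vgt0 : \forall h \near V, 0 < h by apply: V0; exact: nbhs_right_gt.
have VS : S h @[h --> V] --> 0.
  suff c : S h @[h --> 0^'+] --> 0.
    by move=> B /c; exact: V0.
  have s0 : \sum_(k < n) (0 : R) = 0 by rewrite big1.
  rewrite -[X in _ --> X]s0.
  apply: cvg_sumr => k; rewrite -[X in _ --> X](subrr (iter k g0 t0)).
  apply: cvgB; last exact: cvg_cst.
  have c : t0 + h @[h --> 0^'+] --> t0 + 0.
    by apply: cvgD; [exact: cvg_cst|apply: cvg_at_right_filter; exact: cvg_id].
  rewrite addr0 in c.
  exact: (cvg_comp _ _ c (@iter_continuous _ _ k base_continuous t0)).
have pl (k : 'I_n) : exists l : R, d k h / S h @[h --> V] --> l.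
  apply: (@ultra_cvg _ _ V _ 0 1); apply: filterS Vgt0 => h h0.
  rewrite divr_ge0 ?(ltW (d0 _ _ h0)) ?(ltW (S0 _ h0))//=.
  by rewrite ler_pdivrMr ?S0// mul1r dS.
have [p pP] := choice pl.
have pj k : jacobi bp bm kap p k.
  have [C [rho [C0 rho0 H]]] := coef_expansion k.
  rewrite /jacobi -sum_coef.
  have c1 : \sum_j coef k j * (d j h / S h) @[h --> V] --> \sum_j coef k j * p j.
    by apply: cvg_sumr => j; apply: cvgMl_tmp; exact: pP.
  have bound : \forall h \near V, `|\sum_j coef k j * (d j h / S h)| <= C * S h.
    have nS : \forall h \near V, S h <= rho by exact: cvgr_le VS _ rho0.
    apply: filterS2 Vgt0 nS => h h0 Sr.
    have := H unit setT _ (sup_norm _ _) (fun=> e0) (fun j _ => d j h) 0 (S h).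
    case=> //.
    - by split=> // _ _; rewrite subrr normr0.
    - move=> j; split=> [|_ _]; first exact/ltW/S0.
      by rewrite ger0_norm ?dS// ltW// d0.
    - by rewrite lexx ltW// S0.
    move=> _ /(_ tt Logic.I); rewrite add0r subr0.
    have -> : residual (gamma e0) (fun j => x j + d j h) k = 0.
      have -> : (fun j => x j + d j h) = (fun j : 'I_n => iter j g0 (t0 + h)).
        by apply/funext => j; rewrite /x /d subrKC.
      exact: (orbit_residual O0 k (orb0 _)).
    rewrite sub0r normrN => h1.
    have -> : \sum_j coef k j * (d j h / S h) = (\sum_j coef k j * d j h) / S h.
      by rewrite mulr_suml; apply: eq_bigr => j _; rewrite mulrA.
    rewrite normrM normfV (gtr0_norm (S0 _ h0)) ler_pdivrMr ?S0//.
    by rewrite -mulrA -expr2.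
  apply/eqP; rewrite -normr_le0.
  have c2 : C * S h @[h --> V] --> C * 0 by exact: cvgMl_tmp.
  rewrite mulr0 in c2.
  exact: ler_cvg_to (cvg_norm c1) c2 bound.
have p0 k : 0 <= p k.
  apply: (cvgr_to_ge (pP k)); apply: filterS Vgt0 => h h0.
  by rewrite divr_ge0 ?(ltW (d0 _ _ h0)) ?(ltW (S0 _ h0)).
have p1 : \sum_k p k = 1.
  have c1 : \sum_k d k h / S h @[h --> V] --> \sum_k p k.
    by apply: cvg_sumr => j; exact: pP.
  have c2 : (fun=> 1 : R) h @[h --> V] --> (1 : R) by exact: cvg_cst.
  apply: (real_cvg_unique _ c1 c2); apply: filterS Vgt0 => h h0.
  by rewrite -mulr_suml divff// gt_eqF// S0.
by exists p; split=> // k; exact: (jacobi_positive bp_gt0 bm_gt0 p0 p1 pj).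
Qed.

(** The system for a periodic orbit starting at a prescribed point: the equation
    at index 0 is replaced by the initial condition. *)
Definition orbit_system (k : 'I_n) e (z : 'I_n -> R) : R :=
  if k == ord0 then z k - x k else residual (gamma e) z k.

Let J : 'M[R]_n :=
  \matrix_(k, j) if k == ord0 then (if j == k then 1 else 0) else coef k j.

Let system_expansion k : expansion I e0 x (orbit_system k) 0 (J k).
Proof.
have -> : J k = if k == ord0 then (fun j => if j == k then 1 else 0) else coef k.
  by apply/funext => j; rewrite mxE; case: ifP.
rewrite /orbit_system; case: ifP => _; last exact: coef_expansion.
exact: expansion_var.
Qed.

(* A kernel vector satisfies the Jacobi equation except at index 0, where it
   vanishes; the orbits of [g0] provide the positive solution for comparison. *)
Let J_unit : J \in unitmx.
Proof.
rewrite unitmxE unitfE -det_tr; apply/negP => /det0P[v v0 vJ].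
move/negP: v0; apply; apply/eqP/rowP => k; rewrite mxE.
have row j : \sum_i J j i * v 0 i = 0.
  have /rowP /(_ j) := vJ; rewrite !mxE => vJj; rewrite -[RHS]vJj.
  by apply: eq_bigr => i _; rewrite [in RHS]mxE mulrC.
have [p [p0 pj]] := positive_field.
apply: (jacobi_trivial bp_gt0 bm_gt0 p0 pj) => [|j j0].
  have := row ord0; rewrite (bigD1 ord0)//= mxE !eqxx mul1r big1 ?addr0// => i i0.
  by rewrite mxE eqxx (negbTE i0) mul0r.
rewrite /jacobi -sum_coef -[RHS](row j); apply: eq_bigr => i _.
by rewrite mxE (negbTE j0).
Qed.

Let orbit_solves e Z : I e -> periodic_orbit m N (gamma e) Z ->
  solves x orbit_system e (fun k => if k == ord0 then Z 0%N - t0 else 0)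
    (fun k => Z k - x k).
Proof.
move=> Ie oZ k.
have -> : (fun j => x j + (Z j - x j)) = (fun j : 'I_n => Z j).
  by apply/funext => j; rewrite subrKC.
rewrite /orbit_system; case: eqP => [->//|_].
exact: (orbit_residual (family_oval A Ie) k oZ).
Qed.

(** A periodic orbit near that of [t0] is determined by its starting point and
    depends on it in a Lipschitz way.  For the existence at every nearby
    parameter, all equations but the one at index 0 are solved, with the starting
    point prescribed; the remaining residual is an analytic function of the
    parameter, and it vanishes wherever there is an actual periodic orbit, so it
    is zero as soon as there are orbits for infinitely many parameters. *)
Lemma local_continuation : exists r0 kappa : R, [/\ 0 < r0, 0 < kappa <= 1 &
  forall r, 0 < r <= r0 ->
  (forall e Z Z', I e -> `|e - e0| <= kappa * r ->
     periodic_orbit m N (gamma e) Z -> periodic_orbit m N (gamma e) Z' ->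
     `|Z 0%N - t0| <= kappa * r / 2 -> `|Z' 0%N - t0| <= kappa * r / 2 ->
     (forall k : 'I_n, `|Z k - iter k g0 t0| <= r / 2) ->
     (forall k : 'I_n, `|Z' k - iter k g0 t0| <= r / 2) ->
     forall k : 'I_n, `|Z k - Z' k| <= `|Z 0%N - Z' 0%N| / kappa) /\
  (forall t, `|t - t0| <= kappa * r / 2 ->
     (forall s : seq R, exists e Z, [/\ I e, e \notin s, `|e - e0| <= kappa * r / 8,
        periodic_orbit m N (gamma e) Z &
        Z 0%N = t /\ forall k : 'I_n, `|Z k - iter k g0 t0| <= r / 2]) ->
     forall e, I e -> `|e - e0| <= kappa * r / 4 ->
     exists Z, [/\ periodic_orbit m N (gamma e) Z, Z 0%N = t &
       forall k : 'I_n, `|Z k - iter k g0 t0| <= r / 8])].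
Proof.
have [r0 [kappa [r00 kap01 shrinks]]] := newton_ball system_expansion J_unit.
have [rho rho0 bound] := expansion_bound (coef_expansion ord0).
have /andP[kap0 kap1] := kap01.
exists (Num.min r0 rho), kappa; split=> //; first by rewrite lt_min r00.
move=> r /andP[r_gt0]; rewrite le_min => /andP[rr0 rrho].
have kr0 : 0 < kappa * r by exact: mulr_gt0.
have shr : newton_shrinks I e0 x orbit_system J r kappa.
  by apply: shrinks; rewrite r_gt0.
have taule t : `|t - t0| <= kappa * r / 2 ->
    forall k : 'I_n, `|if k == ord0 then t - t0 else 0| <= kappa * r / 2.
  by move=> tr k; case: ifP => _ //; rewrite normr0 divr_ge0// ltW.
split.
  move=> e Z Z' Ie er oZ oZ' Z0 Z0' Zr Zr' k.
  have -> : Z k - Z' k = (Z k - x k) - (Z' k - x k) by ring.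
  apply: (solution_lipschitz J_unit r_gt0 kap0 shr Ie er (taule _ Z0) (taule _ Z0')
    Zr Zr' (orbit_solves Ie oZ) (orbit_solves Ie oZ')) => j.
  case: ifP => _; last by rewrite subrr normr0.
  by rewrite opprB addrA subrK.
move=> t tr many e Ie er.
pose tau (k : 'I_n) : R := if k == ord0 then t - t0 else 0.
have [Y [Ys Yr YN]] := solution_exists J_unit r_gt0 kap0 shr (taule _ tr).
set D := [set s | _] in Ys Yr YN.
have D1 : D `<=` [set s | `|s| <= 1] by move=> s [].
have PN := poly_normP D1.
have DP e' (b : R) : I e' -> `|e' - e0| <= kappa * r * b -> b <= 1 ->
    let s := (e' - e0) / (kappa * r) in
    [/\ D s, `|s| <= b & e0 + kappa * r * s = e'].
  move=> Ie' er' b1 s.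
  have es : e0 + kappa * r * s = e' by rewrite /s mulrC mulfVK ?gt_eqF// subrKC.
  have sb : `|s| <= b.
    by rewrite normrM normfV (gtr0_norm kr0) ler_pdivrMr// mulrC.
  by split=> //; split; rewrite /= ?es// (le_trans sb).
have Ne : poly_norm D (fun s => e0 + kappa * r * s - e0) (kappa * r).
  have := norm_cstM PN (kappa * r) (@poly_norm_id R D).
  rewrite gtr0_norm// mulr1; apply: (norm_ext PN) => s _; ring.
have YN' k : poly_norm D (Y^~ k) r.
  by apply: (norm_le PN) (YN k); lra.
have kr : 0 <= kappa * r <= r by rewrite (ltW kr0) ler_piMl// ltW.
have [M GM] := bound R D _ PN _ (fun k s => Y s k) _ _ (fun s Ds => proj2 Ds)
  Ne YN' kr rrho.
have Gz : forall s : seq R, exists z, [/\ D z, z \notin s, `|z| <= 8^-1 &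
    residual (gamma (e0 + kappa * r * z)) (fun k => x k + Y z k) ord0 = 0].
  move=> l; have [e' [Z [Ie' el er' oZ [Z0 Zr]]]] :=
    many [seq e0 + kappa * r * s | s <- l].
  have [|Ds s8 es] := DP e' 8^-1 Ie' er'; first by lra.
  set s := (e' - e0) / (kappa * r) in Ds s8 es.
  exists s; split=> //.
    by apply: contra el => sl; rewrite -es; exact: map_f.
  have Zs := orbit_solves Ie' oZ; rewrite Z0 in Zs.
  have := Ys s Ds; rewrite es => Ys'.
  have er1 : `|e' - e0| <= kappa * r by lra.
  have Yr2 k : `|Y s k| <= r / 2 by apply: le_trans (Yr s k Ds) _; lra.
  have YZ k : Y s k = Z k - x k.
    apply/eqP; rewrite -subr_eq0 -normr_le0.
    have := @solution_lipschitz _ _ _ _ _ _ _ J_unit _ _ r_gt0 kap0 shr e' tau tau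
      (Y s) (fun k => Z k - x k) 0 Ie' er1 (taule _ tr) (taule _ tr) Yr2 Zr Ys' Zs.
    by rewrite mul0r; apply => j; rewrite subrr normr0.
  have -> : (fun k => x k + Y s k) = (fun k : 'I_n => Z k).
    by apply/funext => k; rewrite YZ subrKC.
  exact: (orbit_residual (family_oval A Ie') ord0 oZ).
have [|Ds s4 es] := DP e 4^-1 Ie er; first by lra.
set s := (e - e0) / (kappa * r) in Ds s4 es.
have G0 := poly_norm_identity D1 GM Gz Ds s4.
have := Ys s Ds; rewrite es => Ys'; rewrite es in G0.
exists (lift m (fun k => x k + Y s k)); split.
- apply: (residual_orbit m (family_oval A Ie)) => k; have [->//|k0] := eqVneq k ord0.
  by have := Ys' k; rewrite /orbit_system (negbTE k0).
- rewrite -[0%N]/(val (@ord0 N)) lift_ord.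
  by have := Ys' ord0; rewrite /orbit_system eqxx => /(canRL (subrK _)) ->; rewrite subrK.
- by move=> k; rewrite lift_ord -/(x k) [x k + _]addrC addrK; exact: Yr.
Qed.

End local.

(** * Uniformity over the circle *)

Section uniform.
Variable R : realType.

(** A property of a scale [rho] and a point, inherited by smaller scales and by
    integer translates, holds at one scale everywhere if it holds locally. *)
Lemma uniform_cover (Q : R -> R -> Prop) :
  (forall t0, exists2 rho : R, 0 < rho & forall t, `|t - t0| <= rho -> Q rho t) ->
  (forall (rho rho' t : R), 0 < rho' <= rho -> Q rho t -> Q rho' t) ->
  (forall rho t (k : int), Q rho t -> Q rho (t + k%:~R)) ->
  exists2 rho : R, 0 < rho & forall t, Q rho t.
Proof.
move=> loc anti trans.
have /compact_near_coveringP cov := @segment_compact R 0 1.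
have : \forall rho \near (0 : R)^'+, `[0, 1] `<=` Q rho.
  apply: cov => t0 _; have [rho rho0 Qrho] := loc t0.
  exists ([set t | `|t - t0| < rho], [set r | 0 < r < rho]).
    split; first by exists rho => // t /=; rewrite distrC.
    have : \forall r \near (0 : R)^'+, 0 < r < rho.
      near=> r; apply/andP; split; near: r; first exact: nbhs_right_gt.
      exact: nbhs_right_lt.
    by [].
  move=> [t r] /= [/ltW tt0 /andP[r0 /ltW rr]].
  by apply: (anti rho); [rewrite r0|exact: Qrho].
move=> [rho /= rho0 H]; exists (rho / 2); first by rewrite divr_gt0.
move=> t; rewrite -(subrK (Num.floor t)%:~R t); apply: trans.
apply: H => /=; last 2 first.
- by rewrite divr_gt0.
- rewrite in_itv/= subr_ge0 Num.Theory.floor_le/=.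
  by have := Num.Theory.lt_succ_floor t; rewrite intrD; lra.
by rewrite sub0r normrN gtr0_norm ?divr_gt0//; lra.
Unshelve. all: by end_near. Qed.

(** Lipschitz at small distances is what the continuation provides; boundedness
    makes it global and stable under products. *)
Definition bounded_lipschitz (f : R -> R) := exists L rho : R, [/\ 0 < rho,
  forall t, `|f t| <= L & forall t u, `|t - u| <= rho -> `|f t - f u| <= L * `|t - u|].

Lemma bounded_lipschitzP f : bounded_lipschitz f -> lipschitz f.
Proof.
move=> [L [rho [rho0 fL fl]]]; apply/lipschitzP; exists (L + 2 * L / rho) => t u.
have L0 : 0 <= L by exact: le_trans (fL 0).
have [tu|tu] := leP `|t - u| rho.
  by rewrite mulrDl (le_trans (fl _ _ tu))// lerDl mulr_ge0// divr_ge0 ?mulr_ge0// ltW.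
apply: (@le_trans _ _ (2 * L / rho * `|t - u|)); last first.
  by rewrite ler_wpM2r// lerDr.
apply: (@le_trans _ _ (2 * L)).
  by apply: le_trans (ler_normB _ _) _; have := fL t; have := fL u; lra.
by rewrite mulrAC ler_pdivlMr// ler_wpM2l ?mulr_ge0// ltW.
Qed.

Lemma bounded_lipschitzM f g : bounded_lipschitz f -> bounded_lipschitz g ->
  bounded_lipschitz (fun t => f t * g t).
Proof.
move=> [L [rho [rho0 fL fl]]] [M [sig [sig0 gM gm]]].
have L0 : 0 <= L by exact: le_trans (fL 0).
have M0 : 0 <= M by exact: le_trans (gM 0).
exists (2 * (L * M)), (Num.min rho sig); split=> [|t|t u].
- by rewrite lt_min rho0.
- have := ler_pM (normr_ge0 _) (normr_ge0 _) (fL t) (gM t).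
  by rewrite normrM; have := mulr_ge0 L0 M0; lra.
rewrite le_min => /andP[tr ts].
have -> : f t * g t - f u * g u = f t * (g t - g u) + (f t - f u) * g u by ring.
apply: le_trans (ler_normD _ _) _; rewrite !normrM.
have := ler_pM (normr_ge0 _) (normr_ge0 _) (fL t) (gm _ _ ts).
have := ler_pM (normr_ge0 _) (normr_ge0 _) (fl _ _ tr) (gM u).
by lra.
Qed.

Lemma bounded_lipschitzB f g : bounded_lipschitz f -> bounded_lipschitz g ->
  bounded_lipschitz (fun t => f t - g t).
Proof.
move=> [L [rho [rho0 fL fl]]] [M [sig [sig0 gM gm]]].
exists (L + M), (Num.min rho sig); split=> [|t|t u].
- by rewrite lt_min rho0.
- by apply: le_trans (ler_normB _ _) _; exact: lerD.
rewrite le_min => /andP[tr ts].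
have -> : f t - g t - (f u - g u) = (f t - f u) - (g t - g u) by ring.
apply: le_trans (ler_normB _ _) _; rewrite mulrDl.
by apply: lerD; [exact: fl|exact: gm].
Qed.

Lemma bounded_lipschitz_comp f g (L rho : R) : bounded_lipschitz f -> 0 < rho ->
  (forall t u, `|t - u| <= rho -> `|g t - g u| <= L * `|t - u|) ->
  bounded_lipschitz (fun t => f (g t)).
Proof.
move=> [M [sig [sig0 fM fm]]] rho0 gl.
have M0 : 0 <= M by exact: le_trans (fM 0).
have L1 : 0 < `|L| + 1 by rewrite ltr_wpDl.
exists (M * (`|L| + 1)), (Num.min rho (sig / (`|L| + 1))); split=> [|t|t u].
- by rewrite lt_min rho0 divr_gt0.
- by apply: le_trans (fM _) _; rewrite mulrDr mulr1 lerDr mulr_ge0.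
rewrite le_min ler_pdivlMr// => /andP[tr ts].
have gtu : `|g t - g u| <= (`|L| + 1) * `|t - u|.
  apply: le_trans (gl _ _ tr) _; apply: ler_wpM2r => //.
  by rewrite (le_trans (ler_norm _))// lerDl.
apply: le_trans (fm _ _ _) _; first by apply: le_trans gtu _; rewrite mulrC.
by rewrite -mulrA ler_wpM2l.
Qed.

(** Locally, this is the first order expansion in the algebra of functions on two
    points. *)
Lemma analytic_bounded_lipschitz (I : set R) (f : R -> R -> R) e : I e ->
  (forall x, analytic_at I f e x) -> (forall x (k : int), f e (x + k%:~R) = f e x) ->
  bounded_lipschitz (f e).
Proof.
move=> Ie fa fper.
pose Q (rho t : R) := `|f e t| <= rho^-1 /\
  forall u, `|t - u| <= rho -> `|f e t - f e u| <= rho^-1 * `|t - u|.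
have [rho rho0 HQ] : exists2 rho : R, 0 < rho & forall t, Q rho t.
  apply: uniform_cover => [t0|rho sig t /andP[sig0 le] [ft fl]|rho t k [ft fl]].
  - have [C [rho [C0 rho0 jet]]] := analytic_at_jet Ie (fa t0).
    set d := derive1 (f e) t0 in jet; pose r := rho / 4.
    have r0 : 0 < r by rewrite divr_gt0.
    have lip t u : `|t - t0| <= r -> `|u - t0| <= r ->
        `|f e t - f e u| <= (`|d| + C * rho ^+ 2 / r) * `|t - u|.
      move=> tr ur; have [->|tu] := eqVneq t u.
        by rewrite !subrr normr0 mulr0.
      have tu0 : 0 < `|t - u| by rewrite normr_gt0 subr_eq0.
      have K0 : 0 < r / `|t - u| by rewrite divr_gt0.
      have Ne : lipschitz_norm (r / `|t - u|) (fun=> e - e) 0.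
        by move=> b; rewrite !subrr normr0 mulr0 addr0.
      have Ny : lipschitz_norm (r / `|t - u|)
          (fun b => (if b then t else u) - t0) rho.
        move=> b; have -> : t - t0 - (u - t0) = t - u by ring.
        rewrite mulfVK ?gt_eqF//.
        by case: b; rewrite /r in tr ur *; lra.
      have s0 : 0 <= (0 : R) <= rho by rewrite lexx ltW.
      have r1 : 0 <= rho <= rho by rewrite lexx ltW.
      have := jet bool setT _ (lipschitz_normP (ltW K0)) _ _ _ _ (fun _ _ => Ie)
        Ne Ny s0 r1 true.
      rewrite !subrKC add0r => h.
      have {}h : r / `|t - u| * `|(f e t - f e t0 - d * (t - t0)) -
          (f e u - f e t0 - d * (u - t0))| <= C * rho ^+ 2.
        by apply: le_trans h; rewrite lerDr.
      rewrite -ler_pdivlMl// invf_div in h.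
      have -> : f e t - f e u = ((f e t - f e t0 - d * (t - t0)) -
          (f e u - f e t0 - d * (u - t0))) + d * (t - u) by ring.
      apply: le_trans (ler_normD _ _) _; rewrite normrM mulrDl addrC lerD2l.
      by apply: le_trans h _; rewrite mulrC mulrA mulrAC.
    set L := `|d| + C * rho ^+ 2 / r in lip.
    have L0 : 0 <= L by rewrite addr_ge0// divr_ge0 ?mulr_ge0 ?sqr_ge0// ltW.
    clearbody L; have Lr0 : 0 <= L * r by rewrite mulr_ge0// ltW.
    pose B : R := `|f e t0| + L * r + L + 1.
    have f00 := normr_ge0 (f e t0).
    have B0 : 0 < B by rewrite /B; lra.
    have LB : L <= B by rewrite /B; lra.
    exists (Num.min (r / 2) B^-1); first by rewrite lt_min divr_gt0//= invr_gt0.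
    set rh := Num.min _ _.
    have rh0 : 0 < rh by rewrite lt_min divr_gt0//= invr_gt0.
    have rhr : rh <= r / 2 by rewrite ge_min lexx.
    have rhB : B <= rh^-1.
      by rewrite -[B]invrK lef_pV2 ?posrE ?invr_gt0// ge_min lexx orbT.
    clearbody rh; move=> t tt0; split.
      apply: le_trans rhB.
      have t0r : `|t0 - t0| <= r by rewrite subrr normr0 ltW.
      have tr : `|t - t0| <= r by lra.
      have := lip t t0 tr t0r.
      have -> : f e t = (f e t - f e t0) + f e t0 by ring.
      have := ler_normD (f e t - f e t0) (f e t0).
      rewrite subrK; have := ler_wpM2l L0 tr; rewrite /B; lra.
    move=> u tu; have ur : `|u - t0| <= r.
      have -> : u - t0 = (t - t0) - (t - u) by ring.
      by apply: le_trans (ler_normB _ _) _; lra.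
    have tr : `|t - t0| <= r by lra.
    apply: le_trans (lip t u tr ur) _; apply: ler_wpM2r => //.
    exact: le_trans rhB.
  - have ss : rho^-1 <= sig^-1 by rewrite lef_pV2 ?posrE// (lt_le_trans sig0).
    split=> [|u tu]; first exact: le_trans ss.
    apply: le_trans (fl u (le_trans tu le)) _; exact: ler_wpM2r.
  - split=> [|u]; first by rewrite fper.
    rewrite fper -[u](subrK k%:~R) fper opprD addrACA subrr addr0.
    exact: fl.
exists rho^-1, rho; split=> // [t|t u]; first by case: (HQ t).
by case: (HQ t) => _; apply.
Qed.

End uniform.

(** * Continuation of invariant curves *)

Section global.
Variables (R : realType) (I : set R) (gamma : R -> R -> R * R).
Hypothesis A : analytic_ovals I gamma.
Variables (U : set_system R) (e0 : R) (m : int) (N : nat) (g : R -> R -> R).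
Local Notation n := N.+1.
Context {UU : UltraFilter U}.
Hypotheses (Ie0 : I e0) (Ue0 : U --> e0) (Une0 : U [set e | e != e0]).
Hypothesis m_gt0 : 0 < m.
Hypothesis gU : \forall e \near U, [/\ I e,
  periodic_circle_map (gamma e) m n (g e) & {mono g e : x y / x <= y}].
Variable g0 : R -> R.
Hypotheses (gc : periodic_circle_map (gamma e0) m n g0)
  (mono : {mono g0 : x y / x <= y})
  (gcvg : forall k t, iter k (g e) t @[e --> U] --> iter k g0 t).

Local Notation X k t := (iter k g0 t).
Local Notation orbit e := (periodic_orbit m N (gamma e)).

Lemma ultra_neq a : \forall e \near U, e != a.
Proof.
have [->//|ae] := eqVneq a e0.
apply: Ue0; apply/nbhs_ballP; exists `|e0 - a|.
  by rewrite /= normr_gt0 subr_eq0 eq_sym.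
by move=> e; rewrite /ball/=; apply: contraTneq => ->; rewrite ltxx.
Qed.

Lemma ultra_notin (s : seq R) : \forall e \near U, e \notin s.
Proof.
have : \forall e \near U, forall a, a \in s -> e != a.
  by apply: near_seq => a _; exact: ultra_neq.
apply: filterS => e es; apply/negP => /es; by rewrite eqxx.
Qed.

Lemma ultra_near d : 0 < d -> \forall e \near U, `|e - e0| <= d.
Proof.
move=> d0; apply: Ue0; apply: filterS (nbhsx_ballx e0 d d0) => e.
by rewrite /ball/= distrC => /ltW.
Qed.

Lemma iter_translate k t (q : int) : X k (t + q%:~R) = X k t + q%:~R.
Proof. by elim: k => //= k ->; rewrite (circle_degreez gc). Qed.

Lemma base_uniform del : 0 < del -> exists2 rho : R, 0 < rho &
  forall t b, `|b - t| <= rho -> forall k : 'I_n, `|X k b - X k t| <= del.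
Proof.
move=> del0.
pose Q (rho t : R) := forall b, `|b - t| <= rho -> forall k : 'I_n, `|X k b - X k t| <= del.
apply: (@uniform_cover _ Q) => [t0|rho rho' t /andP[_ le] Qt b br|rho t q Qt b br k].
- have : \forall t \near t0, forall k : 'I_n, `|X k t - X k t0| <= del / 2.
    have FF : Filter (nbhs t0) by exact: nbhs_filter.
    apply: (@filter_forall R _ (fun (k : 'I_n) t => `|X k t - X k t0| <= del / 2)
      (nbhs t0) FF) => k; have d2 : 0 < del / 2 by rewrite divr_gt0.
    have := cvgr_dist_le _ _ (@iter_continuous _ _ k (base_continuous gc mono) t0) _ d2.
    by move=> /(_ FF); apply: (@filterS _ _ FF) => t; rewrite distrC.
  move=> /nbhs_ballP[rho /= rho0 H]; exists (rho / 4); first by rewrite divr_gt0.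
  move=> t tt0 b bt k.
  have h1 : `|X k t - X k t0| <= del / 2.
    apply: H.
    by rewrite /ball/= distrC; lra.
  have h2 : `|X k b - X k t0| <= del / 2.
    apply: H.
    rewrite /ball/= distrC; have -> : b - t0 = (b - t) + (t - t0) by ring.
    by apply: le_lt_trans (ler_normD _ _) _; lra.
  have -> : X k b - X k t = (X k b - X k t0) - (X k t - X k t0) by ring.
  by apply: le_trans (ler_normB _ _) _; lra.
- exact: (Qt b (le_trans br le)).
- rewrite -[b](subrK q%:~R) !iter_translate opprD addrACA subrr addr0.
  by apply: Qt; rewrite -addrA -opprD [_ + t]addrC.
Qed.

Lemma orbit_translate e Z (q : int) : I e -> orbit e Z ->
  orbit e (fun k => Z k + q%:~R).
Proof.
move=> Ie [Zn Zb]; split=> k; first by rewrite Zn addrAC.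
by rewrite !(heightzD (family_oval A Ie)) !(heightDz (family_oval A Ie)).
Qed.

Lemma orbit_shift e Z : orbit e Z -> orbit e (fun k => Z k.+1).
Proof. by move=> [Zn Zb]; split=> k; [rewrite -addSn Zn|exact: Zb]. Qed.

(** The given circle maps supply a periodic orbit from [t] at infinitely many
    parameters. *)
Lemma many_orbits t0 t d r : 0 < d -> 0 < r ->
  (forall k : 'I_n, `|X k t - X k t0| <= r / 4) ->
  forall s : seq R, exists e Z, [/\ I e, e \notin s, `|e - e0| <= d, orbit e Z &
    Z 0%N = t /\ forall k : 'I_n, `|Z k - X k t0| <= r / 2].
Proof.
move=> d0 r0 tt0 s; have r4 : 0 < r / 4 by rewrite divr_gt0.
have nk : \forall e \near U, forall k : 'I_n, `|X k t - iter k (g e) t| <= r / 4.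
  by apply: filter_forall => k; exact: cvgr_dist_le _ _ (@gcvg k t) _ r4.
have [e [[[Ie ge _] es] [ed ek]]] :=
  filter_ex (filterI (filterI gU (ultra_notin s)) (filterI (ultra_near d0) nk)).
exists e, (fun k => iter k (g e) t); split=> //; first exact: circle_orbit.
split=> // k; have h := ek k.
have -> : iter k (g e) t - X k t0 = (X k t - X k t0) - (X k t - iter k (g e) t) by ring.
by apply: le_trans (ler_normB _ _) _; have := tt0 k; lra.
Qed.

Lemma continuation_exists del : 0 < del -> exists2 rho : R, 0 < rho &
  forall t e, I e -> `|e - e0| <= rho ->
    exists Z, [/\ orbit e Z, Z 0%N = t & forall k : 'I_n, `|Z k - X k t| <= del].
Proof.
move=> del0.
pose Q (rho t : R) := forall e, I e -> `|e - e0| <= rho ->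
    exists Z, [/\ orbit e Z, Z 0%N = t & forall k : 'I_n, `|Z k - X k t| <= del].
apply: (@uniform_cover _ Q) => [t0|rho rho' t /andP[_ le] Qt e Ie er|rho t q Qt e Ie er].
- have [r0 [kappa [r00 /andP[kap0 kap1] loc]]] := local_continuation A Ie0 gc mono t0.
  pose r := Num.min r0 del.
  have r_gt0 : 0 < r by rewrite lt_min r00.
  have rr0 : r <= r0 by rewrite ge_min lexx.
  have rdel : r <= del by rewrite ge_min lexx orbT.
  clearbody r; have kr0 : 0 < kappa * r by exact: mulr_gt0.
  have r4 : 0 < r / 4 by rewrite divr_gt0.
  have [rho1 rho10 unif] := base_uniform r4.
  have [_ ex] : _ /\ _ := loc r (introT andP (conj r_gt0 rr0)).
  exists (Num.min rho1 (kappa * r / 4)); first by rewrite lt_min rho10 divr_gt0.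
  move=> t; rewrite le_min => /andP[t1 t2] e Ie; rewrite le_min => /andP[_ er].
  have tX := unif _ _ t1.
  have k8 : 0 < kappa * r / 8 by rewrite divr_gt0.
  have tk : `|t - t0| <= kappa * r / 2 by lra.
  have [Z [oZ Z0 Zr]] := ex t tk (many_orbits k8 r_gt0 tX) e Ie er.
  exists Z; split=> // k.
  have -> : Z k - X k t = (Z k - X k t0) - (X k t - X k t0) by ring.
  by apply: le_trans (ler_normB _ _) _; have := Zr k; have := tX k; lra.
- exact: Qt Ie (le_trans er le).
- have [Z [oZ Z0 Zr]] := Qt e Ie er; exists (fun k => Z k + q%:~R); split.
  + exact: orbit_translate.
  + by rewrite Z0.
  + by move=> k; rewrite iter_translate opprD addrACA subrr addr0.
Qed.

Lemma continuation_unique : exists2 rho : R, 0 < rho &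
  forall t e, I e -> `|e - e0| <= rho -> forall Z Z', orbit e Z -> orbit e Z' ->
    (forall k : 'I_n, `|Z k - X k t| <= rho) ->
    (forall k : 'I_n, `|Z' k - X k t| <= rho) ->
    forall k : 'I_n, `|Z k - Z' k| <= rho^-1 * `|Z 0%N - Z' 0%N|.
Proof.
pose Q (rho t : R) := forall e, I e -> `|e - e0| <= rho ->
  forall Z Z', orbit e Z -> orbit e Z' ->
    (forall k : 'I_n, `|Z k - X k t| <= rho) ->
    (forall k : 'I_n, `|Z' k - X k t| <= rho) ->
    forall k : 'I_n, `|Z k - Z' k| <= rho^-1 * `|Z 0%N - Z' 0%N|.
apply: (@uniform_cover _ Q).
- move=> t0.
  have [r [kappa [r0 /andP[kap0 kap1] loc]]] := local_continuation A Ie0 gc mono t0.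
  have kr0 : 0 < kappa * r by exact: mulr_gt0.
  have r4 : 0 < r / 4 by rewrite divr_gt0.
  have [rho1 rho10 unif] := base_uniform r4.
  have [un _] : _ /\ _ := loc r (introT andP (conj r0 (lexx r))).
  exists (Num.min rho1 (Num.min (kappa * r / 4) (Num.min (r / 4) kappa))).
    by rewrite !lt_min rho10 kap0 !divr_gt0.
  set rho := Num.min _ _.
  have [h1 h2 h3 h4] : [/\ rho <= rho1, rho <= kappa * r / 4, rho <= r / 4 & rho <= kappa].
    by rewrite /rho !ge_min !lexx !orbT.
  have rho0 : 0 < rho by rewrite /rho !lt_min rho10 kap0 !divr_gt0.
  clearbody rho.
  move=> t tt0 e Ie er Z Z' oZ oZ' Zr Zr' k.
  have tX := unif _ _ (le_trans tt0 h1).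
  have near0 (Y : nat -> R) : (forall k : 'I_n, `|Y k - X k t| <= rho) ->
      `|Y 0%N - t0| <= kappa * r / 2.
    move=> /(_ ord0) /= Y0; have -> : Y 0%N - t0 = (Y 0%N - t) + (t - t0) by ring.
    by apply: le_trans (ler_normD _ _) _; lra.
  have neark (Y : nat -> R) : (forall k : 'I_n, `|Y k - X k t| <= rho) ->
      forall k : 'I_n, `|Y k - X k t0| <= r / 2.
    move=> Yr j; have -> : Y j - X j t0 = (Y j - X j t) + (X j t - X j t0) by ring.
    by apply: le_trans (ler_normD _ _) _; have := Yr j; have := tX j; lra.
  have er' : `|e - e0| <= kappa * r by lra.
  apply: le_trans (un e Z Z' Ie er' oZ oZ' (near0 _ Zr) (near0 _ Zr')
    (neark _ Zr) (neark _ Zr') k) _.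
  by rewrite mulrC; apply: ler_wpM2r => //; rewrite lef_pV2 ?posrE.
- move=> rho rho' t /andP[rho'0 le] Qt e Ie er Z Z' oZ oZ' Zr Zr' k.
  have H := Qt e Ie (le_trans er le) Z Z' oZ oZ' (fun j => le_trans (Zr j) le)
    (fun j => le_trans (Zr' j) le) k.
  apply: le_trans H _; apply: ler_wpM2r => //.
  by rewrite lef_pV2 ?posrE// (lt_le_trans rho'0).
- move=> rho t q Qt e Ie er Z Z' oZ oZ' Zr Zr' k.
  have tr (Y : nat -> R) : (forall k : 'I_n, `|Y k - X k (t + q%:~R)| <= rho) ->
      forall k : 'I_n, `|Y k + (- q)%:~R - X k t| <= rho.
    move=> Yr j; have := Yr j; rewrite iter_translate intrN.
    by have -> : Y j - (X j t + q%:~R) = Y j - q%:~R - X j t by ring.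
  have := Qt e Ie er _ _ (orbit_translate (- q) Ie oZ) (orbit_translate (- q) Ie oZ')
    (tr _ Zr) (tr _ Zr') k.
  by rewrite !opprD !addrA ![_ + (- q)%:~R - _]addrAC !subrK.
Qed.

Lemma phase_uniform : exists2 rho : R, 0 < rho &
  forall t e a b, I e -> `|e - e0| <= rho -> `|a - t| <= rho ->
    `|b - g0 t| <= rho -> phase (gamma e) a b.
Proof.
pose Q (rho t : R) := forall e a b, I e -> `|e - e0| <= rho -> `|a - t| <= rho ->
    `|b - g0 t| <= rho -> phase (gamma e) a b.
apply: (@uniform_cover _ Q) => [t0|rho sig t /andP[_ le] Qt e a b Ie es ar br|
    rho t k Qt e a b Ie er ar br].
- have [/andP[tg gt] pt] := circle_phase gc t0.
  pose F := within (fun z : R * R * R => I z.1.1) (nbhs ((e0, t0), g0 t0)).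
  have FF : Filter F by exact: within_filter.
  have FI : \forall z \near F, I z.1.1 by apply: withinT.
  have Fn : F --> nbhs ((e0, t0), g0 t0) by exact: cvg_within.
  have F1 : z.1.1 @[z --> F] --> e0.
    by apply: (cvg_trans (cvg_app _ Fn)); apply: cvg_comp; exact: cvg_fst.
  have F2 : z.1.2 @[z --> F] --> t0.
    apply: (cvg_trans (cvg_app _ Fn)).
    by apply: (@cvg_comp _ _ _ fst snd); [exact: cvg_fst|exact: cvg_snd].
  have F3 : z.2 @[z --> F] --> g0 t0.
    by apply: (cvg_trans (cvg_app _ Fn)); exact: cvg_snd.
  have tz := @tangents_cvg _ _ _ A _ _ _ _ F _ _ _ FF Ie0 FI F1 F2 F3.
  have := cvgr_gt _ tz _ pt; move=> /(_ (within_filter _ _)) /nbhs_ballP[rho /= rho0 H].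
  pose r := Num.min rho (Num.min ((g0 t0 - t0) / 2) ((t0 + 1 - g0 t0) / 2)).
  have r0 : 0 < r by rewrite !lt_min rho0 !divr_gt0// ?subr_gt0.
  have [r1 r2 r3] : [/\ r <= rho, r <= (g0 t0 - t0) / 2 & r <= (t0 + 1 - g0 t0) / 2].
    by rewrite /r !ge_min !lexx !orbT.
  clearbody r; have r40 : 0 < r / 4 by rewrite divr_gt0.
  have := cvgr_dist_le _ _ (@iter_continuous _ _ 1 (base_continuous gc mono) t0) _ r40.
  move=> /(_ (nbhs_filter _)) /nbhs_ballP[d /= d0 D].
  exists (Num.min (d / 2) (r / 4)); first by rewrite lt_min divr_gt0.
  move=> t; rewrite le_min => /andP[td tr] e a b Ie.
  rewrite !le_min => /andP[_ er] /andP[_ ar] /andP[_ br].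
  have gtt : `|g0 t0 - g0 t| <= r / 4.
    by apply: D; rewrite /ball/= distrC; lra.
  have ar' : `|a - t0| < r.
    have -> : a - t0 = (a - t) + (t - t0) by ring.
    by apply: le_lt_trans (ler_normD _ _) _; lra.
  have br' : `|b - g0 t0| < r.
    have -> : b - g0 t0 = (b - g0 t) - (g0 t0 - g0 t) by ring.
    by apply: le_lt_trans (ler_normB _ _) _; lra.
  split.
    by move: ar' br'; rewrite !ltr_norml => /andP[? ?] /andP[? ?]; apply/andP; split; lra.
  by apply: (H (e, a, b)) => //; split; [split|]; rewrite /ball/= distrC; lra.
- apply: Qt => //; exact: le_trans le.
- apply/(phaseDz (family_oval A Ie) (- k)); apply: Qt => //.
    by rewrite intrN; have -> : a + - k%:~R - t = a - (t + k%:~R) by ring.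
  rewrite (circle_degreez gc) in br; rewrite intrN.
  by have -> : b + - k%:~R - g0 t = b - (g0 t + k%:~R) by ring.
Qed.

(** The circle map for the new parameter sends [t] to the next point of the
    continued orbit from [t].  Uniqueness makes the orbits of all points fit
    together, and the Lipschitz dependence of orbits on their starting point makes
    the curve Lipschitz. *)
Lemma curve_near : exists2 rho : R, 0 < rho & forall e, I e -> `|e - e0| <= rho ->
  exists eta, periodic_invariant_curve (gamma e) m n eta.
Proof.
have n1 : (1 < n)%N.
  have := circle_rotation_lt (family_oval A Ie0) (isT : (0 < n)%N) gc.
  rewrite -[2]/(2%:~R) -[n%:R]/((n%:Z)%:~R) -intrM ltr_int; move: m_gt0; lia.
have [rU rU0 uniq] := continuation_unique.
have [rP rP0 ph] := phase_uniform.
(* The orbit from [t], shifted by one step, has to be recognized as the orbit from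
   [g1 t]; it is close to the base orbit of [t] by construction, and the base
   orbits of [g1 t] and [g0 t] are within [rU / 2]. *)
have rU2 : 0 < rU / 2 by rewrite divr_gt0.
have [rC rC0 base] := base_uniform rU2.
pose del := Num.min (rU / 2) (Num.min rP rC).
have del0 : 0 < del by rewrite !lt_min rU2 rP0.
have [dU dP dC] : [/\ del <= rU / 2, del <= rP & del <= rC].
  by rewrite /del !ge_min !lexx !orbT.
clearbody del; have [rE rE0 ex] := continuation_exists del0.
exists (Num.min rU (Num.min rP rE)); first by rewrite !lt_min rU0 rP0.
move=> e Ie; rewrite !le_min => /and3P[eU eP eE].
have Oe := family_oval A Ie.
have [Z Zp] := choice (fun t => ex t e Ie eE).
have oZ t : orbit e (Z t) by case: (Zp t).
have Z0 t : Z t 0%N = t by case: (Zp t).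
have Zn t : Z t n = t + m%:~R by have [zn _] := oZ t; rewrite -[n]add0n zn Z0.
have Zr t k : (k <= n)%N -> `|Z t k - X k t| <= del.
  rewrite leq_eqVlt => /predU1P[->|kn]; last by case: (Zp t) => _ _ /(_ (Ordinal kn)).
  by rewrite Zn (circle_iter gc) subrr normr0 ltW.
have un t Y : orbit e Y -> Y 0%N = t -> (forall k : 'I_n, `|Y k - X k t| <= rU) ->
    forall i, Y i = Z t i.
  move=> oY Y0 Yr i; rewrite (lift_mod i (proj1 oY)) (lift_mod i (proj1 (oZ t))).
  congr (_ + _); have ik : (i %% n < n)%N by rewrite ltn_pmod.
  have Zr' (k : 'I_n) : `|Z t k - X k t| <= rU.
    by apply: le_trans (Zr t k (ltnW (ltn_ord k))) _; lra.
  have := uniq t e Ie eU Y (Z t) oY (oZ t) Yr Zr' (Ordinal ik).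
  by rewrite Y0 Z0 subrr normr0 mulr0 normr_le0 subr_eq0 => /eqP.
pose g1 t := Z t 1%N.
have g1r t : `|g1 t - g0 t| <= del by exact: (Zr t 1%N (ltnW n1)).
have shift t i : Z (g1 t) i = Z t i.+1.
  apply/esym; apply: (un (g1 t) (fun k => Z t k.+1)) => //; first exact: orbit_shift.
  move=> k; have -> : Z t k.+1 - X k (g1 t) =
    (Z t k.+1 - X k.+1 t) - (X k (g1 t) - X k (g0 t)) by rewrite iterSr; ring.
  apply: le_trans (ler_normB _ _) _.
  have := Zr t k.+1 (ltn_ord k).
  by have := base (g0 t) (g1 t) (le_trans (g1r t) dC) k; lra.
have it k t : iter k g1 t = Z t k.
  by elim: k t => [|k IHk] t; [rewrite Z0|rewrite iterSr IHk shift].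
have g1c : periodic_circle_map (gamma e) m n g1.
  split=> t.
  - apply: (ph t) => //; first by rewrite subrr normr0 ltW.
    exact: le_trans (g1r t) dP.
  - have [_ /(_ 0%N)] := oZ t; rewrite Z0 => b.
    by rewrite -[g1 (g1 t)]/(Z (g1 t) 1%N) shift.
  - rewrite -[g1 (t + 1)]/(Z (t + 1) 1%N); apply/esym.
    apply: (un (t + 1) (fun k => Z t k + 1%:~R)).
    + exact: orbit_translate.
    + by rewrite Z0.
    + move=> k; rewrite (iter_translate k t 1) opprD addrACA subrr addr0.
      by have := Zr t k (ltnW (ltn_ord k)); lra.
  - by rewrite it Zn.
have g1l t u : `|t - u| <= del -> `|g1 t - g1 u| <= rU^-1 * `|t - u|.
  move=> tu; have := uniq t e Ie eU (Z t) (Z u) (oZ t) (oZ u).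
  rewrite !Z0 => H; apply: (H _ _ (Ordinal n1)) => k.
    by apply: le_trans (Zr t k (ltnW (ltn_ord k))) _; lra.
  have -> : Z u k - X k t = (Z u k - X k u) + (X k u - X k t) by ring.
  apply: le_trans (ler_normD _ _) _.
  have := Zr u k (ltnW (ltn_ord k)).
  have ut : `|u - t| <= rC by rewrite distrC; exact: le_trans dC.
  by have := base t u ut k; lra.
exists (fun t => height (gamma e) t (g1 t)); apply: (curve_of_circle_map Oe g1c).
apply: bounded_lipschitzP; rewrite height.unlock /omega.
have d1 : bounded_lipschitz (fun t => (derive1 (gamma e) t).1).
  apply: (analytic_bounded_lipschitz (f := fun e t => (derive1 (gamma e) t).1) Ie).
    by move=> x; exact: (family_dan1 A).
  by move=> x k; rewrite (derive1_per Oe).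
have d2 : bounded_lipschitz (fun t => (derive1 (gamma e) t).2).
  apply: (analytic_bounded_lipschitz (f := fun e t => (derive1 (gamma e) t).2) Ie).
    by move=> x; exact: (family_dan2 A).
  by move=> x k; rewrite (derive1_per Oe).
have c1 : bounded_lipschitz (fun t => (gamma e t).1).
  apply: (analytic_bounded_lipschitz (f := fun e t => (gamma e t).1) Ie).
    by move=> x; exact: (family_an1 A).
  by move=> x k; rewrite (oval_perz Oe).
have c2 : bounded_lipschitz (fun t => (gamma e t).2).
  apply: (analytic_bounded_lipschitz (f := fun e t => (gamma e t).2) Ie).
    by move=> x; exact: (family_an2 A).
  by move=> x k; rewrite (oval_perz Oe).
apply: bounded_lipschitzB; apply: bounded_lipschitzM => //.
  exact: (bounded_lipschitz_comp c2 del0 g1l).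
exact: (bounded_lipschitz_comp c1 del0 g1l).
Qed.

End global.

(** * The set of parameters with an invariant curve *)

Section limit_points.
Variables (R : realType) (I : set R) (gamma : R -> R -> R * R).
Hypothesis A : analytic_ovals I gamma.
Variables (m : int) (n : nat).
Hypotheses (m_gt0 : 0 < m) (n_gt0 : (0 < n)%N).
Local Notation S := (parameters_with_curve I gamma m n).

(** The invariant curves of an ultrafilter of parameters converge to one at [e0],
    and all the periodic orbits of the latter continue to every nearby
    parameter. *)
Lemma curves_near_limit_point e0 : I e0 -> limit_point S e0 ->
  exists2 rho : R, 0 < rho & forall e, I e -> `|e - e0| <= rho -> S e.
Proof.
move=> Ie0 Se0; pose F := within (fun e => S e /\ e != e0) (nbhs e0).
have PF : ProperFilter F.
  have FF : Filter F by exact: within_filter.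
  by split=> // /Se0[e [ne Se]]; apply.
have [U [UU FU]] := ultraFilterLemma PF.
have Ue0 : U --> e0 by move=> V Ve; apply: FU; apply: (filterS _ Ve) => e Vee _.
have [US Une0] : (\forall e \near U, S e) /\ (\forall e \near U, e != e0).
  by split; apply: FU; apply: (@filterE _ (nbhs e0)) => e [].
have map_of_curve e : exists h, S e -> periodic_circle_map (gamma e) m n h /\
    {mono h : x y / x <= y}.
  have [Se|] := pselect (S e); last by exists id.
  have [Ie [eta curve]] := Se; have Oe := family_oval A Ie.
  have gc := circle_map_of_curve Oe curve.
  exists (fun t => (of_ts (gamma e) (t, eta t)).2) => _; split=> //.
  by apply: (circle_increasing n_gt0 gc); exact: (circle_map_of_curve_continuous Oe curve).
have [g gP] := choice map_of_curve.
have gU : \forall e \near U, [/\ I e, periodic_circle_map (gamma e) m n (g e) &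
    {mono g e : x y / x <= y}].
  by apply: filterS US => e Se; have [Ie _] := Se; have [] := gP e Se.
have [g0 [gc mono gcvg]] := ultralimit_circle_map A Ie0 Ue0 m_gt0 n_gt0 gU.
case: n n_gt0 gP gU gc gcvg => // N _ gP gU gc gcvg.
have [rho rho0 near_curve] := curve_near A Ie0 Ue0 Une0 m_gt0 gU gc mono gcvg.
by exists rho => // e Ie er; split=> //; exact: near_curve.
Qed.

Hypothesis I_itv : is_interval I.

Lemma limit_point_near e0 : I e0 -> limit_point S e0 ->
  \forall e \near e0, I e -> limit_point S e.
Proof.
move=> Ie0 Se0; have [rho rho0 rhoS] := curves_near_limit_point Ie0 Se0.
apply: filterS (nbhsx_ballx e0 rho rho0) => e; rewrite /ball/= => er Ie.
have [->//|ee0] := eqVneq e e0.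
move=> V /nbhs_ballP[d /= d0 dV].
have ed : 0 < `|e0 - e| by rewrite normr_gt0 subr_eq0 eq_sym.
pose s := Num.min (1 / 2) (d / (2 * `|e0 - e|)).
have s0 : 0 < s by rewrite lt_min !divr_gt0// mulr_gt0.
have s1 : s <= 1 / 2 by rewrite ge_min lexx.
have sd : s * `|e0 - e| <= d / 2.
  by rewrite -ler_pdivlMr// -mulrA -invfM ge_min lexx orbT.
clearbody s; pose y := e + s * (e0 - e).
have ye : `|y - e| = s * `|e0 - e| by rewrite /y addrC addKr normrM gtr0_norm.
(* A point slightly off [e] in the direction of [e0]: it stays in the interval. *)
exists y; split.
- by rewrite -subr_eq0 -normr_gt0 ye mulr_gt0.
- apply: rhoS.
    have [le|lt] := leP e e0.
      have sp : 0 <= s * (e0 - e) by rewrite mulr_ge0 ?(ltW s0)// subr_ge0.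
      have sq : 0 <= (1 - s) * (e0 - e) by rewrite mulr_ge0 ?subr_ge0//; lra.
      by apply: (I_itv Ie Ie0); rewrite /y; apply/andP; split; lra.
    have sp : 0 <= s * (e - e0) by rewrite mulr_ge0 ?(ltW s0)// subr_ge0 ltW.
    have sq : 0 <= (1 - s) * (e - e0) by rewrite mulr_ge0 ?subr_ge0 ?(ltW lt)//; lra.
    by apply: (I_itv Ie0 Ie); rewrite /y; apply/andP; split; lra.
  have -> : y - e0 = - ((1 - s) * (e0 - e)) by rewrite /y; ring.
  rewrite normrN normrM ger0_norm; last lra.
  by have := mulr_ge0 (ltW s0) (ltW ed); lra.
- by apply: dV; rewrite /ball/= distrC ye; lra.
Qed.

(** Limit points in [I] form a closed and open subset of a connected set. *)
Lemma limit_point_everywhere : I `&` limit_point S !=set0 -> S = I.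
Proof.
move=> ne.
have limI : I `&` limit_point S = I.
  apply: ((connected_intervalP I).2 I_itv) => //.
    exists [set e | I e -> limit_point S e]°; first exact: open_interior.
    apply/seteqP; split=> e [Ie Se]; split=> //; first exact: limit_point_near.
    exact: (interior_subset Se).
  exists (limit_point S) => //; apply: limit_point_closed.
  exact/hausdorff_accessible/Rhausdorff.
apply/seteqP; split=> [e []//|e Ie].
have [_ Se] : (I `&` limit_point S) e by rewrite limI.
have [rho rho0 rhoS] := curves_near_limit_point Ie Se.
by apply: rhoS => //; rewrite subrr normr0 ltW.
Qed.

(** An infinite subset of a compact set accumulates in that set. *)
Lemma finite_parameters : (forall K : set R, compact K -> K `<=` I ->
  finite_set (S `&` K)) \/ S = I.
Proof.
have [|none] := pselect (I `&` limit_point S !=set0).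
  by right; exact: limit_point_everywhere.
left=> K cK KI; apply: contrapT => inf; apply: none.
have bK : bounded_set (S `&` K).
  have [M [rM KM]] := compact_bounded cK; exists M; split=> // x Mx e [_ Ke].
  exact: KM Mx e Ke.
have [e lim] := infinite_bounded_limit_point_nonempty inf bK.
exists e; split.
  apply: KI; apply: (compact_closed (@Rhausdorff R) cK).
  apply: subset_limit_point => V /lim[y [ye [_ Ky] Vy]]; by exists y.
by move=> V /lim[y [ye [Sy _] Vy]]; exists y.
Qed.

End limit_points.

Theorem theorem20 (R : realType) (I : set R) (Omega : R -> set (R * R))
    (gamma : R -> R -> R * R) (m : int) (n : nat)
    (I_itv : is_interval I)
    (Omega_convex : forall e, I e -> strictly_convex_domain (Omega e))
    (family : analytic_family I Omega gamma)
    (n_gt0 : (0 < n)%N)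
    (mn_coprime : coprimez m n%:Z)
    (mn_itv : 0 < (m%:~R / n%:R : R) < 1) :
  let S := parameters_with_curve I gamma m n in
  (compact I -> finite_set S \/ S = I) /\
  ((forall K : set R, compact K -> K `<=` I -> finite_set (S `&` K)) \/ S = I).
Proof.
have m_gt0 : 0 < m.
  case/andP: mn_itv => + _.
  by rewrite pmulr_lgt0 ?invr_gt0 ?ltr0n// ltr0z.
have fin := finite_parameters (analytic_ovalsP Omega_convex family) m_gt0 n_gt0 I_itv.
move=> S; split=> // cI; case: fin => [fin|]; [left|by right].
by have := fin I cI (@subset_refl _ I); rewrite setIidl// => e [].
Qed.
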